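(* Let $Y$ be a regular complex Banach space and let $0<p\le 1$. Then $H_p(\mathbb{D},Y)\simeq H_p(\mathbb{T},Y)$, i.e., these quasi-Banach spaces are (complex-linearly) isomorphic.
   Context: A complex Banach space is regular if it is isomorphic to the complexification of a real Banach space. $\mathbb{D}$ is the open unit disc of $\mathbb{C}$. $H_p(\mathbb{D},Y)$ is the quasi-Banach space of all analytic $F\colon\mathbb{D}\to Y$ with $\sup_{0\le r<1}\big(\int_{-1/2}^{1/2}\|F(re^{2\pi i t})\|_Y^p\,dt\big)^{1/p}<\infty$. Functions on the torus $\mathbb{T}$ are regarded as $1$-periodic functions on $\mathbb{R}$; $I=[-1/2,1/2)$. $\mathcal{D}'(\mathbb{T},Y)$ is the space of continuous linear maps from $\mathcal{C}^{(\infty)}(\mathbb{T},\mathbb{C})$ (with its usual Fréchet topology) into $Y$. For $0\le r<1$ and $t\in\mathbb{R}$, $P_r(t)=\operatorname{Re}\frac{1+re^{2\pi it}}{1-re^{2\pi it}}$ and $Q_r(t)=\operatorname{Im}\frac{1+re^{2\pi it}}{1-re^{2\pi it}}$. For $f\in\mathcal{D}'(\mathbb{T},Y)$, $(P_r*f)(t)=f(P_r(t-\cdot))$, and likewise for $Q_r$. $H_p(\mathbb{T},Y)$ is the quasi-Banach space of all $f\in\mathcal{D}'(\mathbb{T},Y)$ with $$\|f\|_{H_p(\mathbb{T},Y)}=\sup_{0\le r<1}\Big(\int_I\|P_r*f\|_Y^p+\|Q_r*f\|_Y^p\Big)^{1/p}<\infty.$$ *)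

(* Defs.v *)
From Stdlib Require Import Reals Lra Lia FunctionalExtensionality ProofIrrelevance.
From Coquelicot Require Import Coquelicot.

Open Scope R_scope.

Section FctModule.
Context {K : Ring} (T : Type) (V : ModuleSpace K).

Definition fct_AbelianMonoid_mixin : AbelianMonoid.mixin_of (T -> V).
Proof.
  apply (AbelianMonoid.Mixin (T -> V) (fun (f g : T -> V) t => plus (f t) (g t)) (fun _ => zero));
    intros; apply functional_extensionality; intros t.
  - apply plus_comm.
  - apply plus_assoc.
  - apply plus_zero_r.
Defined.

Definition fct_AbelianGroup_mixin :
  AbelianGroup.mixin_of (AbelianMonoid.Pack (T -> V) fct_AbelianMonoid_mixin (T -> V)).
Proof.
  apply (AbelianGroup.Mixin (AbelianMonoid.Pack (T -> V) fct_AbelianMonoid_mixin (T -> V)) (fun (f : T -> V) t => opp (f t))).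
  intros f; apply functional_extensionality; intros t.
  exact (plus_opp_r (f t)).
Defined.

Definition fct_AbelianGroup : AbelianGroup :=
  AbelianGroup.Pack (T -> V)
    (AbelianGroup.Class _ fct_AbelianMonoid_mixin fct_AbelianGroup_mixin) (T -> V).

Definition fct_ModuleSpace_mixin : ModuleSpace.mixin_of K fct_AbelianGroup.
Proof.
  apply (ModuleSpace.Mixin K fct_AbelianGroup (fun k (f : T -> V) t => scal k (f t)));
    intros; apply functional_extensionality; intros t.
  - exact (scal_assoc x y (u t)).
  - exact (scal_one (u t)).
  - exact (scal_distr_l x (u t) (v t)).
  - exact (scal_distr_r x y (u t)).
Defined.

Definition fct_ModuleSpace : ModuleSpace K :=
  ModuleSpace.Pack K (T -> V)
    (ModuleSpace.Class K (T -> V) _ fct_ModuleSpace_mixin) (T -> V).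

End FctModule.

Record submodule {K : Ring} {V : ModuleSpace K} (P : V -> Prop) : Prop := {
  submodule_zero : P zero;
  submodule_plus : forall x y, P x -> P y -> P (plus x y);
  submodule_scal : forall k x, P x -> P (scal k x)
}.

Section SubModule.
Context {K : Ring} {V : ModuleSpace K} {P : V -> Prop} (HP : submodule P).

Lemma sub_eq (x y : {v : V | P v}) : proj1_sig x = proj1_sig y -> x = y.
Proof.
  destruct x as [x Hx], y as [y Hy]; simpl; intros E; subst y.
  f_equal; apply proof_irrelevance.
Qed.

Lemma submodule_opp (x : V) : P x -> P (opp x).
Proof.
  intros Hx; rewrite <- (scal_opp_one x); now apply (submodule_scal _ HP).
Qed.

Definition sub_AbelianMonoid_mixin : AbelianMonoid.mixin_of {v : V | P v}.
Proof.
  apply (AbelianMonoid.Mixin {v : V | P v}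
    (fun x y => exist P (plus (proj1_sig x) (proj1_sig y))
       (submodule_plus _ HP _ _ (proj2_sig x) (proj2_sig y)))
    (exist P zero (submodule_zero _ HP)));
    intros; apply sub_eq; simpl.
  - apply plus_comm.
  - apply plus_assoc.
  - apply plus_zero_r.
Defined.

Definition sub_AbelianGroup_mixin :
  AbelianGroup.mixin_of
    (AbelianMonoid.Pack {v : V | P v} sub_AbelianMonoid_mixin {v : V | P v}).
Proof.
  apply (AbelianGroup.Mixin (AbelianMonoid.Pack _ sub_AbelianMonoid_mixin {v : V | P v})
    (fun x => exist P (opp (proj1_sig x)) (submodule_opp _ (proj2_sig x)))).
  intros x; apply sub_eq; exact (plus_opp_r (proj1_sig x)).
Defined.

Definition sub_AbelianGroup : AbelianGroup :=
  AbelianGroup.Pack {v : V | P v}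
    (AbelianGroup.Class _ sub_AbelianMonoid_mixin sub_AbelianGroup_mixin) {v : V | P v}.

Definition sub_ModuleSpace_mixin : ModuleSpace.mixin_of K sub_AbelianGroup.
Proof.
  apply (ModuleSpace.Mixin K sub_AbelianGroup
    (fun k x => exist P (scal k (proj1_sig x))
       (submodule_scal _ HP k _ (proj2_sig x))));
    intros; apply sub_eq.
  - exact (scal_assoc x y (proj1_sig u)).
  - exact (scal_one (proj1_sig u)).
  - exact (scal_distr_l x (proj1_sig u) (proj1_sig v)).
  - exact (scal_distr_r x y (proj1_sig u)).
Defined.

Definition sub_ModuleSpace : ModuleSpace K :=
  ModuleSpace.Pack K {v : V | P v}
    (ModuleSpace.Class K {v : V | P v} _ sub_ModuleSpace_mixin) {v : V | P v}.

End SubModule.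

Lemma plus_plus (G : AbelianMonoid) (x y z t : G) :
  plus (plus x y) (plus z t) = plus (plus x z) (plus y t).
Proof.
  rewrite <- !plus_assoc; f_equal.
  now rewrite !plus_assoc, (plus_comm y z).
Qed.

Section Complexification.
Context (X : NormedModule R_AbsRing).

Let lin (a b : R) (x y : X) : X :=
  plus (scal (a : R_AbsRing) x) (scal (b : R_AbsRing) y).

Lemma lin_scal (k a b : R) (x y : X) :
  scal (k : R_AbsRing) (lin a b x y) = lin (k * a) (k * b) x y.
Proof.
  unfold lin.
  etransitivity; [refine (scal_distr_l _ _ _)|].
  f_equal; refine (scal_assoc _ _ _).
Qed.

Lemma lin_plus (a b c d : R) (x y : X) :
  plus (lin a b x y) (lin c d x y) = lin (a + c) (b + d) x y.
Proof.
  unfold lin; rewrite plus_plus.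
  f_equal; symmetry; refine (scal_distr_r _ _ _).
Qed.

Lemma lin_distr (a b : R) (x y z t : X) :
  lin a b (plus x z) (plus y t) = plus (lin a b x y) (lin a b z t).
Proof.
  unfold lin; rewrite <- plus_plus.
  f_equal; refine (scal_distr_l _ _ _).
Qed.

Lemma lin_lin (a b c d e f : R) (x y : X) :
  lin a b (lin c d x y) (lin e f x y) = lin (a * c + b * e) (a * d + b * f) x y.
Proof.
  unfold lin at 1; rewrite !lin_scal, lin_plus; reflexivity.
Qed.

Lemma scal0 (u : X) : scal (0 : R_AbsRing) u = zero.
Proof. refine (scal_zero_l _). Qed.

Lemma scal1 (u : X) : scal (1 : R_AbsRing) u = u.
Proof. refine (scal_one _). Qed.

Lemma lin_10 (x y : X) : lin 1 0 x y = x.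
Proof. unfold lin; rewrite scal0, scal1; apply plus_zero_r. Qed.

Lemma lin_01 (x y : X) : lin 0 1 x y = y.
Proof. unfold lin; rewrite scal0, scal1; apply plus_zero_l. Qed.

(* The pair [(x, y)] stands for [x + i y]. *)
Definition cplx_scal (c : C) (z : X * X) : X * X :=
  (plus (scal (Re c : R_AbsRing) (fst z)) (scal (- Im c : R_AbsRing) (snd z)),
   plus (scal (Im c : R_AbsRing) (fst z)) (scal (Re c : R_AbsRing) (snd z))).

(* The Taylor norm of [z]: the supremum of the norms of the real parts of
   [w z] over the complex numbers [w] of modulus at most [1]. *)
Definition cplx_norm_set (z : X * X) (v : R) : Prop :=
  exists w : C, Cmod w <= 1 /\ v = norm (fst (cplx_scal w z)).

Definition cplx_norm (z : X * X) : R := real (Lub_Rbar (cplx_norm_set z)).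

Lemma cplx_scalE c z :
  cplx_scal c z = (lin (Re c) (- Im c) (fst z) (snd z), lin (Im c) (Re c) (fst z) (snd z)).
Proof. reflexivity. Qed.

Definition cplx_AbelianGroup : AbelianGroup := prod_AbelianGroup X X.

Definition cplx_ModuleSpace_mixin : ModuleSpace.mixin_of C_Ring cplx_AbelianGroup.
Proof.
  apply (ModuleSpace.Mixin C_Ring cplx_AbelianGroup cplx_scal).
  - intros [a b] [c d] [x y]; rewrite !cplx_scalE; simpl; rewrite !lin_lin.
    f_equal; f_equal; unfold mult; simpl; ring.
  - intros [x y]; rewrite !cplx_scalE; simpl; rewrite Ropp_0.
    now rewrite lin_10, lin_01.
  - intros [a b] [x y] [z t]; rewrite !cplx_scalE; simpl; rewrite !lin_distr.
    reflexivity.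
  - intros [a b] [c d] [x y]; rewrite !cplx_scalE; simpl.
    apply (f_equal2 pair); simpl; rewrite lin_plus;
      f_equal; unfold plus; simpl; ring.
Defined.

Definition cplx_ModuleSpace_class : ModuleSpace.class_of C_Ring (X * X) :=
  ModuleSpace.Class C_Ring (X * X) _ cplx_ModuleSpace_mixin.

Definition cplx_NormedModuleAux : NormedModuleAux C_AbsRing :=
  NormedModuleAux.Pack C_AbsRing (X * X)
    (NormedModuleAux.Class C_AbsRing (X * X) cplx_ModuleSpace_class
       (UniformSpace.class (prod_UniformSpace X X))) (X * X).

Lemma cplx_re_le (w : C) (z : X * X) :
  Cmod w <= 1 -> norm (fst (cplx_scal w z)) <= norm (fst z) + norm (snd z).
Proof.
  intros Hw; simpl.
  assert (H1 := Rle_trans _ _ _ (Rmax_Cmod w) Hw).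
  assert (H2 := Rle_trans _ _ _ (Rmax_l _ _) H1).
  assert (H3 := Rle_trans _ _ _ (Rmax_r _ _) H1).
  eapply Rle_trans; [apply norm_triangle|].
  apply Rplus_le_compat; eapply Rle_trans; try apply norm_scal.
  - change (Rabs (Re w) * norm (fst z) <= norm (fst z)).
    rewrite <- (Rmult_1_l (norm (fst z))) at 2.
    apply Rmult_le_compat_r; [apply norm_ge_0 | exact H2].
  - change (Rabs (- Im w) * norm (snd z) <= norm (snd z)); rewrite Rabs_Ropp.
    rewrite <- (Rmult_1_l (norm (snd z))) at 2.
    apply Rmult_le_compat_r; [apply norm_ge_0 | exact H3].
Qed.

Lemma cplx_norm_lub (z : X * X) : is_lub_Rbar (cplx_norm_set z) (cplx_norm z).
Proof.
  unfold cplx_norm; generalize (Lub_Rbar_correct (cplx_norm_set z)).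
  generalize (Lub_Rbar (cplx_norm_set z)); intros [l| |] [U L]; simpl.
  - now split.
  - exfalso; refine (L (Finite (norm (fst z) + norm (snd z))) _).
    intros v [w [Hw ->]]; now apply cplx_re_le.
  - exfalso; refine (U (norm (fst (cplx_scal 0 z))) _).
    exists 0%C; split; [rewrite Cmod_0; lra | reflexivity].
Qed.

Lemma cplx_norm_ub (w : C) (z : X * X) :
  Cmod w <= 1 -> norm (fst (cplx_scal w z)) <= cplx_norm z.
Proof. intros Hw; apply (proj1 (cplx_norm_lub z)); now exists w. Qed.

Lemma cplx_norm_le (z : X * X) (M : R) :
  (forall w, Cmod w <= 1 -> norm (fst (cplx_scal w z)) <= M) -> cplx_norm z <= M.
Proof.
  intros H; apply (proj2 (cplx_norm_lub z) (Finite M)).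
  intros v [w [Hw ->]]; now apply H.
Qed.

Lemma cplx_norm_fst (z : X * X) : norm (fst z) <= cplx_norm z.
Proof.
  replace (fst z) with (fst (cplx_scal 1 z)).
  - apply cplx_norm_ub; rewrite Cmod_1; lra.
  - rewrite cplx_scalE; simpl; rewrite Ropp_0; apply lin_10.
Qed.

Lemma cplx_norm_snd (z : X * X) : norm (snd z) <= cplx_norm z.
Proof.
  replace (snd z) with (fst (cplx_scal (- Ci) z)).
  - apply cplx_norm_ub; rewrite Cmod_opp, Cmod_Ci; lra.
  - rewrite cplx_scalE; simpl; rewrite Ropp_0, Ropp_involutive; apply lin_01.
Qed.

Lemma cplx_norm_plus (y z : X * X) :
  cplx_norm (@plus cplx_AbelianGroup y z) <= cplx_norm y + cplx_norm z.
Proof.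
  apply cplx_norm_le; intros w Hw.
  replace (fst (cplx_scal w (@plus cplx_AbelianGroup y z)))
    with (plus (fst (cplx_scal w y)) (fst (cplx_scal w z))).
  - eapply Rle_trans; [apply norm_triangle|].
    apply Rplus_le_compat; now apply cplx_norm_ub.
  - rewrite !cplx_scalE; simpl; now rewrite lin_distr.
Qed.

Lemma cplx_norm_scal (c : C) (z : X * X) :
  cplx_norm (cplx_scal c z) <= Cmod c * cplx_norm z.
Proof.
  apply cplx_norm_le; intros w Hw.
  change (cplx_scal w (cplx_scal c z)) with
    (ModuleSpace.scal _ _ cplx_ModuleSpace_mixin w
       (ModuleSpace.scal _ _ cplx_ModuleSpace_mixin c z)).
  rewrite (ModuleSpace.ax1 _ _ cplx_ModuleSpace_mixin).
  change (norm (fst (cplx_scal (w * c)%C z)) <= Cmod c * cplx_norm z).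
  destruct (Req_dec (Cmod c) 0) as [E|E].
  - apply Cmod_eq_0 in E; subst c.
    rewrite Cmult_0_r, Cmod_0, Rmult_0_l, cplx_scalE; simpl.
    rewrite Ropp_0; unfold lin.
    rewrite !scal0, plus_zero_l; apply Req_le; refine norm_zero.
  - assert (P : 0 < Cmod c) by (assert (H := Cmod_ge_0 c); lra).
    replace (fst (cplx_scal (w * c)%C z)) with
      (scal (Cmod c : R_AbsRing) (fst (cplx_scal (w * c / Cmod c)%C z))).
    + eapply Rle_trans; [apply norm_scal|].
      change (Rabs (Cmod c) * norm (fst (cplx_scal (w * c / Cmod c)%C z))
              <= Cmod c * cplx_norm z).
      rewrite Rabs_pos_eq by lra; apply Rmult_le_compat_l; [lra|].
      apply cplx_norm_ub; rewrite Cmod_div, Cmod_mult, Cmod_R, Rabs_pos_eq;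
        [field_simplify; lra | lra | intros H; injection H; lra].
    + assert (Ec : (w * c = Cmod c * (w * c / Cmod c))%C).
      { field; intros H; injection H; lra. }
      rewrite Ec at 2; generalize (w * c / Cmod c)%C; intros [a b].
      rewrite !cplx_scalE; simpl fst; rewrite lin_scal; simpl.
      f_equal; ring.
Qed.

Definition cplx_NormedModule_mixin :
  NormedModule.mixin_of C_AbsRing cplx_NormedModuleAux.
Proof.
  apply (NormedModule.Mixin C_AbsRing cplx_NormedModuleAux cplx_norm
           (2 * @norm_factor _ X)).
  - exact cplx_norm_plus.
  - exact cplx_norm_scal.
  - intros x y eps H; split.
    + apply norm_compat1.
      apply Rle_lt_trans with (2 := H).
      exact (cplx_norm_fst (@minus cplx_AbelianGroup y x)).
    + apply norm_compat1.
      apply Rle_lt_trans with (2 := H).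
      exact (cplx_norm_snd (@minus cplx_AbelianGroup y x)).
  - intros x y eps [H1 H2].
    apply Rle_lt_trans with
      (norm (minus (fst y) (fst x)) + norm (minus (snd y) (snd x))).
    + apply cplx_norm_le; intros w Hw.
      exact (cplx_re_le w (@minus cplx_AbelianGroup y x) Hw).
    + replace (2 * @norm_factor _ X * eps)
        with (@norm_factor _ X * eps + @norm_factor _ X * eps) by ring.
      apply Rplus_lt_compat; now apply norm_compat2.
  - intros z H.
    assert (H1 := cplx_norm_fst z); assert (H2 := cplx_norm_snd z).
    rewrite H in H1, H2; destruct z as [x y].
    apply (f_equal2 pair); apply norm_eq_zero, Rle_antisym;
      solve [assumption | apply norm_ge_0].
Defined.

Definition complexification : NormedModule C_AbsRing :=
  NormedModule.Pack C_AbsRing (X * X)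
    (NormedModule.Class C_AbsRing (X * X) _ cplx_NormedModule_mixin) (X * X).

End Complexification.

Definition regular (Y : CompleteNormedModule C_AbsRing) : Prop :=
  exists (X : CompleteNormedModule R_AbsRing)
         (T : complexification X -> Y) (S : Y -> complexification X),
    is_linear T /\ is_linear S /\
    (forall x, S (T x) = x) /\ (forall y, T (S y) = y).

(* [nnpow x p] is the real power [x ^ p] of a nonnegative [x], with
   [0 ^ p = 0] for every [p] (whereas [Rpower 0 p = 1]). *)
Definition nnpow (x p : R) : R := if Rle_dec x 0 then 0 else Rpower x p.

Definition disc : Type := {z : C | Cmod z < 1}.

Definition circle (t : R) : C := (cos (2 * PI * t), sin (2 * PI * t)).

Lemma Cmod_circle t : Cmod (circle t) = 1.
Proof.
  unfold circle, Cmod; simpl fst; simpl snd.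
  replace (_ + _) with 1; [apply sqrt_1|].
  rewrite <- (sin2_cos2 (2 * PI * t)); unfold Rsqr; ring.
Qed.

Lemma disc_point_proof (r t : R) : 0 <= r < 1 -> Cmod (r * circle t)%C < 1.
Proof.
  intros Hr; rewrite Cmod_mult, Cmod_circle, Cmod_R, Rabs_pos_eq; lra.
Qed.

Definition disc_point (r : R) (Hr : 0 <= r < 1) (t : R) : disc :=
  exist _ (r * circle t)%C (disc_point_proof r t Hr).

Section Analytic.
Context (Y : CompleteNormedModule C_AbsRing).

Definition analytic (F : fct_ModuleSpace disc Y) : Prop :=
  forall z0 : disc, exists (a : nat -> Y) (eps : posreal),
    forall z : disc, Cmod (proj1_sig z - proj1_sig z0)%C < eps ->
      is_pseries a ((proj1_sig z - proj1_sig z0)%C : C_AbsRing) (F z).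

Lemma analytic_submodule : submodule analytic.
Proof.
  split.
  - intros z0; exists (fun _ => zero), (mkposreal 1 Rlt_0_1).
    intros z _; unfold is_pseries.
    apply is_series_ext with (fun _ => zero).
    { intros n; symmetry; refine (scal_zero_r _). }
    unfold is_series.
    apply filterlim_ext with (fun _ : nat => @zero Y).
    { intros n; unfold sum_n; symmetry; refine (sum_n_m_const_zero 0 n). }
    apply filterlim_const.
  - intros F G HF HG z0.
    destruct (HF z0) as [a [e1 Ha]], (HG z0) as [b [e2 Hb]].
    exists (PS_plus a b), (mkposreal _ (Rmin_stable_in_posreal e1 e2)).
    intros z Hz; simpl in Hz.
    refine (is_pseries_plus a b _ _ _ (Ha z _) (Hb z _)).
    + apply Rlt_le_trans with (1 := Hz), Rmin_l.
    + apply Rlt_le_trans with (1 := Hz), Rmin_r.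
  - intros k F HF z0.
    destruct (HF z0) as [a [e1 Ha]].
    exists (PS_scal k a), e1; intros z Hz.
    refine (is_pseries_scal k a _ _ _ (Ha z Hz)).
    apply Cmult_comm.
Qed.

Definition analytic_functions : ModuleSpace C_Ring := sub_ModuleSpace analytic_submodule.

(* [RInt] is meaningful here: for analytic [F] the integrand is continuous
   ([Hp_disc_continuous]). *)
Definition Hp_disc_mean (p : R) (F : disc -> Y) (r : R) (Hr : 0 <= r < 1) : R :=
  nnpow (RInt (fun t => nnpow (norm (F (disc_point r Hr t))) p) (- (1 / 2)) (1 / 2)) (/ p).

Definition Hp_disc_norm (p : R) (F : analytic_functions) : Rbar :=
  Lub_Rbar (fun v => exists (r : R) (Hr : 0 <= r < 1),
    v = Hp_disc_mean p (proj1_sig F) r Hr).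

End Analytic.

Definition torus_deriv (g : R -> C) (n : nat) (t : R) : C :=
  (Derive_n (fun s => Re (g s)) n t, Derive_n (fun s => Im (g s)) n t).

Definition smooth_periodic (g : fct_ModuleSpace R C_ModuleSpace) : Prop :=
  (forall t, g (t + 1) = g t) /\
  (forall n t, ex_derive_n (fun s => Re (g s)) n t /\
               ex_derive_n (fun s => Im (g s)) n t).

Lemma smooth_lin (f g : R -> R) (a b : R) :
  (forall n t, ex_derive_n f n t) -> (forall n t, ex_derive_n g n t) ->
  forall n t, ex_derive_n (fun s => a * f s + b * g s) n t.
Proof.
  intros Hf Hg n t.
  apply ex_derive_n_plus; apply filter_forall; intros y k _;
    apply ex_derive_n_scal_l; auto.
Qed.

Lemma smooth_periodic_submodule : submodule smooth_periodic.
Proof.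
  split.
  - split; [reflexivity|].
    intros n t; split; exact (ex_derive_n_const 0 n t).
  - intros f g [Pf Sf] [Pg Sg]; split.
    + intros t; exact (f_equal2 (@plus C_ModuleSpace) (Pf t) (Pg t)).
    + intros n t; split.
      * apply ex_derive_n_ext with (fun s => 1 * Re (f s) + 1 * Re (g s)).
        { intros s; unfold Re; simpl; ring. }
        apply smooth_lin; [apply Sf | apply Sg].
      * apply ex_derive_n_ext with (fun s => 1 * Im (f s) + 1 * Im (g s)).
        { intros s; unfold Im; simpl; ring. }
        apply smooth_lin; [apply Sf | apply Sg].
  - intros [a b] f [Pf Sf]; split.
    + intros t; exact (f_equal (@scal _ C_ModuleSpace (a, b)) (Pf t)).
    + intros n t; split.
      * apply ex_derive_n_ext with (fun s => a * Re (f s) + - b * Im (f s)).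
        { intros s; unfold Re, Im; simpl; ring. }
        apply smooth_lin; apply Sf.
      * apply ex_derive_n_ext with (fun s => a * Im (f s) + b * Re (f s)).
        { intros s; unfold Re, Im; simpl; ring. }
        apply smooth_lin; apply Sf.
Qed.

Definition smooth_torus : ModuleSpace C_Ring := sub_ModuleSpace smooth_periodic_submodule.

(* The neighbourhoods of [g] in the Frechet topology defined by the
   seminorms sup |g^(k)|. *)
Definition smooth_nbhs (g : smooth_torus) (P : smooth_torus -> Prop) : Prop :=
  exists (N : nat) (delta : posreal), forall h : smooth_torus,
    (forall k t, (k <= N)%nat ->
       Cmod (torus_deriv (proj1_sig h) k t - torus_deriv (proj1_sig g) k t)%C < delta) ->
    P h.

Global Instance smooth_nbhs_filter g : Filter (smooth_nbhs g).
Proof.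
  split.
  - exists 0%nat, (mkposreal 1 Rlt_0_1); trivial.
  - intros P Q [N [d HP]] [M [e HQ]].
    exists (Nat.max N M), (mkposreal _ (Rmin_stable_in_posreal d e)).
    intros h Hh; simpl in Hh; split.
    + apply HP; intros k t Hk.
      apply Rlt_le_trans with (1 := Hh k t ltac:(lia)), Rmin_l.
    + apply HQ; intros k t Hk.
      apply Rlt_le_trans with (1 := Hh k t ltac:(lia)), Rmin_r.
  - intros P Q H [N [d HP]]; exists N, d; auto.
Qed.

Definition herglotz (r t : R) : C := ((1 + r * circle t) / (1 - r * circle t))%C.
Definition poisson (r t : R) : R := Re (herglotz r t).
Definition conj_poisson (r t : R) : R := Im (herglotz r t).

Definition poisson_den (r t : R) : R := 1 - 2 * r * cos (2 * PI * t) + r * r.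

Lemma poisson_den_pos r t : 0 <= r < 1 -> 0 < poisson_den r t.
Proof.
  intros Hr; unfold poisson_den.
  assert (H := COS_bound (2 * PI * t)).
  assert (0 <= r * (1 - cos (2 * PI * t))) by (apply Rmult_le_pos; lra).
  assert (0 < (1 - r) * (1 - r)) by (apply Rmult_lt_0_compat; lra).
  lra.
Qed.

Lemma herglotzE r t : 0 <= r < 1 ->
  herglotz r t = ((1 - r * r) * / poisson_den r t,
                  2 * r * sin (2 * PI * t) * / poisson_den r t).
Proof.
  intros Hr; assert (D := poisson_den_pos r t Hr).
  assert (E := sin2_cos2 (2 * PI * t)); unfold Rsqr in E.
  unfold herglotz, circle; set (c := cos _) in *; set (s := sin _) in *.
  assert (D' : (1 + - (r * c - 0 * s)) ^ 2 + (0 + - (r * s + 0 * c)) ^ 2 = poisson_den r t).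
  { unfold poisson_den; fold c.
    replace (1 - 2 * r * c + r * r) with (1 - 2 * r * c + r * r * (s * s + c * c))
      by (rewrite E; ring).
    ring. }
  unfold Cdiv, Cinv, Cmult, Cplus, Cminus, Copp; simpl fst; simpl snd.
  simpl in D' |- *; rewrite D'; apply (f_equal2 pair).
  - replace (1 - r * r) with (1 - r * r * (s * s + c * c)) by (rewrite E; ring).
    field; lra.
  - field; lra.
Qed.

(* The algebra generated by the coefficients of [herglotz r] is stable under
   differentiation. *)
Inductive trig_alg (r : R) : (R -> R) -> Prop :=
  | trig_cst c : trig_alg r (fun _ => c)
  | trig_cos : trig_alg r (fun t => cos (2 * PI * t))
  | trig_sin : trig_alg r (fun t => sin (2 * PI * t))
  | trig_inv : trig_alg r (fun t => / poisson_den r t)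
  | trig_add f g : trig_alg r f -> trig_alg r g -> trig_alg r (fun t => f t + g t)
  | trig_mul f g : trig_alg r f -> trig_alg r g -> trig_alg r (fun t => f t * g t).

Lemma trig_alg_derive r f : 0 <= r < 1 -> trig_alg r f ->
  exists g, trig_alg r g /\ forall t, is_derive f t (g t).
Proof.
  intros Hr Hf; induction Hf as [c| | | |f g Hf [f' [Af Df]] Hg [g' [Ag Dg]]
                                |f g Hf [f' [Af Df]] Hg [g' [Ag Dg]]].
  - exists (fun _ => 0); split; [apply trig_cst|].
    intros t; auto_derive; trivial.
  - exists (fun t => - (2 * PI) * sin (2 * PI * t)).
    split; [apply (trig_mul r (fun _ => _)); [apply trig_cst | apply trig_sin]|].
    intros t; auto_derive; trivial; ring.
  - exists (fun t => 2 * PI * cos (2 * PI * t)).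
    split; [apply (trig_mul r (fun _ => _)); [apply trig_cst | apply trig_cos]|].
    intros t; auto_derive; trivial; ring.
  - exists (fun t => - (4 * PI * r) * sin (2 * PI * t)
                     * (/ poisson_den r t * / poisson_den r t)).
    split.
    { apply (trig_mul r (fun t => - (4 * PI * r) * sin (2 * PI * t))).
      - apply (trig_mul r (fun _ => _)); [apply trig_cst | apply trig_sin].
      - apply trig_mul; apply trig_inv. }
    intros t; assert (D := poisson_den_pos r t Hr); unfold poisson_den in *.
    auto_derive; [lra | field; lra].
  - exists (fun t => f' t + g' t); split; [now apply trig_add|].
    intros t; exact (is_derive_plus f g t _ _ (Df t) (Dg t)).
  - exists (fun t => f' t * g t + f t * g' t).
    split; [apply trig_add; now apply trig_mul|].
    intros t; refine (is_derive_mult f g t _ _ (Df t) (Dg t) _).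
    intros; apply Rmult_comm.
Qed.

Lemma trig_alg_smooth r f : 0 <= r < 1 -> trig_alg r f ->
  forall n t, ex_derive_n f n t.
Proof.
  intros Hr Hf.
  assert (K : forall n, exists g, trig_alg r g /\ forall t, Derive_n f n t = g t).
  { induction n as [|n [g [Ag Eg]]].
    - exists f; now split.
    - destruct (trig_alg_derive r g Hr Ag) as [g' [Ag' Dg']].
      exists g'; split; [exact Ag'|]; intros t; simpl.
      rewrite (Derive_ext _ g) by exact Eg; now apply is_derive_unique. }
  intros [|n] t; simpl; trivial.
  destruct (K n) as [g [Ag Eg]].
  destruct (trig_alg_derive r g Hr Ag) as [g' [_ Dg']].
  apply ex_derive_ext with g; [intros; now rewrite Eg | now exists (g' t)].
Qed.

Definition kernel (k : R -> R) : Prop :=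
  (forall t, k (t + 1) = k t) /\ (forall n t, ex_derive_n k n t).

Lemma circle_periodic t : circle (t + 1) = circle t.
Proof.
  unfold circle; replace (2 * PI * (t + 1)) with (2 * PI * t + 2 * PI) by ring.
  now rewrite cos_plus, sin_plus, cos_2PI, sin_2PI, !Rmult_1_r, !Rmult_0_r, Rminus_0_r, Rplus_0_r.
Qed.

Lemma poisson_kernel r : 0 <= r < 1 -> kernel (poisson r).
Proof.
  intros Hr; split.
  - intros t; unfold poisson, herglotz; now rewrite circle_periodic.
  - intros n t; apply ex_derive_n_ext with (fun t => (1 - r * r) * / poisson_den r t).
    { intros s; unfold poisson; now rewrite herglotzE. }
    apply (trig_alg_smooth r); [exact Hr|].
    apply (trig_mul r (fun _ => _)); [apply trig_cst | apply trig_inv].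
Qed.

Lemma conj_poisson_kernel r : 0 <= r < 1 -> kernel (conj_poisson r).
Proof.
  intros Hr; split.
  - intros t; unfold conj_poisson, herglotz; now rewrite circle_periodic.
  - intros n t; apply ex_derive_n_ext with
      (fun t => 2 * r * sin (2 * PI * t) * / poisson_den r t).
    { intros s; unfold conj_poisson; now rewrite herglotzE. }
    apply (trig_alg_smooth r); [exact Hr|].
    apply (trig_mul r (fun _ => _ * _)); [|apply trig_inv].
    apply (trig_mul r (fun _ => _)); [apply trig_cst | apply trig_sin].
Qed.

Lemma kernel_reflect k t n s : kernel k ->
  is_derive_n (fun s => k (t - s)) n s ((-1) ^ n * Derive_n k n (t - s)).
Proof.
  intros [_ Sk].
  apply is_derive_n_ext with (fun s => (fun u => k (u + t)) (- s)).
  { intros u; f_equal; ring. }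
  refine (is_derive_n_comp_opp (fun u => k (u + t)) n s _ _ _).
  - apply filter_forall; intros y j _.
    apply ex_derive_n_comp_trans; apply Sk.
  - replace (Derive_n k n (t - s)) with (Derive_n k n (- s + t)) by (f_equal; ring).
    apply is_derive_n_comp_trans, Derive_n_correct, Sk.
Qed.

Lemma kernel_test_proof k t : kernel k -> smooth_periodic (fun s => RtoC (k (t - s))).
Proof.
  intros Hk; split.
  - intros s; apply (f_equal RtoC).
    rewrite <- (proj1 Hk (t - (s + 1))); f_equal; ring.
  - intros n s; split.
    + apply ex_derive_n_ext with (fun s => k (t - s)); [reflexivity|].
      assert (D := kernel_reflect k t n s Hk).
      destruct n; [exact I | eexists; exact D].
    + exact (ex_derive_n_const 0 n s).
Qed.

Definition kernel_test (k : R -> R) (Hk : kernel k) (t : R) : smooth_torus :=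
  exist _ (fun s => RtoC (k (t - s))) (kernel_test_proof k t Hk).

Section Distributions.
Context (Y : CompleteNormedModule C_AbsRing).

Definition distribution (f : fct_ModuleSpace smooth_torus Y) : Prop :=
  (forall g h : smooth_torus, f (plus g h) = plus (f g) (f h)) /\
  (forall (c : C) (g : smooth_torus), f (scal (c : C_Ring) g) = scal (c : C_AbsRing) (f g)) /\
  (forall g : smooth_torus, filterlim f (smooth_nbhs g) (locally (f g))).

Lemma distribution_submodule : submodule distribution.
Proof.
  split.
  - repeat split.
    + intros g h; symmetry; refine (plus_zero_r _).
    + intros c g; symmetry; refine (scal_zero_r _).
    + intros g; refine (filterlim_const (F := smooth_nbhs g) (zero : Y)).
  - intros f f' [Pf [Sf Cf]] [Pf' [Sf' Cf']]; repeat split.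
    + intros g h.
      change (plus (f (plus g h)) (f' (plus g h)) =
              plus (plus (f g) (f' g)) (plus (f h) (f' h))).
      rewrite Pf, Pf'; refine (plus_plus Y _ _ _ _).
    + intros c g.
      change (plus (f (scal (c : C_Ring) g)) (f' (scal (c : C_Ring) g)) =
              scal (c : C_AbsRing) (plus (f g) (f' g))).
      rewrite Sf, Sf'; symmetry; refine (scal_distr_l _ _ _).
    + intros g; refine (filterlim_comp_2 f f' plus (Cf g) (Cf' g) _).
      refine (filterlim_plus (f g) (f' g)).
  - intros k f [Pf [Sf Cf]]; repeat split.
    + intros g h.
      change (scal k (f (plus g h)) = plus (scal k (f g)) (scal k (f h))).
      rewrite Pf; refine (scal_distr_l _ _ _).
    + intros c g.
      change (scal k (f (scal (c : C_Ring) g)) = scal (c : C_AbsRing) (scal k (f g))).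
      rewrite Sf; etransitivity; [refine (scal_assoc _ _ _)|].
      etransitivity; [|symmetry; refine (scal_assoc _ _ _)].
      f_equal; apply Cmult_comm.
    + intros g.
      refine (filterlim_comp _ _ _ f (fun y => scal k y) _ _ _ (Cf g) _).
      refine (filterlim_scal_r k (f g)).
Qed.

Definition distributions : ModuleSpace C_Ring := sub_ModuleSpace distribution_submodule.

Definition convolution (k : R -> R) (Hk : kernel k) (f : smooth_torus -> Y) (t : R) : Y :=
  f (kernel_test k Hk t).

(* [RInt] is meaningful here: for a distribution [f] the integrand is
   continuous ([convolution_continuous]). *)
Definition Hp_torus_mean (p : R) (f : smooth_torus -> Y) (r : R) (Hr : 0 <= r < 1) : R :=
  nnpow (RInt (fun t =>
      nnpow (norm (convolution (poisson r) (poisson_kernel r Hr) f t)) p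
      + nnpow (norm (convolution (conj_poisson r) (conj_poisson_kernel r Hr) f t)) p)
    (- (1 / 2)) (1 / 2)) (/ p).

Definition Hp_torus_norm (p : R) (f : distributions) : Rbar :=
  Lub_Rbar (fun v => exists (r : R) (Hr : 0 <= r < 1),
    v = Hp_torus_mean p (proj1_sig f) r Hr).

End Distributions.

Lemma nnpow_ge_0 x p : 0 <= nnpow x p.
Proof.
  unfold nnpow; destruct (Rle_dec x 0); [lra|]; left; apply exp_pos.
Qed.

Lemma nnpow_le x y p : 0 <= p -> x <= y -> nnpow x p <= nnpow y p.
Proof.
  intros Hp H; unfold nnpow; destruct (Rle_dec x 0), (Rle_dec y 0); try lra.
  - left; apply exp_pos.
  - apply Rle_Rpower_l; lra.
Qed.

Lemma nnpow_mult x y p : 0 <= x -> 0 <= y -> nnpow (x * y) p = nnpow x p * nnpow y p.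
Proof.
  intros Hx Hy; unfold nnpow; destruct (Rle_dec x 0) as [X|X].
  { replace x with 0 by lra; rewrite Rmult_0_l; destruct (Rle_dec 0 0); lra. }
  destruct (Rle_dec y 0) as [Z|Z].
  { replace y with 0 by lra; rewrite Rmult_0_r; destruct (Rle_dec 0 0); lra. }
  assert (0 < x * y) by (apply Rmult_lt_0_compat; lra).
  destruct (Rle_dec (x * y) 0); [lra|]; now rewrite Rpower_mult_distr by lra.
Qed.

Lemma nnpow_plus x y p : 0 <= p -> 0 <= x -> 0 <= y ->
  nnpow (x + y) p <= nnpow 2 p * (nnpow x p + nnpow y p).
Proof.
  intros Hp Hx Hy; assert (A := nnpow_ge_0 x p); assert (B := nnpow_ge_0 y p).
  assert (D := nnpow_ge_0 2 p).
  destruct (Rle_dec x y).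
  - apply Rle_trans with (nnpow (2 * y) p); [apply nnpow_le; lra|].
    rewrite nnpow_mult by lra; apply Rmult_le_compat_l; lra.
  - apply Rle_trans with (nnpow (2 * x) p); [apply nnpow_le; lra|].
    rewrite nnpow_mult by lra; apply Rmult_le_compat_l; lra.
Qed.

Lemma nnpow_inv x p : 0 < p -> 0 <= x -> nnpow (nnpow x (/ p)) p = x.
Proof.
  intros Hp Hx; unfold nnpow at 2; destruct (Rle_dec x 0).
  - unfold nnpow; destruct (Rle_dec 0 0); lra.
  - unfold nnpow; destruct (Rle_dec (Rpower x (/ p)) 0) as [H|H].
    + exfalso; apply (Rlt_not_le (Rpower x (/ p)) 0); [apply exp_pos | exact H].
    + rewrite Rpower_mult, Rinv_l by lra; apply Rpower_1; lra.
Qed.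

Lemma nnpow_continuous p x : 0 < p -> continuous (fun y => nnpow y p) x.
Proof.
  intros Hp; destruct (Rtotal_order x 0) as [H|[->|H]].
  - apply continuous_ext_loc with (fun _ => 0); [|apply continuous_const].
    apply filter_imp with (2 := open_lt 0 x H).
    intros y Hy; unfold nnpow; destruct (Rle_dec y 0); lra.
  - apply filterlim_locally; intros eps.
    assert (P : 0 < Rpower eps (/ p)) by apply exp_pos.
    exists (mkposreal _ P); intros y Hy.
    apply Rabs_lt_between in Hy; simpl in Hy.
    change (Rabs (nnpow y p - nnpow 0 p) < eps).
    replace (nnpow 0 p) with 0 by (unfold nnpow; destruct (Rle_dec 0 0); lra).
    rewrite Rminus_0_r, Rabs_pos_eq by apply nnpow_ge_0.
    unfold minus, plus, opp in Hy; simpl in Hy.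
    unfold nnpow; destruct (Rle_dec y 0); [apply cond_pos|].
    apply Rlt_le_trans with (Rpower (Rpower eps (/ p)) p).
    + apply Rlt_Rpower_l; lra.
    + rewrite Rpower_mult, Rinv_l by lra; rewrite Rpower_1; [lra | apply cond_pos].
  - apply continuous_ext_loc with (fun y => Rpower y p).
    + apply filter_imp with (2 := open_gt 0 x H).
      intros y Hy; unfold nnpow; destruct (Rle_dec y 0); lra.
    + apply (ex_derive_continuous (fun y => Rpower y p)).
      unfold Rpower; auto_derive; trivial.
Qed.

Lemma nnpow_norm_continuous {K : AbsRing} {V : NormedModule K} (u : R -> V) p t :
  0 < p -> continuous u t -> continuous (fun s => nnpow (norm (u s)) p) t.
Proof.
  intros Hp Hu.
  apply (continuous_comp (fun s => norm (u s)) (fun y => nnpow y p)).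
  - apply (continuous_comp u norm); [exact Hu|]; refine (filterlim_norm (u t)).
  - now apply nnpow_continuous.
Qed.

Lemma minus_plus_l (G : AbelianGroup) (x y : G) : minus (plus x y) x = y.
Proof.
  unfold minus; rewrite (plus_comm x y), <- plus_assoc.
  rewrite <- (plus_zero_r y) at 2; f_equal; refine (plus_opp_r x).
Qed.

Section Closure.
Context (Y : CompleteNormedModule C_AbsRing).

Lemma norm_pow_scal (q : C) (n : nat) (y : Y) :
  norm (scal (pow_n (q : C_AbsRing) n) y) <= Cmod q ^ n * norm y.
Proof.
  eapply Rle_trans; [refine (norm_scal _ _)|].
  apply Rmult_le_compat_r; [refine (norm_ge_0 _)|].
  induction n as [|n IH]; simpl.
  - change (Cmod 1 <= 1); rewrite Cmod_1; lra.
  - change (Cmod (q * pow_n (q : C_AbsRing) n)%C <= Cmod q * Cmod q ^ n).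
    rewrite Cmod_mult; apply Rmult_le_compat_l; [apply Cmod_ge_0 | exact IH].
Qed.

Lemma pow_n_Cmult (q k : C) (n : nat) :
  (pow_n ((q * k)%C : C_AbsRing) n =
   pow_n (q : C_AbsRing) n * pow_n (k : C_AbsRing) n)%C.
Proof.
  induction n as [|n IH]; simpl.
  - change (RtoC 1 = RtoC 1 * RtoC 1)%C; ring.
  - change (q * k * pow_n ((q * k)%C : C_AbsRing) n =
            (q * pow_n (q : C_AbsRing) n) * (k * pow_n (k : C_AbsRing) n))%C.
    rewrite IH; ring.
Qed.

Lemma pseries_bound (b : nat -> Y) (M : R) (q : C) (l : Y) :
  (forall n, norm (b n) <= M) -> Cmod q <= 1 / 2 ->
  is_pseries b (q : C_AbsRing) l -> norm (minus l (b 0%nat)) <= 2 * M * Cmod q.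
Proof.
  intros HM Hq Hl; assert (Q := Cmod_ge_0 q).
  set (u := fun n => scal (pow_n (q : C_AbsRing) n) (b n)) in *.
  assert (HM0 : 0 <= M) by (eapply Rle_trans; [refine (norm_ge_0 _) | apply (HM 0%nat)]).
  assert (HQ : forall n, Cmod q ^ S n <= Cmod q * (1 / 2) ^ n).
  { intros n; simpl; apply Rmult_le_compat_l; [exact Q | apply pow_incr; lra]. }
  assert (MQ : 0 <= M * Cmod q) by now apply Rmult_le_pos.
  assert (H : forall n, norm (minus (sum_n u n) (b 0%nat))
                        <= 2 * (M * Cmod q) * (1 - (1 / 2) ^ n)).
  { induction n as [|n IH].
    - rewrite sum_O; unfold u; simpl.
      apply Req_le; replace (2 * (M * Cmod q) * (1 - 1)) with 0 by ring.
      transitivity (norm (zero : Y)); [|refine norm_zero].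
      f_equal; unfold minus.
      etransitivity; [|refine (plus_opp_r (b 0%nat))].
      f_equal; refine (scal_one _).
    - rewrite sum_Sn.
      replace (minus (plus (sum_n u n) (u (S n))) (b 0%nat))
        with (plus (minus (sum_n u n) (b 0%nat)) (u (S n))).
      2:{ unfold minus; rewrite <- !plus_assoc; f_equal; apply plus_comm. }
      eapply Rle_trans; [refine (norm_triangle _ _)|].
      assert (T := norm_pow_scal q (S n) (b (S n))); fold (u (S n)) in T.
      assert (T2 : Cmod q ^ S n * norm (b (S n)) <= Cmod q * (1 / 2) ^ n * M).
      { apply Rmult_le_compat; [apply pow_le; exact Q | refine (norm_ge_0 _) | apply HQ | apply HM]. }
      replace (2 * (M * Cmod q) * (1 - (1 / 2) ^ S n)) with
        (2 * (M * Cmod q) * (1 - (1 / 2) ^ n) + Cmod q * (1 / 2) ^ n * M)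
        by (simpl; field).
      apply Rplus_le_compat; [exact IH | exact (Rle_trans _ _ _ T T2)]. }
  assert (L : is_lim_seq (fun n => norm (minus (sum_n u n) (b 0%nat)))
                         (norm (minus l (b 0%nat)))).
  { refine (filterlim_comp _ _ _ (fun n => minus (sum_n u n) (b 0%nat)) norm _ _ _ _
             (filterlim_norm _)).
    refine (filterlim_comp_2 (sum_n u) (fun _ => opp (b 0%nat)) plus Hl
             (filterlim_const _) (filterlim_plus _ _)). }
  refine (is_lim_seq_le _ (fun _ => 2 * M * Cmod q) (norm (minus l (b 0%nat)))
           (2 * M * Cmod q) _ L (is_lim_seq_const _)).
  intros n; eapply Rle_trans; [apply H|].
  assert (0 <= (1 / 2) ^ n) by (apply pow_le; lra).
  replace (2 * M * Cmod q) with (2 * (M * Cmod q) * 1) by ring.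
  apply Rmult_le_compat_l; lra.
Qed.

Lemma analytic_continuous (F : disc -> Y) (z0 : disc) :
  analytic Y F -> forall eps : posreal, exists delta : posreal,
    forall z, Cmod (proj1_sig z - proj1_sig z0)%C < delta -> ball (F z0) eps (F z).
Proof.
  intros HF eps; destruct (HF z0) as [a [e Ha]].
  set (w0 := proj1_sig z0) in *; assert (Hw0 : Cmod w0 < 1) by exact (proj2_sig z0).
  set (rho := Rmin e (1 - Cmod w0) / 2).
  assert (Pe := cond_pos e).
  assert (M1 := Rmin_l e (1 - Cmod w0)); assert (M2 := Rmin_r e (1 - Cmod w0)).
  assert (P : 0 < Rmin e (1 - Cmod w0)) by (apply Rmin_pos; lra).
  assert (Prho : 0 < rho) by (unfold rho; lra).
  assert (Hz1 : Cmod (w0 + rho)%C < 1).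
  { eapply Rle_lt_trans; [apply Cmod_triangle|].
    rewrite Cmod_R, Rabs_pos_eq; unfold rho; lra. }
  assert (E1 : (w0 + rho - w0 = rho)%C) by ring.
  assert (S1 := Ha (exist _ _ Hz1)); simpl in S1; rewrite E1 in S1.
  rewrite Cmod_R, Rabs_pos_eq in S1 by lra.
  specialize (S1 ltac:(unfold rho; lra)).
  set (b := fun n => scal (pow_n (RtoC rho : C_AbsRing) n) (a n)).
  destruct (filterlim_bounded (sum_n b) (ex_intro _ _ S1)) as [M HM].
  assert (HM0 : 0 <= M) by (eapply Rle_trans; [refine (norm_ge_0 _) | apply (HM 0%nat)]).
  assert (B : forall n, norm (b n) <= 2 * M).
  { intros [|n].
    - specialize (HM 0%nat); rewrite sum_O in HM; lra.
    - assert (H1 := HM (S n)); assert (H0 := HM n); rewrite sum_Sn in H1.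
      replace (b (S n)) with (minus (plus (sum_n b n) (b (S n))) (sum_n b n)).
      + eapply Rle_trans; [refine (norm_triangle _ _)|].
        replace (2 * M) with (M + M) by ring; apply Rplus_le_compat; [exact H1|].
        eapply Rle_trans; [|exact H0]; apply Req_le; refine (norm_opp _).
      + refine (minus_plus_l _ _ _). }
  assert (Nrho : RtoC rho <> 0%C) by (intros H; injection H; lra).
  assert (K : forall z, Cmod (proj1_sig z - w0)%C <= rho / 2 ->
    norm (minus (F z) (b 0%nat)) <= 4 * M / rho * Cmod (proj1_sig z - w0)%C).
  { intros z Hz; set (h := (proj1_sig z - w0)%C) in *.
    assert (Eh : h = (h / rho * rho)%C) by (field; exact Nrho).
    assert (Eq : Cmod (h / rho)%C = Cmod h / rho).
    { rewrite Cmod_div, Cmod_R, Rabs_pos_eq by (trivial; lra); reflexivity. }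
    replace (4 * M / rho * Cmod h) with (2 * (2 * M) * Cmod (h / rho)%C)
      by (rewrite Eq; field; lra).
    apply pseries_bound; [exact B| |].
    - rewrite Eq; apply Rmult_le_reg_r with rho; [exact Prho|].
      unfold Rdiv; rewrite Rmult_assoc, Rinv_l by lra; lra.
    - assert (S := Ha z ltac:(fold h; unfold rho in *; lra)); fold h in S.
      refine (is_series_ext _ _ _ _ S); intros n; unfold b.
      etransitivity; [|symmetry; refine (scal_assoc _ _ _)].
      f_equal; rewrite Eh at 1; apply pow_n_Cmult. }
  assert (E0 : F z0 = b 0%nat).
  { assert (H := K z0); fold w0 in H; replace (w0 - w0)%C with (RtoC 0) in H by ring.
    rewrite Cmod_0, Rmult_0_r in H; specialize (H ltac:(lra)).
    assert (Z : minus (F z0) (b 0%nat) = zero)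
      by (refine (norm_eq_zero _ (Rle_antisym _ _ H (norm_ge_0 _)))).
    refine (plus_reg_r (opp (b 0%nat)) _ _ _).
    etransitivity; [exact Z|]; symmetry; refine (plus_opp_r _). }
  assert (Pd : 0 < Rmin (rho / 2) (eps * rho / (4 * M + 1))).
  { apply Rmin_pos; [lra|]; apply Rdiv_lt_0_compat; [|lra].
    apply Rmult_lt_0_compat; [apply cond_pos | exact Prho]. }
  exists (mkposreal _ Pd); intros z Hz; simpl in Hz.
  assert (Hz1' := Rlt_le_trans _ _ _ Hz (Rmin_l _ _)).
  assert (Hz2 := Rlt_le_trans _ _ _ Hz (Rmin_r _ _)).
  refine (norm_compat1 (F z0) (F z) eps _); rewrite E0.
  eapply Rle_lt_trans; [apply K; lra|].
  assert (Ce := cond_pos eps).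
  apply Rle_lt_trans with (4 * M / rho * (eps * rho / (4 * M + 1))).
  - apply Rmult_le_compat_l; [|lra].
    apply Rmult_le_pos; [lra | left; now apply Rinv_0_lt_compat].
  - replace (4 * M / rho * (eps * rho / (4 * M + 1)))
      with (eps * (1 - / (4 * M + 1))) by (field; lra).
    assert (0 < / (4 * M + 1)) by (apply Rinv_0_lt_compat; lra).
    rewrite <- (Rmult_1_r eps) at 2; apply Rmult_lt_compat_l; lra.
Qed.

Lemma circle_continuous (r t : R) (eps : posreal) : 0 <= r < 1 ->
  locally t (fun s => Cmod (r * circle s - r * circle t)%C < eps).
Proof.
  intros Hr.
  assert (C1 : continuous (fun s => r * cos (2 * PI * s)) t)
    by (apply (ex_derive_continuous (fun s => r * cos (2 * PI * s))); auto_derive; trivial).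
  assert (C2 : continuous (fun s => r * sin (2 * PI * s)) t)
    by (apply (ex_derive_continuous (fun s => r * sin (2 * PI * s))); auto_derive; trivial).
  assert (P : 0 < eps / 2) by (assert (H := cond_pos eps); lra).
  assert (D1 := proj1 (filterlim_locally _ _) C1 (mkposreal _ P)).
  assert (D2 := proj1 (filterlim_locally _ _) C2 (mkposreal _ P)).
  generalize (filter_and _ _ D1 D2); apply filter_imp; intros s [A B].
  change (Rabs (r * cos (2 * PI * s) - r * cos (2 * PI * t)) < eps / 2) in A.
  change (Rabs (r * sin (2 * PI * s) - r * sin (2 * PI * t)) < eps / 2) in B.
  unfold circle.
  set (u := r * cos (2 * PI * s) - r * cos (2 * PI * t)) in *.
  set (v := r * sin (2 * PI * s) - r * sin (2 * PI * t)) in *.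
  replace (_ - _)%C with (RtoC u + Ci * RtoC v)%C
    by (unfold u, v; apply injective_projections; simpl; ring).
  eapply Rle_lt_trans; [apply Cmod_triangle|].
  rewrite Cmod_mult, Cmod_Ci, !Cmod_R; lra.
Qed.

Lemma Hp_disc_continuous (F : disc -> Y) (r : R) (Hr : 0 <= r < 1) (t : R) :
  analytic Y F -> continuous (fun s => F (disc_point r Hr s)) t.
Proof.
  intros HF; apply filterlim_locally; intros eps.
  destruct (analytic_continuous F (disc_point r Hr t) HF eps) as [d Hd].
  generalize (circle_continuous r t d Hr); apply filter_imp.
  intros s Hs; exact (Hd (disc_point r Hr s) Hs).
Qed.

Lemma periodic_Z (f : R -> R) : (forall t, f (t + 1) = f t) ->
  forall (n : Z) t, f (t + IZR n) = f t.
Proof.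
  intros P n; induction n using Z.peano_ind; intros t.
  - now rewrite Rplus_0_r.
  - rewrite succ_IZR, <- Rplus_assoc, P; apply IHn.
  - unfold Z.pred; rewrite plus_IZR, <- (IHn t), <- P; f_equal; ring.
Qed.

Lemma kernel_deriv_bounded k j : kernel k -> exists B, forall t, Rabs (Derive_n k j t) <= B.
Proof.
  intros [Pk Sk].
  assert (C : forall t, continuous (fun s => Rabs (Derive_n k j s)) t).
  { intros t; apply (continuous_comp (Derive_n k j) Rabs); [|apply continuous_Rabs].
    apply (ex_derive_continuous (Derive_n k j)); exact (Sk (S j) t). }
  destruct (continuity_ab_maj (fun s => Rabs (Derive_n k j s)) 0 1) as [m [Hm _]].
  { lra. }
  { intros c _; apply continuity_pt_filterlim, C. }
  exists (Rabs (Derive_n k j m)); intros t.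
  assert (P : forall t, Derive_n k j (t + 1) = Derive_n k j t).
  { intros s; rewrite <- Derive_n_comp_trans; apply Derive_n_ext, Pk. }
  rewrite <- (periodic_Z _ P (- Int_part t) t), opp_IZR.
  apply Hm; destruct (base_Int_part t); lra.
Qed.

Lemma kernel_deriv_lip k j : kernel k -> exists L, 0 <= L /\
  forall x y, Rabs (Derive_n k j x - Derive_n k j y) <= L * Rabs (x - y).
Proof.
  intros Hk; destruct (kernel_deriv_bounded k (S j) Hk) as [B HB].
  exists B; split; [eapply Rle_trans; [apply Rabs_pos | apply (HB 0)]|].
  intros x y.
  destruct (MVT_gen (Derive_n k j) y x (Derive_n k (S j))) as [c [_ E]].
  - intros z _; apply Derive_correct; exact (proj2 Hk (S j) z).
  - intros z _; apply continuity_pt_filterlim.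
    apply (ex_derive_continuous (Derive_n k j)); exact (proj2 Hk (S j) z).
  - rewrite E, Rabs_mult; apply Rmult_le_compat_r; [apply Rabs_pos | apply HB].
Qed.

Lemma kernel_deriv_lip_le k N : kernel k -> exists L, 0 <= L /\
  forall j x y, (j <= N)%nat ->
    Rabs (Derive_n k j x - Derive_n k j y) <= L * Rabs (x - y).
Proof.
  intros Hk; induction N as [|N [L [L0 IH]]].
  - destruct (kernel_deriv_lip k 0 Hk) as [L [L0 H]].
    exists L; split; [exact L0|]; intros j x y Hj.
    replace j with 0%nat by lia; apply H.
  - destruct (kernel_deriv_lip k (S N) Hk) as [M [M0 H]].
    exists (L + M); split; [lra|]; intros j x y Hj.
    rewrite Rmult_plus_distr_r.
    assert (A := Rmult_le_pos _ _ L0 (Rabs_pos (x - y))).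
    assert (B := Rmult_le_pos _ _ M0 (Rabs_pos (x - y))).
    destruct (Nat.eq_dec j (S N)) as [->|E].
    + specialize (H x y); lra.
    + specialize (IH j x y ltac:(lia)); lra.
Qed.

Lemma kernel_test_continuous k (Hk : kernel k) (t : R) :
  filterlim (kernel_test k Hk) (locally t) (smooth_nbhs (kernel_test k Hk t)).
Proof.
  intros P [N [d HP]].
  destruct (kernel_deriv_lip_le k N Hk) as [L [L0 HL]].
  assert (Pd : 0 < d / (L + 1)) by (apply Rdiv_lt_0_compat; [apply cond_pos | lra]).
  exists (mkposreal _ Pd); intros s Hs; apply HP; intros j u Hj.
  change (Rabs (s - t) < d / (L + 1)) in Hs.
  assert (E : forall v, torus_deriv (proj1_sig (kernel_test k Hk v)) j u
                        = RtoC ((-1) ^ j * Derive_n k j (v - u))).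
  { intros v; unfold torus_deriv, RtoC; simpl; f_equal.
    - apply is_derive_n_unique, kernel_reflect, Hk.
    - destruct j as [|j]; [reflexivity|]; exact (Derive_n_const j 0 u). }
  rewrite !E; clear E.
  rewrite <- RtoC_minus, Cmod_R, <- Rmult_minus_distr_l, Rabs_mult, pow_1_abs, Rmult_1_l.
  eapply Rle_lt_trans; [apply HL, Hj|].
  replace (s - u - (t - u)) with (s - t) by ring.
  apply Rle_lt_trans with (L * (d / (L + 1))).
  - apply Rmult_le_compat_l; lra.
  - replace (L * (d / (L + 1))) with (d * (1 - / (L + 1))) by (field; lra).
    assert (0 < / (L + 1)) by (apply Rinv_0_lt_compat; lra).
    assert (Cd := cond_pos d).
    rewrite <- (Rmult_1_r d) at 2; apply Rmult_lt_compat_l; lra.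
Qed.

Lemma convolution_continuous k (Hk : kernel k) (f : smooth_torus -> Y) (t : R) :
  distribution Y f -> continuous (convolution Y k Hk f) t.
Proof.
  intros [_ [_ Cf]].
  exact (filterlim_comp _ _ _ (kernel_test k Hk) f _ _ _
           (kernel_test_continuous k Hk t) (Cf _)).
Qed.

End Closure.

Lemma Hp_finite (p : R) (J : forall r, 0 <= r < 1 -> R) :
  0 < p -> (forall r Hr, 0 <= J r Hr) ->
  Rbar_lt (Lub_Rbar (fun v => exists r Hr, v = nnpow (J r Hr) (/ p))) p_infty
  <-> exists M, forall r Hr, J r Hr <= M.
Proof.
  intros Hp J0; assert (Hp' := Rinv_0_lt_compat p Hp).
  set (E := fun v => exists r Hr, v = nnpow (J r Hr) (/ p)).
  generalize (Lub_Rbar_correct E); intros [U L]; split.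
  - intros H; destruct (Lub_Rbar E) as [l| |].
    + exists (nnpow l p); intros r Hr.
      rewrite <- (nnpow_inv (J r Hr) p Hp (J0 r Hr)).
      apply nnpow_le; [lra|]; apply (U (nnpow (J r Hr) (/ p))); now exists r, Hr.
    + contradiction H.
    + exfalso; assert (H0 : 0 <= 0 < 1) by lra.
      refine (U (nnpow (J 0 H0) (/ p)) _); now exists 0, H0.
  - intros [M HM]; apply Rbar_le_lt_trans with (Finite (nnpow M (/ p))); [|exact I].
    apply L; intros v [r [Hr ->]]; apply nnpow_le; [lra | apply HM].
Qed.

Section Spaces.
Context (Y : CompleteNormedModule C_AbsRing) (p : R) (Hp : 0 < p).

Let pint (u : R -> Y) : R := RInt (fun t => nnpow (norm (u t)) p) (- (1 / 2)) (1 / 2).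

Lemma pint_ex (u : R -> Y) : (forall t, continuous u t) ->
  ex_RInt (fun t => nnpow (norm (u t)) p) (- (1 / 2)) (1 / 2).
Proof.
  intros Hu; refine (ex_RInt_continuous _ _ _ _); intros t _.
  apply nnpow_norm_continuous; [exact Hp | apply Hu].
Qed.

Lemma pint_ge_0 (u : R -> Y) : (forall t, continuous u t) -> 0 <= pint u.
Proof.
  intros Hu; apply RInt_ge_0; [lra | now apply pint_ex | intros; apply nnpow_ge_0].
Qed.

Lemma pint_zero : pint (fun _ => zero) = 0.
Proof.
  unfold pint; rewrite (RInt_ext _ (fun _ => 0)).
  - rewrite RInt_const; apply Rmult_0_r.
  - intros t _; replace (norm (zero : Y)) with 0 by (symmetry; refine norm_zero).
    unfold nnpow; destruct (Rle_dec 0 0); lra.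
Qed.

Lemma pint_plus (u v : R -> Y) :
  (forall t, continuous u t) -> (forall t, continuous v t) ->
  pint (fun t => plus (u t) (v t)) <= nnpow 2 p * (pint u + pint v).
Proof.
  intros Hu Hv; unfold pint.
  assert (Eu := pint_ex u Hu); assert (Ev := pint_ex v Hv).
  assert (Es := ex_RInt_plus _ _ _ _ Eu Ev).
  assert (R1 := RInt_plus _ _ _ _ Eu Ev).
  assert (R2 := RInt_scal _ _ _ (nnpow 2 p) Es).
  assert (R3 := eq_trans R2 (f_equal (Rmult (nnpow 2 p)) R1)).
  eapply Rle_trans; [|apply Req_le, R3].
  apply RInt_le; [lra | | exact (ex_RInt_scal _ _ _ _ Es) |].
  - apply pint_ex; intros t; refine (continuous_plus u v t (Hu t) (Hv t)).
  - intros t _; eapply Rle_trans; [apply nnpow_le; [lra | refine (norm_triangle _ _)]|].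
    apply nnpow_plus; [lra | refine (norm_ge_0 _) | refine (norm_ge_0 _)].
Qed.

Lemma pint_scal (k : C) (u : R -> Y) : (forall t, continuous u t) ->
  pint (fun t => scal (k : C_AbsRing) (u t)) <= nnpow (Cmod k) p * pint u.
Proof.
  intros Hu; unfold pint; assert (Eu := pint_ex u Hu).
  assert (R2 := RInt_scal _ _ _ (nnpow (Cmod k) p) Eu).
  eapply Rle_trans; [|apply Req_le, R2].
  apply RInt_le; [lra | | exact (ex_RInt_scal _ _ _ _ Eu) |].
  - apply pint_ex; intros t.
    refine (filterlim_comp _ _ _ u (fun y => scal (k : C_AbsRing) y) _ _ _ (Hu t) _).
    refine (filterlim_scal_r _ _).
  - intros t _; eapply Rle_trans; [apply nnpow_le; [lra | refine (norm_scal _ _)]|].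
    change (nnpow (Cmod k * norm (u t)) p <= nnpow (Cmod k) p * nnpow (norm (u t)) p).
    rewrite nnpow_mult; [lra | apply Cmod_ge_0 | refine (norm_ge_0 _)].
Qed.

Lemma Hp_disc_finite (F : analytic_functions Y) :
  Rbar_lt (Hp_disc_norm Y p F) p_infty <->
  exists M, forall r Hr, pint (fun t => proj1_sig F (disc_point r Hr t)) <= M.
Proof.
  refine (Hp_finite p (fun r Hr => pint (fun t => proj1_sig F (disc_point r Hr t))) Hp _).
  intros r Hr; apply pint_ge_0; intros t; apply Hp_disc_continuous, (proj2_sig F).
Qed.

Lemma Hp_disc_submodule :
  submodule (fun F : analytic_functions Y => Rbar_lt (Hp_disc_norm Y p F) p_infty).
Proof.
  split.
  - apply Hp_disc_finite; exists 0; intros r Hr; apply Req_le, pint_zero.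
  - intros F G HF HG; apply Hp_disc_finite in HF; apply Hp_disc_finite in HG.
    destruct HF as [M HM], HG as [N HN].
    apply Hp_disc_finite; exists (nnpow 2 p * (M + N)); intros r Hr.
    eapply Rle_trans; [refine (pint_plus _ _ _ _)|].
    + intros t; apply Hp_disc_continuous, (proj2_sig F).
    + intros t; apply Hp_disc_continuous, (proj2_sig G).
    + apply Rmult_le_compat_l; [apply nnpow_ge_0 | apply Rplus_le_compat; auto].
  - intros k F HF; apply Hp_disc_finite in HF; destruct HF as [M HM].
    apply Hp_disc_finite; exists (nnpow (Cmod k) p * M); intros r Hr.
    eapply Rle_trans; [refine (pint_scal _ _ _)|].
    + intros t; apply Hp_disc_continuous, (proj2_sig F).
    + apply Rmult_le_compat_l; [apply nnpow_ge_0 | auto].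
Qed.

Let J (f : smooth_torus -> Y) (r : R) (Hr : 0 <= r < 1) : R :=
  pint (convolution Y _ (poisson_kernel r Hr) f) +
  pint (convolution Y _ (conj_poisson_kernel r Hr) f).

Lemma Hp_torus_finite (f : distributions Y) :
  Rbar_lt (Hp_torus_norm Y p f) p_infty <->
  exists M, forall r Hr, J (proj1_sig f) r Hr <= M.
Proof.
  assert (C : forall k Hk t, continuous (convolution Y k Hk (proj1_sig f)) t).
  { intros k Hk t; apply convolution_continuous, (proj2_sig f). }
  refine (iff_trans _ (Hp_finite p (J (proj1_sig f)) Hp _)).
  - unfold Hp_torus_norm; erewrite Lub_Rbar_eqset; [apply iff_refl|].
    intros v; simpl.
    assert (E : forall r Hr, Hp_torus_mean Y p (proj1_sig f) r Hr
                             = nnpow (J (proj1_sig f) r Hr) (/ p)).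
    { intros r Hr; unfold Hp_torus_mean, J, pint; f_equal.
      refine (RInt_plus _ _ _ _ (pint_ex _ _) (pint_ex _ _)); apply C. }
    split; intros [r [Hr ->]]; exists r, Hr; [|symmetry]; apply E.
  - intros r Hr; apply Rplus_le_le_0_compat; apply pint_ge_0, C.
Qed.

Lemma Hp_torus_submodule :
  submodule (fun f : distributions Y => Rbar_lt (Hp_torus_norm Y p f) p_infty).
Proof.
  assert (C : forall (f : distributions Y) k Hk t,
             continuous (convolution Y k Hk (proj1_sig f)) t).
  { intros f k Hk t; apply convolution_continuous, (proj2_sig f). }
  split.
  - apply Hp_torus_finite; exists 0; intros r Hr.
    apply Req_le; transitivity (0 + 0); [exact (f_equal2 Rplus pint_zero pint_zero) | ring].
  - intros f g Hf Hg; apply Hp_torus_finite in Hf; apply Hp_torus_finite in Hg.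
    destruct Hf as [M HM], Hg as [N HN].
    apply Hp_torus_finite; exists (nnpow 2 p * (M + N)); intros r Hr.
    apply Rle_trans with (nnpow 2 p * (J (proj1_sig f) r Hr + J (proj1_sig g) r Hr)).
    + assert (A := pint_plus _ _ (C f _ (poisson_kernel r Hr)) (C g _ (poisson_kernel r Hr))).
      assert (B := pint_plus _ _ (C f _ (conj_poisson_kernel r Hr))
                              (C g _ (conj_poisson_kernel r Hr))).
      assert (D := Rplus_le_compat _ _ _ _ A B).
      eapply Rle_trans; [exact D|]; apply Req_le; unfold J; ring.
    + apply Rmult_le_compat_l; [apply nnpow_ge_0 | apply Rplus_le_compat; auto].
  - intros k f Hf; apply Hp_torus_finite in Hf; destruct Hf as [M HM].
    apply Hp_torus_finite; exists (nnpow (Cmod k) p * M); intros r Hr.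
    apply Rle_trans with (nnpow (Cmod k) p * J (proj1_sig f) r Hr).
    + assert (A := pint_scal k _ (C f _ (poisson_kernel r Hr))).
      assert (B := pint_scal k _ (C f _ (conj_poisson_kernel r Hr))).
      assert (D := Rplus_le_compat _ _ _ _ A B).
      eapply Rle_trans; [exact D|]; apply Req_le; unfold J; ring.
    + apply Rmult_le_compat_l; [apply nnpow_ge_0 | auto].
Qed.

End Spaces.

(* Complex vector spaces with a size functional; below, the H_p spaces with
   their quasi-norms.  The laws of a quasi-norm play no role in
   what an isomorphism is, so they are not bundled. *)
Record gauged_space := GaugedSpace {
  gauged_module :> ModuleSpace C_Ring;
  gauge : gauged_module -> R
}.

Definition Hp_disc (Y : CompleteNormedModule C_AbsRing) (p : R) (Hp : 0 < p) :
  gauged_space :=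
  GaugedSpace (sub_ModuleSpace (Hp_disc_submodule Y p Hp))
    (fun F => real (Hp_disc_norm Y p (proj1_sig F))).

Definition Hp_torus (Y : CompleteNormedModule C_AbsRing) (p : R) (Hp : 0 < p) :
  gauged_space :=
  GaugedSpace (sub_ModuleSpace (Hp_torus_submodule Y p Hp))
    (fun f => real (Hp_torus_norm Y p (proj1_sig f))).

(* For linear maps between quasi-normed spaces, continuity is boundedness. *)
Record bounded_linear {U V : gauged_space} (T : U -> V) : Prop := {
  bounded_linear_plus : forall x y : U, T (plus x y) = plus (T x) (T y);
  bounded_linear_scal : forall (c : C_Ring) (x : U), T (scal c x) = scal c (T x);
  bounded_linear_norm : exists M : R, forall x : U, gauge V (T x) <= M * gauge U x
}.

Definition isomorphic (U V : gauged_space) : Prop :=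
  exists (T : U -> V) (S : V -> U),
    bounded_linear T /\ bounded_linear S /\
    (forall x, S (T x) = x) /\ (forall y, T (S y) = y).

(* Main.v *)
From Stdlib Require Import Reals ZArith Lra Lia Psatz List ClassicalEpsilon.
From Stdlib Require Import FunctionalExtensionality ProofIrrelevance.
From Coquelicot Require Import Coquelicot.
Require Import Defs.

Open Scope R_scope.

(** Index the Fourier modes of the torus by [nat] through the enumeration
    [0, -1, 1, -2, 2, ...] of the integers.  A power series [F(z) = sum h_m z^m] and a
    distribution [f] with the same coefficients [h_m] determine each other's means: with
    [z = q e^(2 pi i t)] and [w] its conjugate, the even part of [F] carries the
    frequencies [>= 0] and the odd part the negative ones, so that
    [(P_(q^2) * f)(2t) = (F(z) + F(-z)) / 2 + w (F(w) - F(-w)) / 2], and similarly for [Q].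
    Solving for [F(z)] costs a factor [1 / z], which is harmless away from the centre.

    It remains to see that both sides have coefficients of polynomial growth, with a bound
    in terms of the quasi-norm.  For a distribution this is continuity.  For [F] in [H_p],
    put [S(r) = sum |h_m| r^m]; since [|F| <= S^(1-p) |F|^p] on each circle, averaging
    gives [|h_m| s^m <= S(s)^(1-p) A], hence [S(r) <= S(s)^(1-p) A / (1 - r/s)], an
    inequality that improves itself to [S(r) <= C A^(1/p) (1 - r)^(-1/p)].  The same bound
    on the coefficients controls [F] near the centre.

    Coefficients are recovered by averaging over roots of unity, so that only norms are
    ever integrated. *)

(** A distribution on the torus carries two half-lines of frequencies and a power series only one,
    so taking boundary values cannot be onto. The enumeration repairs this: writing
    [F(z) = G(z^2) + z H(z^2)] identifies the space on the disc with its own square, [G] supplies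
    the frequencies [>= 0] and [H], taken at the conjugate variable, the negative ones. Conversely
    [P + i Q] and [P - i Q] isolate the two halves of [f] up to the coefficient of frequency [0];
    this is how both kernels in the norm come into play. For [p < 1] a mean of order [p] does not
    dominate the integral of [|F|]. A coefficient can then be estimated by a mean only at the price
    of a supremum over the same circle, and the circle is broken by comparing two radii. Analyticity
    is given by local expansions only, so the global power series has to be obtained by
    continuation, again without vector-valued integrals. Since boundedness is proved by inequalities
    for each map and not by an open mapping argument, every constant has to be chosen before [F] or
    [f]. *)

Ltac funext x := apply functional_extensionality; intros x.

(** * Finite sums *)

Fixpoint rsum (f : nat -> R) (n : nat) : R :=
  match n with O => 0 | S n => rsum f n + f n end.

Fixpoint csum (f : nat -> C) (n : nat) : C :=
  match n with O => RtoC 0 | S n => (csum f n + f n)%C end.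

Lemma rsum_ext f g n : (forall k, (k < n)%nat -> f k = g k) -> rsum f n = rsum g n.
Proof.
  induction n as [|n IH]; intros H; simpl; [reflexivity|].
  rewrite IH, (H n); auto.
Qed.

Lemma rsum_le f g n : (forall k, (k < n)%nat -> f k <= g k) -> rsum f n <= rsum g n.
Proof.
  induction n as [|n IH]; intros H; simpl; [lra|].
  apply Rplus_le_compat; auto.
Qed.

Lemma rsum_ge_0 f n : (forall k, 0 <= f k) -> 0 <= rsum f n.
Proof.
  intros H; induction n as [|n IH]; simpl; [lra|]; specialize (H n); lra.
Qed.

Lemma rsum_mono f n m : (forall k, 0 <= f k) -> (n <= m)%nat -> rsum f n <= rsum f m.
Proof.
  intros H; induction 1 as [|m Hm IH]; simpl; [lra|]; specialize (H m); lra.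
Qed.

Lemma rsum_term f n k : (forall k, 0 <= f k) -> (k < n)%nat -> f k <= rsum f n.
Proof.
  intros H Hk; apply Rle_trans with (rsum f (S k)).
  - simpl; assert (A := rsum_ge_0 f k H); lra.
  - apply rsum_mono; auto.
Qed.

Lemma rsum_plus f g n : rsum (fun k => f k + g k) n = rsum f n + rsum g n.
Proof. induction n as [|n IH]; simpl; [ring | rewrite IH; ring]. Qed.

Lemma rsum_scal c f n : rsum (fun k => c * f k) n = c * rsum f n.
Proof. induction n as [|n IH]; simpl; [ring | rewrite IH; ring]. Qed.

Lemma rsum_const c n : rsum (fun _ => c) n = INR n * c.
Proof.
  induction n as [|n IH]; [simpl; ring|].
  change (rsum (fun _ => c) n + c = INR (S n) * c); rewrite IH, S_INR; ring.
Qed.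

Lemma rsum_swap (f : nat -> nat -> R) n m :
  rsum (fun i => rsum (f i) m) n = rsum (fun j => rsum (fun i => f i j) n) m.
Proof.
  induction n as [|n IH]; simpl.
  - induction m as [|m IHm]; simpl; [reflexivity | rewrite <- IHm; ring].
  - rewrite IH, <- rsum_plus; reflexivity.
Qed.

Lemma csum_ext f g n : (forall k, (k < n)%nat -> f k = g k) -> csum f n = csum g n.
Proof.
  induction n as [|n IH]; intros H; simpl; [reflexivity|].
  rewrite IH, (H n); auto.
Qed.

Lemma csum_scal c f n : csum (fun k => c * f k)%C n = (c * csum f n)%C.
Proof. induction n as [|n IH]; simpl; [ring | rewrite IH; ring]. Qed.

Lemma csum_plus f g n : csum (fun k => f k + g k)%C n = (csum f n + csum g n)%C.
Proof. induction n as [|n IH]; simpl; [ring | rewrite IH; ring]. Qed.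

Lemma csum_0 n : csum (fun _ => RtoC 0) n = RtoC 0.
Proof. induction n as [|n IH]; simpl; [ring | rewrite IH; ring]. Qed.

Lemma csum_single f n N : (n < N)%nat -> (forall k, k <> n -> f k = RtoC 0) -> csum f N = f n.
Proof.
  intros Hn Z; induction Hn as [|N Hn IH]; simpl.
  - rewrite (csum_ext _ (fun _ => RtoC 0)) by (intros; apply Z; lia); rewrite csum_0; ring.
  - rewrite IH, (Z N) by lia; ring.
Qed.

Lemma csum_Cmod f n : Cmod (csum f n) <= rsum (fun k => Cmod (f k)) n.
Proof.
  induction n as [|n IH]; simpl; [rewrite Cmod_0; lra|].
  eapply Rle_trans; [apply Cmod_triangle | lra].
Qed.

Lemma csum_split f N : csum f (S N) = (f O + csum (fun k => f (S k)) N)%C.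
Proof.
  induction N as [|N IH]; [simpl; ring|].
  change (csum f (S (S N))) with (csum f (S N) + f (S N))%C; rewrite IH; simpl; ring.
Qed.

Lemma csum_RtoC f n : csum (fun k => RtoC (f k)) n = RtoC (rsum f n).
Proof. induction n as [|n IH]; simpl; [reflexivity | now rewrite IH, RtoC_plus]. Qed.

Lemma div_lt_1 x y : 0 < y -> x < y -> x / y < 1.
Proof.
  intros Hy H; apply Rmult_lt_reg_r with y; [exact Hy|].
  unfold Rdiv; rewrite Rmult_assoc, Rinv_l; lra.
Qed.

Lemma rsum_geom x n : 0 <= x < 1 -> rsum (fun k => x ^ k) n <= / (1 - x).
Proof.
  intros Hx.
  assert (E : rsum (fun k => x ^ k) n = (1 - x ^ n) / (1 - x)).
  { induction n as [|n IH]; simpl; [field; lra|]; rewrite IH; field; lra. }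
  rewrite E; assert (0 <= x ^ n) by (apply pow_le; lra).
  unfold Rdiv; rewrite <- (Rmult_1_l (/ (1 - x))) at 2.
  apply Rmult_le_compat_r; [left; apply Rinv_0_lt_compat; lra | lra].
Qed.

(** * Bounded nonnegative series *)

(** The Cauchy property of bounded increasing partial sums, phrased as a difference of partial sums
    because this is the form in which the tail estimates for vector and complex series consume
    it. *)
Lemma bounded_tail f M : (forall k, 0 <= f k) -> (forall n, rsum f n <= M) ->
  forall eps, 0 < eps -> exists N, forall n m, (N <= n)%nat -> (n <= m)%nat -> rsum f m - rsum f n <= eps.
Proof.
  intros Hf HM eps He.
  destruct (completeness (fun v => exists n, v = rsum f n)) as [l [U L]].
  - exists M; intros v [n ->]; apply HM.
  - exists (rsum f 0), 0%nat; reflexivity.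
  - destruct (classic (exists N, l - eps <= rsum f N)) as [[N HN]|H].
    + exists N; intros n m Hn Hm.
      assert (A := rsum_mono f N n Hf Hn); assert (B : rsum f m <= l) by (apply U; now exists m); lra.
    + exfalso; assert (l <= l - eps); [|lra].
      apply L; intros v [n ->]; left; apply Rnot_le_lt; intros K; apply H; now exists n.
Qed.

(** [real] sends an infinite supremum to [0], so the value means something only under a bound on the
    partial sums, as in [total_lub]. *)
Definition total (f : nat -> R) : R := real (Lub_Rbar (fun v => exists n, v = rsum f n)).

Lemma total_lub f M : (forall n, rsum f n <= M) -> (forall n, rsum f n <= total f) /\ total f <= M.
Proof.
  intros HM; unfold total.
  destruct (Lub_Rbar_correct (fun v => exists n, v = rsum f n)) as [U L].
  assert (A : Rbar_le (Lub_Rbar (fun v => exists n, v = rsum f n)) M)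
    by (apply L; intros v [k ->]; apply HM).
  assert (B : forall n, Rbar_le (rsum f n) (Lub_Rbar (fun v => exists n, v = rsum f n)))
    by (intros n; apply U; now exists n).
  destruct (Lub_Rbar _); simpl in *; try tauto; destruct (B 0%nat).
Qed.

(** * Vector series *)

(* Coquelicot's operations on [Y] under opaque heads, so that rewriting does
   not have to unify canonical structures. *)
Section Vectors.
Context {Y : CompleteNormedModule C_AbsRing}.

Definition vadd (x y : Y) : Y := plus x y.
Definition vsc (c : C) (x : Y) : Y := scal (c : C_AbsRing) x.
Definition v0 : Y := zero.
Definition vn (x : Y) : R := norm x.
Definition vsub (x y : Y) : Y := vadd x (vsc (Copp (RtoC 1)) y).

Lemma vadd_comm x y : vadd x y = vadd y x.
Proof. refine (plus_comm x y). Qed.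
Lemma vadd_assoc x y z : vadd x (vadd y z) = vadd (vadd x y) z.
Proof. refine (plus_assoc x y z). Qed.
Lemma vadd_0_r x : vadd x v0 = x.
Proof. refine (plus_zero_r x). Qed.
Lemma vsc_assoc a b x : vsc a (vsc b x) = vsc (a * b)%C x.
Proof. refine (scal_assoc _ _ _). Qed.
Lemma vsc_plus_r a x y : vsc a (vadd x y) = vadd (vsc a x) (vsc a y).
Proof. refine (scal_distr_l _ _ _). Qed.
Lemma vsc_plus_l a b x : vsc (a + b)%C x = vadd (vsc a x) (vsc b x).
Proof. refine (scal_distr_r _ _ _). Qed.
Lemma vsc_1 x : vsc 1%C x = x.
Proof. refine (scal_one x). Qed.
Lemma vsc_0 x : vsc 0%C x = v0.
Proof. refine (scal_zero_l x). Qed.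
Lemma vsc_v0 a : vsc a v0 = v0.
Proof. refine (scal_zero_r a). Qed.

Lemma vn_ge_0 x : 0 <= vn x.
Proof. refine (norm_ge_0 x). Qed.
Lemma vn_0 : vn v0 = 0.
Proof. refine norm_zero. Qed.
Lemma vn_eq_0 x : vn x = 0 -> x = v0.
Proof. intros H; refine (norm_eq_zero x H). Qed.
Lemma vn_triangle x y : vn (vadd x y) <= vn x + vn y.
Proof. refine (norm_triangle x y). Qed.
Lemma vn_sc_le a x : vn (vsc a x) <= Cmod a * vn x.
Proof. refine (norm_scal _ _). Qed.

(** The axioms of a normed module bound the norm of a multiple only from above. For [a <> 0] the
    same bound applied to [/ a] gives the converse. *)
Lemma vn_sc a x : vn (vsc a x) = Cmod a * vn x.
Proof.
  apply Rle_antisym; [apply vn_sc_le|].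
  destruct (Ceq_dec a 0) as [->|Ha].
  - rewrite Cmod_0, Rmult_0_l; apply vn_ge_0.
  - assert (P := Cmod_gt_0 a); apply P in Ha as Ha'.
    replace x with (vsc (/ a)%C (vsc a x)) at 1.
    + apply Rle_trans with (Cmod a * (Cmod (/ a) * vn (vsc a x))).
      * apply Rmult_le_compat_l; [lra | apply vn_sc_le].
      * rewrite Cmod_inv by exact Ha; apply Req_le; field; lra.
    + rewrite vsc_assoc; replace (/ a * a)%C with (RtoC 1) by (field; exact Ha); apply vsc_1.
Qed.

(** * Linear identities between vectors, by reflection *)

Inductive lexp := LA (n : nat) | LP (a b : lexp) | LS (c : C) (a : lexp) | LZ.
Fixpoint leval (env : list Y) (e : lexp) : Y :=
  match e with
  | LA n => nth n env v0
  | LP a b => vadd (leval env a) (leval env b)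
  | LS c a => vsc c (leval env a)
  | LZ => v0
  end.
Fixpoint lcoef (e : lexp) (i : nat) : C :=
  match e with
  | LA n => if Nat.eqb n i then RtoC 1 else RtoC 0
  | LP a b => (lcoef a i + lcoef b i)%C
  | LS c a => (c * lcoef a i)%C
  | LZ => RtoC 0
  end.
Fixpoint lcomb (cs : nat -> C) (env : list Y) (i : nat) : Y :=
  match env with
  | nil => v0
  | (x :: l)%list => vadd (vsc (cs i) x) (lcomb cs l (S i))
  end.
Fixpoint lsame (e f : lexp) (env : list Y) (i : nat) : Prop :=
  match env with
  | nil => True
  | (_ :: nil)%list => lcoef e i = lcoef f i
  | (_ :: l)%list => lcoef e i = lcoef f i /\ lsame e f l (S i)
  end.

Lemma vadd_swap a b c d : vadd (vadd a b) (vadd c d) = vadd (vadd a c) (vadd b d).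
Proof.
  rewrite <- !vadd_assoc; f_equal; rewrite !vadd_assoc; f_equal; apply vadd_comm.
Qed.

Lemma lcomb_plus c d env i :
  lcomb (fun i => c i + d i)%C env i = vadd (lcomb c env i) (lcomb d env i).
Proof.
  revert i; induction env as [|x l IH]; intros i; simpl; [now rewrite vadd_0_r|].
  rewrite IH, vsc_plus_l; apply vadd_swap.
Qed.

Lemma lcomb_scal k c env i : lcomb (fun i => k * c i)%C env i = vsc k (lcomb c env i).
Proof.
  revert i; induction env as [|x l IH]; intros i; simpl; [now rewrite vsc_v0|].
  now rewrite IH, vsc_plus_r, vsc_assoc.
Qed.

Lemma lcomb_ext c d env i : (forall j, (i <= j)%nat -> c j = d j) -> lcomb c env i = lcomb d env i.
Proof.
  revert i; induction env as [|x l IH]; intros i H; simpl; [reflexivity|].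
  rewrite (H i) by lia; f_equal; apply IH; intros; apply H; lia.
Qed.

Lemma lcomb_0 env i : lcomb (fun _ => RtoC 0) env i = v0.
Proof.
  revert i; induction env as [|x l IH]; intros i; simpl; [reflexivity|].
  rewrite IH, vadd_0_r; apply vsc_0.
Qed.

Lemma leval_atom n env i :
  nth n env v0 = lcomb (fun j => if Nat.eqb (i + n) j then RtoC 1 else RtoC 0) env i.
Proof.
  revert n i; induction env as [|x l IH]; intros n i; simpl; [now destruct n|].
  destruct n as [|n].
  - rewrite Nat.add_0_r, Nat.eqb_refl, vsc_1.
    rewrite (lcomb_ext _ (fun _ => RtoC 0)), lcomb_0, vadd_0_r; [reflexivity|].
    intros j Hj; replace (Nat.eqb i j) with false; [reflexivity|].
    symmetry; apply Nat.eqb_neq; lia.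
  - replace (Nat.eqb (i + S n) i) with false by (symmetry; apply Nat.eqb_neq; lia).
    rewrite vsc_0, vadd_comm, vadd_0_r, (IH n (S i)).
    apply lcomb_ext; intros j _; now rewrite Nat.add_succ_r.
Qed.

Lemma leval_comb env e : leval env e = lcomb (lcoef e) env 0.
Proof.
  induction e as [n|a IHa b IHb|c a IHa|]; simpl.
  - apply (leval_atom n env 0).
  - rewrite IHa, IHb; symmetry; apply lcomb_plus.
  - rewrite IHa; symmetry; apply lcomb_scal.
  - symmetry; apply lcomb_0.
Qed.

(** The atoms are treated as if they were independent, so the condition is sufficient only: a vector
    identity is reduced to one identity in [C] for each atom. *)
Lemma leval_eq env e f : lsame e f env 0 -> leval env e = leval env f.
Proof.
  rewrite !leval_comb; generalize 0%nat.
  induction env as [|x l IH]; intros i H; [reflexivity|].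
  simpl; destruct l as [|y l].
  - simpl in *; now rewrite H.
  - destruct H as [H1 H2]; rewrite H1; f_equal; now apply IH.
Qed.

End Vectors.

Ltac v_mem x l :=
  lazymatch l with
  | nil => constr:(false)
  | (x :: _)%list => constr:(true)
  | (_ :: ?l)%list => v_mem x l
  end.
Ltac v_idx x l :=
  lazymatch l with
  | (x :: _)%list => constr:(O)
  | (_ :: ?l)%list => let n := v_idx x l in constr:(S n)
  end.
Ltac v_atoms l e :=
  lazymatch e with
  | vadd ?a ?b => let l := v_atoms l a in v_atoms l b
  | vsub ?a ?b => let l := v_atoms l a in v_atoms l b
  | vsc _ ?a => v_atoms l a
  | v0 => l
  | ?x => lazymatch v_mem x l with true => l | false => constr:((x :: l)%list) end
  end.
Ltac v_reify l e :=
  lazymatch e with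
  | vadd ?a ?b => let a := v_reify l a in let b := v_reify l b in constr:(LP a b)
  | vsub ?a ?b =>
      let a := v_reify l a in let b := v_reify l b in constr:(LP a (LS (Copp (RtoC 1)) b))
  | vsc ?c ?a => let a := v_reify l a in constr:(LS c a)
  | v0 => constr:(LZ)
  | ?x => let n := v_idx x l in constr:(LA n)
  end.
(** The scalar identities are left to the caller: [ring] settles most of them ([vring]), while
    coefficients with a denominator need [field] and a nonvanishing hypothesis. *)
Ltac vlin :=
  lazymatch goal with
  | |- @eq ?T ?a ?b =>
      let l := v_atoms (@nil T) a in
      let l := v_atoms l b in
      let ea := v_reify l a in
      let eb := v_reify l b in
      apply (leval_eq l ea eb); simpl; repeat split
  end.
Ltac vring := vlin; try ring.

Section VectorSeries.
Context {Y : CompleteNormedModule C_AbsRing}.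
Implicit Types (x y l : Y) (s a b : nat -> Y).

Lemma vsub_eq x y : vn (vsub x y) = 0 -> x = y.
Proof.
  intros H; apply vn_eq_0 in H.
  replace x with (vadd (vsub x y) y) by vring.
  rewrite H; vring.
Qed.

Lemma vn_sub_comm x y : vn (vsub x y) = vn (vsub y x).
Proof.
  replace (vsub x y) with (vsc (Copp (RtoC 1)) (vsub y x)) by vring.
  rewrite vn_sc, Cmod_opp, Cmod_1; ring.
Qed.

Lemma vn_sub_triangle x y l : vn (vsub x l) <= vn (vsub x y) + vn (vsub y l).
Proof.
  replace (vsub x l) with (vadd (vsub x y) (vsub y l)) by vring; apply vn_triangle.
Qed.

Lemma vn_le_sub x y : vn x <= vn y + vn (vsub x y).
Proof.
  replace x with (vadd y (vsub x y)) at 1 by vring; apply vn_triangle.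
Qed.

Lemma minus_vsub x y : minus x y = vsub x y.
Proof.
  unfold vsub, vadd, vsc, minus; f_equal.
  symmetry; refine (scal_opp_one y).
Qed.

Lemma ball_of_vn x y eps : vn (vsub y x) < eps -> ball x eps y.
Proof. intros H; refine (norm_compat1 _ _ _ _); rewrite minus_vsub; exact H. Qed.

(** Balls of the uniform structure lie in norm balls only up to the factor [norm_factor], hence the
    rescaled radius. *)
Lemma vn_of_ball x y eps (H : 0 < eps / @norm_factor _ Y) :
  ball x (eps / @norm_factor _ Y) y -> vn (vsub y x) < eps.
Proof.
  intros HB.
  assert (B := norm_compat2 x y (mkposreal _ H) HB); rewrite minus_vsub in B; simpl in B.
  replace (norm_factor * (eps / @norm_factor _ Y)) with eps in B; [exact B|].
  field; assert (Q := @norm_factor_gt_0 _ Y); lra.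
Qed.

Definition vlim s l := forall eps, 0 < eps ->
  exists N, forall n, (N <= n)%nat -> vn (vsub (s n) l) <= eps.

Lemma vlim_filterlim s l : vlim s l <-> filterlim s eventually (locally l).
Proof.
  split.
  - intros H; apply filterlim_locally; intros eps.
    destruct (H (eps / 2)) as [N HN]; [assert (A := cond_pos eps); lra|].
    exists N; intros n Hn; apply ball_of_vn.
    assert (A := cond_pos eps); specialize (HN n Hn); lra.
  - intros H eps He.
    assert (P : 0 < eps / @norm_factor _ Y)
      by (apply Rdiv_lt_0_compat; [exact He | apply norm_factor_gt_0]).
    destruct (proj1 (filterlim_locally _ _) H (mkposreal _ P)) as [N HN].
    exists N; intros n Hn; left; exact (vn_of_ball _ _ eps P (HN n Hn)).
Qed.

Lemma vlim_unique s l1 l2 : vlim s l1 -> vlim s l2 -> l1 = l2.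
Proof.
  intros H1 H2; apply vsub_eq.
  destruct (Rle_lt_or_eq_dec 0 _ (vn_ge_0 (vsub l1 l2))) as [P|E]; [|lra].
  destruct (H1 (vn (vsub l1 l2) / 3)) as [N1 K1]; [lra|].
  destruct (H2 (vn (vsub l1 l2) / 3)) as [N2 K2]; [lra|].
  specialize (K1 (Nat.max N1 N2) ltac:(lia)); specialize (K2 (Nat.max N1 N2) ltac:(lia)).
  rewrite vn_sub_comm in K1.
  assert (T := vn_sub_triangle l1 (s (Nat.max N1 N2)) l2); lra.
Qed.

Lemma vlim_ext s s' l : (forall n, s n = s' n) -> vlim s l -> vlim s' l.
Proof.
  intros E H eps He; destruct (H eps He) as [N HN]; exists N; intros n Hn.
  rewrite <- E; auto.
Qed.

Lemma vlim_const l : vlim (fun _ => l) l.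
Proof.
  intros eps He; exists 0%nat; intros n _.
  replace (vsub l l) with (@v0 Y) by vring; rewrite vn_0; lra.
Qed.

Lemma vlim_add s s' l l' : vlim s l -> vlim s' l' ->
  vlim (fun n => vadd (s n) (s' n)) (vadd l l').
Proof.
  intros H H' eps He.
  destruct (H (eps / 2)) as [N HN]; [lra|]; destruct (H' (eps / 2)) as [N' HN']; [lra|].
  exists (Nat.max N N'); intros n Hn.
  specialize (HN n ltac:(lia)); specialize (HN' n ltac:(lia)).
  replace (vsub (vadd (s n) (s' n)) (vadd l l')) with (vadd (vsub (s n) l) (vsub (s' n) l')) by vring.
  eapply Rle_trans; [apply vn_triangle | lra].
Qed.

Lemma vlim_sc c s l : vlim s l -> vlim (fun n => vsc c (s n)) (vsc c l).
Proof.
  intros H eps He.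
  assert (P := Cmod_ge_0 c).
  destruct (H (eps / (Cmod c + 1))) as [N HN]; [apply Rdiv_lt_0_compat; lra|].
  exists N; intros n Hn; specialize (HN n Hn).
  replace (vsub (vsc c (s n)) (vsc c l)) with (vsc c (vsub (s n) l)) by vring.
  rewrite vn_sc; apply Rle_trans with ((Cmod c + 1) * (eps / (Cmod c + 1))).
  - apply Rmult_le_compat; try lra; apply vn_ge_0.
  - apply Req_le; field; lra.
Qed.

Lemma vlim_dist_le s l y c N0 : vlim s l ->
  (forall n, (N0 <= n)%nat -> vn (vsub (s n) y) <= c) -> vn (vsub l y) <= c.
Proof.
  intros H B; apply le_epsilon; intros eps He.
  destruct (H eps He) as [N HN].
  specialize (HN (Nat.max N N0) ltac:(lia)); specialize (B (Nat.max N N0) ltac:(lia)).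
  rewrite vn_sub_comm in HN.
  assert (T := vn_sub_triangle l (s (Nat.max N N0)) y); lra.
Qed.

Lemma vsub_0_r x : vsub x v0 = x.
Proof. vring. Qed.

Lemma vlim_norm_le s l c N0 : vlim s l ->
  (forall n, (N0 <= n)%nat -> vn (s n) <= c) -> vn l <= c.
Proof.
  intros H B; rewrite <- (vsub_0_r l); apply (vlim_dist_le s l v0 c N0 H).
  intros n Hn; rewrite vsub_0_r; auto.
Qed.

Fixpoint vsum a (n : nat) : Y :=
  match n with O => v0 | S n => vadd (vsum a n) (a n) end.

Lemma vsum_ext a b n : (forall k, (k < n)%nat -> a k = b k) -> vsum a n = vsum b n.
Proof.
  induction n as [|n IH]; intros H; simpl; [reflexivity|].
  rewrite IH, (H n); auto.
Qed.

Lemma vsum_add a b n : vsum (fun k => vadd (a k) (b k)) n = vadd (vsum a n) (vsum b n).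
Proof. induction n as [|n IH]; simpl; [vring | rewrite IH; vring]. Qed.

Lemma vsum_sc c a n : vsum (fun k => vsc c (a k)) n = vsc c (vsum a n).
Proof. induction n as [|n IH]; simpl; [vring | rewrite IH; vring]. Qed.

Lemma vsum_csum f x n : vsum (fun k => vsc (f k) x) n = vsc (csum f n) x.
Proof. induction n as [|n IH]; simpl; [vring | rewrite IH; vring]. Qed.

Lemma vsum_swap (a : nat -> nat -> Y) n m :
  vsum (fun i => vsum (a i) m) n = vsum (fun j => vsum (fun i => a i j) n) m.
Proof.
  induction n as [|n IH]; simpl.
  - induction m as [|m IHm]; simpl; [reflexivity | rewrite <- IHm; vring].
  - rewrite IH, <- vsum_add; reflexivity.
Qed.

Lemma vsum_single a n N : (n < N)%nat -> (forall k, k <> n -> a k = v0) -> vsum a N = a n.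
Proof.
  intros Hn Z; induction Hn as [|N Hn IH]; simpl.
  - replace (vsum a n) with (vsum (fun _ => vsc (RtoC 0) (@v0 Y)) n).
    + rewrite vsum_sc; vring.
    + apply vsum_ext; intros k Hk; rewrite (Z k) by lia; vring.
  - rewrite IH, (Z N) by lia; vring.
Qed.

Lemma vsum_norm a n : vn (vsum a n) <= rsum (fun k => vn (a k)) n.
Proof.
  induction n as [|n IH]; simpl; [rewrite vn_0; lra|].
  eapply Rle_trans; [apply vn_triangle | lra].
Qed.

Lemma vsum_norm_diff a n m : (n <= m)%nat ->
  vn (vsub (vsum a m) (vsum a n)) <= rsum (fun k => vn (a k)) m - rsum (fun k => vn (a k)) n.
Proof.
  induction 1 as [|m Hm IH].
  - replace (vsub (vsum a n) (vsum a n)) with (@v0 Y) by vring; rewrite vn_0; lra.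
  - simpl; replace (vsub (vadd (vsum a m) (a m)) (vsum a n))
      with (vadd (vsub (vsum a m) (vsum a n)) (a m)) by vring.
    eapply Rle_trans; [apply vn_triangle | lra].
Qed.

Lemma vlim_vsum (s : nat -> nat -> Y) (l : nat -> Y) K : (forall k, (k < K)%nat -> vlim (s k) (l k)) ->
  vlim (fun n => vsum (fun k => s k n) K) (vsum l K).
Proof.
  induction K as [|K IH]; intros H; simpl; [apply vlim_const|].
  apply vlim_add; auto.
Qed.

Definition vseries a l := vlim (vsum a) l.

Lemma vsum_sum_n a n : vsum a (S n) = sum_n a n.
Proof.
  induction n as [|n IH].
  - rewrite sum_O; simpl; vring.
  - rewrite sum_Sn, <- IH; reflexivity.
Qed.

Lemma vseries_is_series a l : vseries a l <-> is_series a l.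
Proof.
  unfold is_series; rewrite <- vlim_filterlim; split; intros H eps He;
    destruct (H eps He) as [N HN].
  - exists N; intros n Hn; rewrite <- vsum_sum_n; apply HN; lia.
  - exists (S N); intros [|n] Hn; [lia|].
    rewrite vsum_sum_n; apply HN; lia.
Qed.

Lemma vseries_single a n : (forall k, k <> n -> a k = v0) -> vseries a (a n).
Proof.
  intros Z eps He; exists (S n); intros N HN; rewrite (vsum_single a n) by auto.
  replace (vsub (a n) (a n)) with (@v0 Y) by vring; rewrite vn_0; lra.
Qed.

Lemma vseries_unique a l1 l2 : vseries a l1 -> vseries a l2 -> l1 = l2.
Proof. apply vlim_unique. Qed.

Lemma vseries_ext a b l : (forall k, a k = b k) -> vseries a l -> vseries b l.
Proof.
  intros E; apply vlim_ext; intros n; apply vsum_ext; auto.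
Qed.

Lemma vseries_add a b l l' : vseries a l -> vseries b l' ->
  vseries (fun k => vadd (a k) (b k)) (vadd l l').
Proof.
  intros H H'; apply vlim_ext with (fun n => vadd (vsum a n) (vsum b n)).
  - intros n; symmetry; apply vsum_add.
  - now apply vlim_add.
Qed.

Lemma vseries_sc c a l : vseries a l -> vseries (fun k => vsc c (a k)) (vsc c l).
Proof.
  intros H; apply vlim_ext with (fun n => vsc c (vsum a n)).
  - intros n; symmetry; apply vsum_sc.
  - now apply vlim_sc.
Qed.

(** Absolute convergence is turned into convergence by the completeness of [Y]; later existence
    proofs for vector sums go through this. *)
Lemma vseries_ex a M : (forall n, rsum (fun k => vn (a k)) n <= M) -> exists l, vseries a l.
Proof.
  intros H.
  assert (E : ex_series a).
  { apply (ex_series_le a (fun k => vn (a k))); [intros n; apply Rle_refl|].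
    assert (X : ex_finite_lim_seq (sum_n (fun k => vn (a k)))).
    { apply ex_finite_lim_seq_incr with M.
      - intros n; rewrite sum_Sn; change plus with Rplus; simpl.
        assert (A := vn_ge_0 (a (S n))); lra.
      - intros n; specialize (H (S n)); eapply Rle_trans; [|exact H]; apply Req_le.
        clear H; induction n as [|n IH].
        + rewrite sum_O; simpl; ring.
        + rewrite sum_Sn, IH; reflexivity. }
    destruct X as [l Hl]; exists l; exact Hl. }
  destruct E as [l Hl]; exists l; now apply vseries_is_series.
Qed.

Lemma vseries_tail a l n e : vseries a l ->
  (forall m, (n <= m)%nat -> rsum (fun k => vn (a k)) m - rsum (fun k => vn (a k)) n <= e) ->
  vn (vsub l (vsum a n)) <= e.
Proof.
  intros H B; apply (vlim_dist_le _ _ _ _ n H); intros m Hm.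
  eapply Rle_trans; [apply vsum_norm_diff, Hm | auto].
Qed.

Lemma vseries_norm_le a l M : vseries a l ->
  (forall n, rsum (fun k => vn (a k)) n <= M) -> vn l <= M.
Proof.
  intros H B; apply (vlim_norm_le _ _ _ 0 H); intros n _.
  eapply Rle_trans; [apply vsum_norm | apply B].
Qed.

Lemma vseries_term_bounded a l : vseries a l -> exists M, 0 < M /\ forall n, vn (a n) <= M.
Proof.
  intros H; destruct (H 1 Rlt_0_1) as [N HN].
  (* From [N] on, two consecutive partial sums are both within [1] of [l], so the term between them
     has norm at most [2]. *)
  exists (rsum (fun k => vn (a k)) N + 2); split.
  - assert (A := rsum_ge_0 (fun k => vn (a k)) N (fun k => vn_ge_0 _)); lra.
  - intros n; destruct (Nat.lt_ge_cases n N) as [Hn|Hn].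
    + assert (A := rsum_term (fun k => vn (a k)) N n (fun k => vn_ge_0 _) Hn); simpl in A; lra.
    + assert (A := HN n Hn); assert (B := HN (S n) ltac:(lia)).
      simpl in B; rewrite vn_sub_comm in A.
      assert (T := vn_sub_triangle (vadd (vsum a n) (a n)) l (vsum a n)).
      replace (vsub (vadd (vsum a n) (a n)) (vsum a n)) with (a n) in T by vring.
      assert (D := rsum_ge_0 (fun k => vn (a k)) N (fun k => vn_ge_0 _)); lra.
Qed.

(** [iota] selects the sum by uniqueness; for a divergent series the value is arbitrary. *)
Definition vtotal a : Y := iota (fun l => vseries a l).

Lemma vtotal_correct a : (exists l, vseries a l) -> vseries a (vtotal a).
Proof.
  intros [l Hl]; apply (iota_correct (fun l => vseries a l)).
  exists l; split; [exact Hl|]; intros l'; now apply vseries_unique.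
Qed.

Lemma vtotal_eq a l : vseries a l -> vtotal a = l.
Proof.
  intros H; apply (vseries_unique a); [apply vtotal_correct; now exists l | exact H].
Qed.

End VectorSeries.

(** * The circle *)

Lemma circle_add x y : circle (x + y) = (circle x * circle y)%C.
Proof.
  unfold circle; rewrite Rmult_plus_distr_l, cos_plus, sin_plus.
  apply injective_projections; simpl; ring.
Qed.

Lemma circle_0 : circle 0 = RtoC 1.
Proof. unfold circle; now rewrite Rmult_0_r, cos_0, sin_0. Qed.

Lemma circle_nat m t : circle (INR m * t) = (circle t ^ m)%C.
Proof.
  induction m as [|m IH]; [simpl; rewrite Rmult_0_l; apply circle_0|].
  rewrite S_INR, Rmult_plus_distr_r, Rmult_1_l, circle_add, IH; simpl; ring.
Qed.

Lemma circle_opp t : (circle (- t) * circle t)%C = RtoC 1.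
Proof. rewrite <- circle_add, Rplus_opp_l; apply circle_0. Qed.

Lemma circle_IZR n : circle (IZR n) = RtoC 1.
Proof.
  assert (P : forall k : nat, circle (INR k) = RtoC 1).
  { intros k; rewrite <- (Rmult_1_r (INR k)), circle_nat.
    replace (circle 1) with (RtoC 1).
    - apply Cpow_1_l.
    - rewrite <- circle_0, <- (Rplus_0_l 1) at 1; symmetry; apply circle_periodic. }
  destruct (Z.le_gt_cases 0 n) as [H|H].
  - rewrite <- (Z2Nat.id n) by exact H; rewrite <- INR_IZR_INZ; apply P.
  - replace n with (- Z.of_nat (Z.to_nat (- n)))%Z by lia.
    rewrite opp_IZR, <- INR_IZR_INZ.
    assert (A := circle_opp (INR (Z.to_nat (- n)))); rewrite P, Cmult_1_r in A; exact A.
Qed.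

(** [1 - cos (2 PI x) = 2 sin^2 (PI x)], and the sine has no zero strictly between [0] and [PI]. *)
Lemma circle_neq_1 x : 0 < Rabs x < 1 -> circle x <> RtoC 1.
Proof.
  intros Hx E; unfold circle in E; injection E as E1 E2.
  replace (2 * PI * x) with (2 * (PI * x)) in E1 by ring.
  rewrite cos_2a_sin in E1.
  assert (Z : sin (PI * x) = 0) by nra.
  assert (P := PI_RGT_0).
  destruct (Rcase_abs x) as [N|N].
  - rewrite Rabs_left in Hx by exact N.
    assert (0 < sin (PI * - x)) by (apply sin_gt_0; nra).
    rewrite <- Ropp_mult_distr_r, sin_neg in H; lra.
  - rewrite Rabs_right in Hx by exact N.
    assert (0 < sin (PI * x)) by (apply sin_gt_0; nra); lra.
Qed.

Lemma csum_geom (c : C) N : ((c - 1) * csum (fun j => c ^ j) N = c ^ N - 1)%C.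
Proof.
  induction N as [|N IH]; simpl; [ring|].
  rewrite Cmult_plus_distr_l, IH; ring.
Qed.

Lemma csum_const (c : C) N : csum (fun _ => c) N = (INR N * c)%C.
Proof.
  induction N as [|N IH]; [simpl; ring|].
  change (csum (fun _ => c) N + c = INR (S N) * c)%C; rewrite IH, S_INR, RtoC_plus; ring.
Qed.

(** A geometric sum whose ratio [circle ((m - n) / N)] has [N]-th power [1]. The bounds on [m] and
    [n] give [|m - n| < N], so for [m <> n] the ratio itself is not [1]. *)
Lemma roots_of_unity_sum (N n m : nat) : (n < N)%nat -> (m < N)%nat ->
  csum (fun j => circle ((INR m - INR n) * (INR j / INR N))) N =
  if Nat.eqb m n then RtoC (INR N) else RtoC 0.
Proof.
  intros Hn Hm.
  assert (PN : 0 < INR N) by (apply lt_0_INR; lia).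
  set (x := (INR m - INR n) / INR N).
  rewrite (csum_ext _ (fun j => (circle x ^ j)%C)).
  2:{ intros j _; rewrite <- circle_nat; f_equal; unfold x; field; lra. }
  destruct (Nat.eqb_spec m n) as [->|D].
  - replace x with 0 by (unfold x; field; lra); rewrite circle_0.
    rewrite (csum_ext _ (fun _ => RtoC 1)) by (intros; apply Cpow_1_l).
    rewrite csum_const; ring.
  - assert (A := csum_geom (circle x) N).
    rewrite <- circle_nat in A.
    replace (INR N * x) with (IZR (Z.of_nat m - Z.of_nat n)) in A.
    2:{ rewrite minus_IZR, <- !INR_IZR_INZ; unfold x; field; lra. }
    rewrite circle_IZR in A.
    assert (NZ : circle x <> RtoC 1).
    { apply circle_neq_1; unfold x.
      unfold Rdiv; rewrite Rabs_mult, (Rabs_pos_eq (/ INR N)) by (left; now apply Rinv_0_lt_compat).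
      apply lt_INR in Hn; apply lt_INR in Hm.
      assert (Pn := pos_INR n); assert (Pm := pos_INR m).
      assert (INR m <> INR n) by (intros E; apply INR_eq in E; auto).
      split.
      - apply Rmult_lt_0_compat; [apply Rabs_pos_lt; lra | now apply Rinv_0_lt_compat].
      - apply Rmult_lt_reg_r with (INR N); [exact PN|].
        rewrite Rmult_assoc, Rinv_l, Rmult_1_r, Rmult_1_l by lra.
        apply Rabs_def1; lra. }
    assert (NZ' : (circle x - 1)%C <> RtoC 0).
    { intros E; apply NZ; replace (circle x) with (circle x - 1 + 1)%C by ring; rewrite E; ring. }
    replace (csum (fun j => circle x ^ j)%C N)
      with ((circle x - 1) * csum (fun j => circle x ^ j)%C N / (circle x - 1))%C by (field; exact NZ').
    rewrite A; field; exact NZ'.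
Qed.

Lemma Cmod_circle_pow t m : Cmod (circle t ^ m)%C = 1.
Proof. rewrite Cmod_pow, Cmod_circle; apply pow1. Qed.

Section PowerSeries.
Context {Y : CompleteNormedModule C_AbsRing}.
Implicit Types (a b : nat -> Y).

(** * Coefficients as discrete means *)

(** Inversion of the discrete Fourier transform at the nodes [t + j / N]. With only [N] consecutive
    frequencies there is no aliasing, and the formula is exact. *)
Lemma trig_mean a (N n : nat) t : (n < N)%nat ->
  vsum (fun j => vsc (circle (- (INR n * (t + INR j / INR N))))
                   (vsum (fun m => vsc (circle (INR m * (t + INR j / INR N))) (a m)) N)) N
  = vsc (RtoC (INR N)) (a n).
Proof.
  intros Hn.
  rewrite (vsum_ext _ (fun j => vsum (fun m =>
    vsc (circle ((INR m - INR n) * t) * circle ((INR m - INR n) * (INR j / INR N)))%C (a m)) N)).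
  2:{ intros j _; rewrite <- vsum_sc; apply vsum_ext; intros m _.
      rewrite vsc_assoc, <- !circle_add; f_equal; f_equal; ring. }
  rewrite vsum_swap.
  rewrite (vsum_ext _ (fun m => vsc (if Nat.eqb m n then RtoC (INR N) else RtoC 0) (a m))).
  2:{ intros m Hm; rewrite vsum_csum, csum_scal, (roots_of_unity_sum N n m Hn Hm).
      destruct (Nat.eqb_spec m n) as [->|D].
      - rewrite Rminus_diag, Rmult_0_l, circle_0, Cmult_1_l; reflexivity.
      - now rewrite Cmult_0_r. }
  rewrite (vsum_single _ n N Hn), Nat.eqb_refl; [reflexivity|].
  intros k Hk; apply Nat.eqb_neq in Hk; rewrite Hk; apply vsc_0.
Qed.

(** [trig_mean] applies to the first [N] terms, and [e] pays for the tail at the nodes. The offset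
    [t] stays free so that it can be integrated out later. *)
Lemma coef_le_mean a (g : R -> Y) (N n : nat) e t :
  (forall t, vseries (fun m => vsc (circle (INR m * t)) (a m)) (g t)) ->
  (forall M, (N <= M)%nat -> rsum (fun k => vn (a k)) M - rsum (fun k => vn (a k)) N <= e) ->
  (n < N)%nat ->
  vn (a n) <= / INR N * rsum (fun j => vn (g (t + INR j / INR N))) N + e.
Proof.
  intros Hg He Hn.
  assert (PN : 0 < INR N) by (apply lt_0_INR; lia).
  assert (E := f_equal vn (trig_mean a N n t Hn)).
  rewrite vn_sc, Cmod_R, Rabs_pos_eq in E by lra.
  apply Rmult_le_reg_l with (INR N); [exact PN|]; rewrite <- E.
  eapply Rle_trans; [apply vsum_norm|].
  rewrite Rmult_plus_distr_l, <- Rmult_assoc, Rinv_r, Rmult_1_l by lra.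
  rewrite <- rsum_const, <- rsum_plus; apply rsum_le; intros j _.
  rewrite vn_sc, Cmod_circle, Rmult_1_l.
  eapply Rle_trans; [apply (vn_le_sub _ (g (t + INR j / INR N)))|].
  apply Rplus_le_compat_l; rewrite vn_sub_comm.
  apply (vseries_tail _ _ _ _ (Hg _)); intros M HM.
  rewrite (rsum_ext _ (fun k => vn (a k)) M), (rsum_ext _ (fun k => vn (a k)) N).
  - now apply He.
  - intros k _; now rewrite vn_sc, Cmod_circle, Rmult_1_l.
  - intros k _; now rewrite vn_sc, Cmod_circle, Rmult_1_l.
Qed.

(** Cauchy's estimate from sample means. [M] only ensures that the tails vanish uniformly; it leaves
    no trace in the final bound, which is the point. *)
Lemma coef_le_sup a (B M : R) :
  (forall n, rsum (fun k => vn (a k)) n <= M) ->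
  (forall t l, vseries (fun m => vsc (circle (INR m * t)) (a m)) l -> vn l <= B) ->
  forall n, vn (a n) <= B.
Proof.
  intros HM HB n.
  set (g := fun t => vtotal (fun m => vsc (circle (INR m * t)) (a m))).
  assert (Hg : forall t, vseries (fun m => vsc (circle (INR m * t)) (a m)) (g t)).
  { intros t; apply vtotal_correct, (vseries_ex _ M); intros k.
    rewrite (rsum_ext _ (fun k => vn (a k))); [apply HM|].
    intros j _; now rewrite vn_sc, Cmod_circle, Rmult_1_l. }
  apply le_epsilon; intros eps He.
  destruct (bounded_tail _ M (fun k => vn_ge_0 (a k)) HM eps He) as [N HN].
  set (N' := S (Nat.max N n)).
  assert (PN : 0 < INR N') by (apply lt_0_INR; unfold N'; lia).
  eapply Rle_trans; [apply (coef_le_mean a g N' n eps 0 Hg)|].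
  - intros K HK; apply HN; unfold N' in *; lia.
  - unfold N'; lia.
  - apply Rplus_le_compat_r.
    apply Rle_trans with (/ INR N' * rsum (fun _ => B) N').
    + apply Rmult_le_compat_l; [left; now apply Rinv_0_lt_compat|].
      apply rsum_le; intros j _; exact (HB _ _ (Hg _)).
    + rewrite rsum_const; apply Req_le; field; lra.
Qed.

(** * Change of centre in power series *)

Definition pser a (w : C) (l : Y) : Prop := vseries (fun n => vsc (w ^ n)%C (a n)) l.
Definition abs_conv a (r M : R) : Prop := forall n, rsum (fun k => vn (a k) * r ^ k) n <= M.

Lemma pser_abs_bound a w r M : abs_conv a r M -> Cmod w <= r ->
  forall n, rsum (fun k => vn (vsc (w ^ k)%C (a k))) n <= M.
Proof.
  intros H Hw n; eapply Rle_trans; [|apply (H n)].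
  apply rsum_le; intros k _; rewrite vn_sc, Cmod_pow, Rmult_comm.
  apply Rmult_le_compat_l; [apply vn_ge_0|].
  apply pow_incr; split; [apply Cmod_ge_0 | exact Hw].
Qed.

Lemma pser_ex a w r M : abs_conv a r M -> Cmod w <= r -> exists l, pser a w l.
Proof. intros H Hw; apply (vseries_ex _ M), (pser_abs_bound a w r M H Hw). Qed.

Lemma abs_conv_le a r s M : abs_conv a r M -> 0 <= s <= r -> abs_conv a s M.
Proof.
  intros H Hs n; eapply Rle_trans; [|apply (H n)].
  apply rsum_le; intros k _; apply Rmult_le_compat_l; [apply vn_ge_0 | now apply pow_incr].
Qed.

Lemma abs_conv_of_terms a r s M : 0 <= s < r -> (forall n, vn (a n) * r ^ n <= M) ->
  abs_conv a s (M * / (1 - s / r)).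
Proof.
  intros Hs H n.
  assert (Q : 0 <= s / r < 1).
  { split; [apply Rdiv_le_0_compat; lra | apply div_lt_1; lra]. }
  assert (HM : 0 <= M) by (eapply Rle_trans; [|apply (H 0%nat)]; simpl; assert (A := vn_ge_0 (a 0%nat)); lra).
  apply Rle_trans with (M * rsum (fun k => (s / r) ^ k) n).
  - rewrite <- rsum_scal; apply rsum_le; intros k _.
    replace (vn (a k) * s ^ k) with (vn (a k) * r ^ k * (s / r) ^ k).
    + apply Rmult_le_compat_r; [apply pow_le; lra | apply H].
    + rewrite Rmult_assoc, <- Rpow_mult_distr; do 2 f_equal; field; lra.
  - apply Rmult_le_compat_l; [exact HM | now apply rsum_geom].
Qed.

(** Abel's lemma: convergence at [w] bounds the terms there, and on radius [s] they are dominated by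
    a geometric series of ratio [s / |w|]. *)
Lemma pser_abs_conv a w l s : pser a w l -> 0 <= s < Cmod w -> exists M, 0 < M /\ abs_conv a s M.
Proof.
  intros H Hs; destruct (vseries_term_bounded _ _ H) as [M [PM HM]].
  exists (M * / (1 - s / Cmod w)); split.
  - apply Rmult_lt_0_compat; [exact PM|]; apply Rinv_0_lt_compat.
    assert (s / Cmod w < 1) by (apply div_lt_1; lra); lra.
  - apply abs_conv_of_terms; [exact Hs|]; intros n; specialize (HM n).
    rewrite vn_sc, Cmod_pow in HM; lra.
Qed.

(* The coefficient of [v^k] in [(u + v)^n]. *)
Fixpoint shift_coef (u : C) (n k : nat) : C :=
  match n, k with
  | O, O => RtoC 1
  | O, S _ => RtoC 0
  | S n, O => (u * shift_coef u n 0)%C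
  | S n, S k => (u * shift_coef u n (S k) + shift_coef u n k)%C
  end.

(** The binomial coefficient times [u^(n-k)], given by Pascal's recursion so that no truncated
    subtraction appears and the value is [0] for [k > n]. The real version majorizes the moduli of
    [shift_coef]. *)
Fixpoint rshift_coef (u : R) (n k : nat) : R :=
  match n, k with
  | O, O => 1
  | O, S _ => 0
  | S n, O => u * rshift_coef u n 0
  | S n, S k => u * rshift_coef u n (S k) + rshift_coef u n k
  end.

Lemma shift_coef_sum u v n K : (n < K)%nat ->
  csum (fun k => shift_coef u n k * v ^ k)%C K = ((u + v) ^ n)%C.
Proof.
  revert K; induction n as [|n IH]; intros [|K] H; try lia.
  - rewrite csum_split; simpl; rewrite (csum_ext _ (fun _ => RtoC 0)) by (intros; ring).
    rewrite csum_0; ring.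
  - rewrite csum_split; simpl.
    rewrite (csum_ext _ (fun k => u * (shift_coef u n (S k) * v ^ S k) + v * (shift_coef u n k * v ^ k))%C)
      by (intros; simpl; ring).
    rewrite csum_plus, !csum_scal, (IH K) by lia.
    assert (E := IH (S K) ltac:(lia)); rewrite csum_split in E.
    set (X := csum (fun k => shift_coef u n (S k) * v ^ S k)%C K) in *; clearbody X.
    simpl in E; rewrite <- E; ring.
Qed.

Lemma rshift_coef_ge_0 u n k : 0 <= u -> 0 <= rshift_coef u n k.
Proof.
  intros Hu; revert k; induction n as [|n IH]; intros [|k]; simpl; try lra.
  - apply Rmult_le_pos; auto.
  - apply Rplus_le_le_0_compat; [apply Rmult_le_pos|]; auto.
Qed.

Lemma shift_coef_real u n k : shift_coef (RtoC u) n k = RtoC (rshift_coef u n k).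
Proof.
  revert k; induction n as [|n IH]; intros [|k]; simpl; try reflexivity;
    rewrite !IH, ?RtoC_plus, !RtoC_mult; reflexivity.
Qed.

Lemma shift_coef_Cmod u n k : Cmod (shift_coef u n k) <= rshift_coef (Cmod u) n k.
Proof.
  revert k; induction n as [|n IH]; intros [|k]; simpl.
  - rewrite Cmod_1; lra.
  - rewrite Cmod_0; lra.
  - rewrite Cmod_mult; apply Rmult_le_compat_l; [apply Cmod_ge_0 | apply IH].
  - eapply Rle_trans; [apply Cmod_triangle|]; apply Rplus_le_compat; [|apply IH].
    rewrite Cmod_mult; apply Rmult_le_compat_l; [apply Cmod_ge_0 | apply IH].
Qed.

Lemma rshift_coef_sum_eq u v n K : (n < K)%nat ->
  rsum (fun k => rshift_coef u n k * v ^ k) K = (u + v) ^ n.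
Proof.
  intros H; apply RtoC_inj; rewrite <- csum_RtoC, RtoC_pow, RtoC_plus, <- (shift_coef_sum _ _ n K H).
  apply csum_ext; intros k _; now rewrite shift_coef_real, RtoC_mult, RtoC_pow.
Qed.

Lemma rshift_coef_sum u v n K : 0 <= u -> 0 <= v ->
  rsum (fun k => rshift_coef u n k * v ^ k) K <= (u + v) ^ n.
Proof.
  intros Hu Hv; rewrite <- (rshift_coef_sum_eq u v n (S (Nat.max n K))) by lia.
  apply rsum_mono; [|lia]; intros k.
  apply Rmult_le_pos; [now apply rshift_coef_ge_0 | now apply pow_le].
Qed.

Lemma rshift_coef_term u v n k : 0 <= u -> 0 <= v -> rshift_coef u n k * v ^ k <= (u + v) ^ n.
Proof.
  intros Hu Hv; eapply Rle_trans; [|apply (rshift_coef_sum u v n (S k) Hu Hv)].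
  apply (rsum_term (fun k => rshift_coef u n k * v ^ k)); [|lia].
  intros j; apply Rmult_le_pos; [now apply rshift_coef_ge_0 | now apply pow_le].
Qed.

(** Homogeneity of degree [n - k] in the centre, multiplied by [circle t ^ k] so as to make sense
    also for [k > n], where both sides vanish. *)
Lemma shift_coef_circle u t n k :
  (circle t ^ k * shift_coef (u * circle t) n k = circle t ^ n * shift_coef u n k)%C.
Proof.
  revert k; induction n as [|n IH]; intros [|k]; simpl.
  - ring.
  - ring.
  - assert (E := IH 0%nat); simpl in E; rewrite Cmult_1_l in E; rewrite E; ring.
  - rewrite Cmult_plus_distr_l.
    assert (E := IH (S k)); simpl in E; assert (E' := IH k).
    replace (circle t * circle t ^ k * (u * circle t * shift_coef (u * circle t) n (S k)))%C
      with (u * circle t * (circle t * circle t ^ k * shift_coef (u * circle t) n (S k)))%C by ring.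
    rewrite E.
    replace (circle t * circle t ^ k * shift_coef (u * circle t) n k)%C
      with (circle t * (circle t ^ k * shift_coef (u * circle t) n k))%C by ring.
    rewrite E'; ring.
Qed.

(** Expand [(u + v)^n] and exchange the summations over [n] and [k]; the double series is dominated
    by the one for [|a n| (|u| + d)^n]. The exchange is made on finite sums before passing to the
    limit. The bound [M] is inherited unchanged, which keeps the estimates uniform in the centre. *)
Lemma recenter a (u : C) (d M : R) : 0 < d -> abs_conv a (Cmod u + d) M ->
  exists b,
    (forall k, vseries (fun n => vsc (shift_coef u n k) (a n)) (b k)) /\
    abs_conv b d M /\
    (forall v l, Cmod v <= d -> pser a (u + v)%C l -> pser b v l).
Proof.
  intros Hd HM.
  assert (Hu := Cmod_ge_0 u).
  assert (Hb : forall k, exists l, vseries (fun n => vsc (shift_coef u n k) (a n)) l).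
  (* [rshift_coef |u| n k d^k] is a single term of the binomial expansion of [(|u| + d)^n]. *)
  { intros k; apply (vseries_ex _ (M * / d ^ k)); intros N.
    assert (P : 0 < d ^ k) by now apply pow_lt.
    apply Rmult_le_reg_r with (d ^ k); [exact P|].
    rewrite Rmult_assoc, Rinv_l, Rmult_1_r by lra.
    eapply Rle_trans; [|apply (HM N)].
    rewrite Rmult_comm, <- rsum_scal; apply rsum_le; intros n _.
    rewrite vn_sc.
    apply Rle_trans with (vn (a n) * (rshift_coef (Cmod u) n k * d ^ k)).
    - rewrite (Rmult_comm (d ^ k)), (Rmult_comm (Cmod _)), Rmult_assoc.
      apply Rmult_le_compat_l; [apply vn_ge_0|]; apply Rmult_le_compat_r; [lra | apply shift_coef_Cmod].
    - apply Rmult_le_compat_l; [apply vn_ge_0 | apply rshift_coef_term; lra]. }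
  exists (fun k => vtotal (fun n => vsc (shift_coef u n k) (a n))).
  assert (Hb' : forall k, vseries (fun n => vsc (shift_coef u n k) (a n))
                            (vtotal (fun n => vsc (shift_coef u n k) (a n))))
    by (intros k; apply vtotal_correct, Hb).
  set (b := fun k => vtotal (fun n => vsc (shift_coef u n k) (a n))) in *.
  change (forall k, vseries (fun n => vsc (shift_coef u n k) (a n)) (b k)) in Hb'.
  split; [exact Hb'|]; split.
  - intros K.
    (* compare with the partial sums in [n], then let their length grow *)
    apply le_epsilon; intros eps He.
    assert (A : forall K e, 0 < e -> exists N0, forall N, (N0 <= N)%nat ->
      rsum (fun k => vn (b k) * d ^ k) K <=
      rsum (fun k => vn (vsum (fun n => vsc (shift_coef u n k) (a n)) N) * d ^ k) K + e).
    { clear K; induction K as [|K IH]; intros e Pe; [exists 0%nat; intros; simpl; lra|].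
      destruct (IH (e / 2)) as [N1 H1]; [lra|].
      assert (P : 0 < d ^ K) by now apply pow_lt.
      destruct (Hb' K (e / 2 / d ^ K)) as [N2 H2]; [apply Rdiv_lt_0_compat; lra|].
      exists (Nat.max N1 N2); intros N HN; simpl.
      specialize (H1 N ltac:(lia)); specialize (H2 N ltac:(lia)).
      rewrite vn_sub_comm in H2.
      assert (T := vn_le_sub (b K) (vsum (fun n => vsc (shift_coef u n K) (a n)) N)).
      assert (Q : vn (b K) * d ^ K <=
        (vn (vsum (fun n => vsc (shift_coef u n K) (a n)) N) + e / 2 / d ^ K) * d ^ K)
        by (apply Rmult_le_compat_r; lra).
      rewrite Rmult_plus_distr_r in Q.
      replace (e / 2 / d ^ K * d ^ K) with (e / 2) in Q by (field; lra); lra. }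
    destruct (A K eps He) as [N0 H0]; eapply Rle_trans; [apply (H0 N0), Nat.le_refl|].
    apply Rplus_le_compat_r; eapply Rle_trans; [|apply (HM N0)].
    apply Rle_trans with (rsum (fun k => rsum (fun n => vn (a n) * (rshift_coef (Cmod u) n k * d ^ k)) N0) K).
    + apply rsum_le; intros k _.
      assert (P : 0 < d ^ k) by now apply pow_lt.
      apply Rle_trans with (rsum (fun n => vn (vsc (shift_coef u n k) (a n))) N0 * d ^ k).
      * apply Rmult_le_compat_r; [lra | apply vsum_norm].
      * rewrite Rmult_comm, <- rsum_scal; apply rsum_le; intros n _; rewrite vn_sc.
        rewrite (Rmult_comm (d ^ k)), (Rmult_comm (Cmod _)), Rmult_assoc.
        apply Rmult_le_compat_l; [apply vn_ge_0|]; apply Rmult_le_compat_r; [lra | apply shift_coef_Cmod].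
    + rewrite rsum_swap; apply rsum_le; intros n _.
      rewrite rsum_scal; apply Rmult_le_compat_l; [apply vn_ge_0 | apply rshift_coef_sum; lra].
  - intros v l Hv Hl.
    assert (HM' : forall N, rsum (fun n => vn (a n) * (Cmod u + Cmod v) ^ n) N <= M).
    { apply (abs_conv_le a _ _ M HM); assert (Q := Cmod_ge_0 v); lra. }
    assert (Pos : forall n, 0 <= vn (a n) * (Cmod u + Cmod v) ^ n).
    { intros n; apply Rmult_le_pos; [apply vn_ge_0|]; apply pow_le.
      assert (Q := Cmod_ge_0 v); lra. }
    (* For [n < N] the sum over [k < N] is already the whole binomial expansion, so the two partial
       sums differ only by truncated expansions with [n >= N], which the tail of the majorant
       controls. *)
    assert (Key : forall N e,
      (forall m, (N <= m)%nat -> rsum (fun n => vn (a n) * (Cmod u + Cmod v) ^ n) m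
                              - rsum (fun n => vn (a n) * (Cmod u + Cmod v) ^ n) N <= e) ->
      vn (vsub (vsum (fun k => vsc (v ^ k)%C (b k)) N) (vsum (fun n => vsc ((u + v) ^ n)%C (a n)) N)) <= e).
    { intros N e He.
      assert (L : vlim (fun m => vsum (fun k => vsc (v ^ k)%C (vsum (fun n => vsc (shift_coef u n k) (a n)) m)) N)
                   (vsum (fun k => vsc (v ^ k)%C (b k)) N)).
      { apply (vlim_vsum (fun k m => vsc (v ^ k)%C (vsum (fun n => vsc (shift_coef u n k) (a n)) m))).
        intros k _; apply vlim_sc, Hb'. }
      apply (vlim_dist_le _ _ _ _ N L); intros m Hm; eapply Rle_trans; [|apply (He m Hm)].
      assert (E : forall m, vsum (fun k => vsc (v ^ k)%C (vsum (fun n => vsc (shift_coef u n k) (a n)) m)) N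
        = vsum (fun n => vsc (csum (fun k => shift_coef u n k * v ^ k)%C N) (a n)) m).
      { intros p.
        rewrite (vsum_ext _ (fun k => vsum (fun n => vsc (shift_coef u n k * v ^ k)%C (a n)) p)).
        - rewrite vsum_swap; apply vsum_ext; intros n _; apply vsum_csum.
        - intros k _; rewrite <- vsum_sc; apply vsum_ext; intros n _; rewrite vsc_assoc; f_equal; ring. }
      rewrite E.
      rewrite (vsum_ext (fun n => vsc ((u + v) ^ n)%C (a n))
                (fun n => vsc (csum (fun k => shift_coef u n k * v ^ k)%C N) (a n)) N).
      2:{ intros n Hn; now rewrite shift_coef_sum. }
      induction Hm as [|m Hm IH].
      - match goal with |- vn (vsub ?x ?x) <= _ => replace (vsub x x) with (@v0 Y) by vring end.
        rewrite vn_0; lra.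
      - simpl.
        match goal with |- vn (vsub (vadd ?x ?y) ?z) <= _ =>
          replace (vsub (vadd x y) z) with (vadd (vsub x z) y) by vring end.
        eapply Rle_trans; [apply vn_triangle|].
        apply Rle_trans with (rsum (fun n => vn (a n) * (Cmod u + Cmod v) ^ n) m
          - rsum (fun n => vn (a n) * (Cmod u + Cmod v) ^ n) N + vn (a m) * (Cmod u + Cmod v) ^ m); [|lra].
        apply Rplus_le_compat; [exact IH|].
        rewrite vn_sc, Rmult_comm; apply Rmult_le_compat_l; [apply vn_ge_0|].
        eapply Rle_trans; [apply csum_Cmod|].
        eapply Rle_trans; [|apply (rshift_coef_sum _ _ m N); apply Cmod_ge_0].
        apply rsum_le; intros k _; rewrite Cmod_mult, Cmod_pow.
        apply Rmult_le_compat_r; [apply pow_le, Cmod_ge_0 | apply shift_coef_Cmod]. }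
    intros eps He.
    destruct (bounded_tail _ M Pos HM' (eps / 2)) as [N1 H1]; [lra|].
    destruct (Hl (eps / 2)) as [N2 H2]; [lra|].
    exists (Nat.max N1 N2); intros n Hn.
    specialize (Key n (eps / 2) (fun m Hm => H1 n m ltac:(lia) Hm)).
    specialize (H2 n ltac:(lia)).
    assert (T := vn_sub_triangle (vsum (fun k => vsc (v ^ k)%C (b k)) n)
                   (vsum (fun n => vsc ((u + v) ^ n)%C (a n)) n) l); lra.
Qed.

Lemma pser_circle a r t : forall l, pser a (RtoC r * circle t)%C l <->
  vseries (fun m => vsc (circle (INR m * t)) (vsc (RtoC (r ^ m)) (a m))) l.
Proof.
  intros l; split; apply vseries_ext; intros k;
    rewrite vsc_assoc, circle_nat, RtoC_pow, Cpow_mult_l; f_equal; ring.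
Qed.

Lemma pser_coef_le a r M B : 0 <= r -> abs_conv a r M ->
  (forall t l, pser a (RtoC r * circle t)%C l -> vn l <= B) ->
  forall n, vn (a n) * r ^ n <= B.
Proof.
  intros Hr HM HB n.
  assert (E : forall k, vn (vsc (RtoC (r ^ k)) (a k)) = vn (a k) * r ^ k).
  { intros k; rewrite vn_sc, Cmod_R, Rabs_pos_eq by (now apply pow_le); ring. }
  rewrite <- E; apply (coef_le_sup (fun m => vsc (RtoC (r ^ m)) (a m)) B M).
  - intros N; rewrite (rsum_ext _ (fun k => vn (a k) * r ^ k)); [apply HM | intros; apply E].
  - intros t l Hl; apply (HB t), pser_circle, Hl.
Qed.

Lemma pser_sub a b w l l' : pser a w l -> pser b w l' ->
  pser (fun n => vsub (a n) (b n)) w (vsub l l').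
Proof.
  intros H H'; unfold vsub at 2.
  eapply vseries_ext; [|exact (vseries_add _ _ _ _ H (vseries_sc (Copp (RtoC 1)) _ _ H'))].
  intros k; simpl; vring.
Qed.

(** Cauchy's estimate with bound [0], applied to the difference on the circle of radius [r / 3];
    convergence at [r / 2] supplies the absolute convergence it requires. *)
Lemma pser_unique a b r : 0 < r ->
  (forall w, Cmod w < r -> exists l, pser a w l /\ pser b w l) -> forall n, a n = b n.
Proof.
  intros Hr H n; apply vsub_eq.
  assert (H0 : forall w, Cmod w < r -> pser (fun n => vsub (a n) (b n)) w v0).
  { intros w Hw; destruct (H w Hw) as [l [H1 H2]].
    replace (@v0 Y) with (vsub l l) by vring; now apply pser_sub. }
  set (c := fun n => vsub (a n) (b n)) in *; change (vn (c n) = 0).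
  assert (R2 : Cmod (RtoC (r / 2)) < r) by (rewrite Cmod_R, Rabs_pos_eq; lra).
  destruct (pser_abs_conv c (RtoC (r / 2)) v0 (r / 3) (H0 _ R2)) as [M [_ HM]].
  { rewrite Cmod_R, Rabs_pos_eq; lra. }
  assert (A := pser_coef_le c (r / 3) M 0 ltac:(lra) HM).
  assert (P : 0 < (r / 3) ^ n) by (apply pow_lt; lra).
  assert (Q := vn_ge_0 (c n)).
  assert (D : forall t l, pser c (RtoC (r / 3) * circle t)%C l -> vn l <= 0).
  { intros t l Hl; apply Req_le; rewrite <- (@vn_0 Y); f_equal; apply (vseries_unique _ _ _ Hl), H0.
    rewrite Cmod_mult, Cmod_circle, Cmod_R, Rabs_pos_eq; lra. }
  specialize (A D n).
  nra.
Qed.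

End PowerSeries.

(** * Analytic functions on the disc are power series *)

Section AnalyticSeries.
Context {Y : CompleteNormedModule C_AbsRing}.
Implicit Types (a b : nat -> Y) (F : disc -> Y).

Lemma pow_n_Cpow (w : C) n : pow_n (w : C_AbsRing) n = (w ^ n)%C.
Proof. induction n as [|n IH]; simpl; [reflexivity | rewrite IH; reflexivity]. Qed.

Lemma pser_is_pseries a (w : C) l : pser a w l <-> is_pseries a (w : C_AbsRing) l.
Proof.
  unfold pser, is_pseries; rewrite vseries_is_series; split; apply is_series_ext; intros n.
  - exact (f_equal (fun c : C_AbsRing => scal c (a n)) (eq_sym (pow_n_Cpow w n))).
  - exact (f_equal (fun c : C_AbsRing => scal c (a n)) (pow_n_Cpow w n)).
Qed.

Definition expands F a (r : R) : Prop :=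
  forall z : disc, Cmod (proj1_sig z) < r -> pser a (proj1_sig z) (F z).

(* A single number [d] controls both the radius of the expansion of [F] at [c]
   and the size of its coefficients, which is what the compactness argument needs. *)
Definition good F (c : C) (d : R) : Prop :=
  exists b, abs_conv b d (/ d) /\
    forall z : disc, Cmod (proj1_sig z - c)%C < d -> pser b (proj1_sig z - c)%C (F z).

Lemma good_mono F c d d' : 0 < d' <= d -> good F c d -> good F c d'.
Proof.
  intros Hd [b [Hb Hz]]; exists b; split.
  - intros n; apply Rle_trans with (/ d); [|apply Rinv_le_contravar; lra].
    apply (abs_conv_le b d d' _ Hb); lra.
  - intros z Hz'; apply Hz; lra.
Qed.

Lemma Cmod_sub_triangle (x y z : C) : Cmod (x - z)%C <= Cmod (x - y)%C + Cmod (y - z)%C.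
Proof. replace (x - z)%C with ((x - y) + (y - z))%C by ring; apply Cmod_triangle. Qed.

Lemma good_near F (z0 : disc) : analytic Y F ->
  exists d, 0 < d /\ forall c, Cmod (c - proj1_sig z0)%C < d -> good F c d.
Proof.
  intros HF; destruct (HF z0) as [a [e Ha]].
  set (w0 := proj1_sig z0) in *; assert (Hw0 : Cmod w0 < 1) by exact (proj2_sig z0).
  assert (Pe := cond_pos e).
  set (rho := Rmin e (1 - Cmod w0) / 2).
  assert (M1 := Rmin_l e (1 - Cmod w0)); assert (M2 := Rmin_r e (1 - Cmod w0)).
  assert (P : 0 < Rmin e (1 - Cmod w0)) by (apply Rmin_pos; lra).
  assert (Prho : 0 < rho) by (unfold rho; lra).
  assert (Hz1 : Cmod (w0 + rho)%C < 1).
  { eapply Rle_lt_trans; [apply Cmod_triangle|].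
    rewrite Cmod_R, Rabs_pos_eq; unfold rho; lra. }
  assert (E1 : (w0 + rho - w0 = rho)%C) by ring.
  assert (S1 := Ha (exist _ _ Hz1)); simpl in S1; rewrite E1 in S1.
  rewrite Cmod_R, Rabs_pos_eq in S1 by lra.
  specialize (S1 ltac:(unfold rho; lra)); apply pser_is_pseries in S1.
  destruct (pser_abs_conv a _ _ (rho / 2) S1) as [M [PM HM]].
  { rewrite Cmod_R, Rabs_pos_eq; lra. }
  (* The first bound ensures [|u| + d <= rho / 2], the radius where absolute convergence is known;
     the second turns the bound [M] on the new coefficients into [/ d]. *)
  set (d := Rmin (rho / 4) (/ M)).
  assert (D1 : d <= rho / 4) by apply Rmin_l; assert (D2 : d <= / M) by apply Rmin_r.
  assert (Pd : 0 < d) by (apply Rmin_pos; [lra | now apply Rinv_0_lt_compat]).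
  exists d; split; [exact Pd|]; intros c Hc.
  set (u := (c - w0)%C) in *; assert (Hu := Cmod_ge_0 u).
  destruct (recenter a u d M Pd) as [b [_ [Hb Hv]]].
  { apply (abs_conv_le a (rho / 2)); [exact HM | lra]. }
  exists b; split.
  - intros n; eapply Rle_trans; [apply Hb|].
    rewrite <- (Rinv_inv M); apply Rinv_le_contravar; lra.
  - intros z Hz; apply Hv; [lra|].
    replace (u + (proj1_sig z - c))%C with (proj1_sig z - w0)%C by (unfold u; ring).
    apply pser_is_pseries, Ha.
    eapply Rle_lt_trans; [apply (Cmod_sub_triangle _ c)|]; fold u.
    assert (rho < e) by (unfold rho; lra); lra.
Qed.

(** A Lebesgue number for the square [[-1, 1]^2]. Compactness asks for a radius at every point of
    the square, including those outside the disc, where the claim is made vacuous. *)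
Lemma good_uniform F r : analytic Y F -> r < 1 ->
  exists d, 0 < d /\ forall c, Cmod c <= r -> good F c d.
Proof.
  intros HF Hr.
  assert (L : forall x : R * R, exists d : posreal, forall c,
    Rabs (Re c - fst x) < d -> Rabs (Im c - snd x) < d -> Cmod c <= r -> good F c d).
  { intros [x y].
    assert (B : forall c d, Rabs (Re c - x) < d -> Rabs (Im c - y) < d ->
                 Cmod (c - (x, y))%C < 2 * d).
    { intros c d H1 H2.
      replace (c - (x, y))%C with (RtoC (Re c - x) + Ci * RtoC (Im c - y))%C
        by (destruct c; apply injective_projections; simpl; ring).
      eapply Rle_lt_trans; [apply Cmod_triangle|].
      rewrite Cmod_mult, Cmod_Ci, !Cmod_R; lra. }
    destruct (Rlt_le_dec (Cmod (x, y)) 1) as [H|H].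
    - destruct (good_near F (exist _ (x, y) H) HF) as [d [Pd Hd]].
      assert (Pd2 : 0 < d / 2) by lra.
      exists (mkposreal _ Pd2); simpl; intros c H1 H2 _.
      apply good_mono with d; [lra|]; apply Hd; simpl.
      specialize (B c (d / 2) H1 H2); lra.
    (* A point this close to the complement of the disc has modulus above [(1 + r) / 2], hence above
       [r]. *)
    - assert (Pd : 0 < (1 - r) / 4) by lra.
      exists (mkposreal _ Pd); simpl; intros c H1 H2 Hc; exfalso.
      specialize (B c _ H1 H2).
      assert (T := Cmod_triangle (- (c - (x, y)))%C c).
      rewrite Cmod_opp in T.
      replace (- (c - (x, y)) + c)%C with ((x, y) : C) in T
        by (destruct c; apply injective_projections; simpl; ring); lra. }
  destruct (choice _ L) as [delta Hdelta].
  destruct (compactness_value_2d (-1) 1 (-1) 1 (fun x y => delta (x, y))) as [d Hd].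
  exists d; split; [apply cond_pos|]; intros c Hc; apply NNPP; intros N.
  assert (M := Rmax_Cmod c); assert (M1 := Rmax_l (Rabs (fst c)) (Rabs (snd c))).
  assert (M2 := Rmax_r (Rabs (fst c)) (Rabs (snd c))).
  assert (C1 : Rabs (fst c) <= 1) by lra; assert (C2 : Rabs (snd c) <= 1) by lra.
  apply Rabs_le_between in C1; apply Rabs_le_between in C2.
  apply (Hd (fst c) (snd c) C1 C2); intros [u [v [_ [_ [H1 [H2 H3]]]]]].
  apply N; apply good_mono with (delta (u, v)); [split; [apply cond_pos | exact H3]|].
  apply Hdelta; assumption.
Qed.

(* Cauchy's estimate on the coefficients of the expansions of [F] at the points of a
   circle of radius [rho] close to [q] controls all [rshift_coef rho n k * |a n|]
   at once; summing over [k] pushes the radius of convergence beyond [q]. *)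
Lemma expands_step F a (q d : R) : 0 < q < 1 -> 0 < d ->
  (forall c, Cmod c <= q -> good F c d) -> expands F a q -> expands F a (q + d / 4).
Proof.
  intros HR Hd HG HE.
  (* [q / 2] keeps [rho] positive. Being within [d / 8] of [q] gives [rho + d / 2 > q + d / 4], and
     puts every [w] with [q <= |w| < q + d / 4] at distance less than [d] from the circle of radius
     [rho]. *)
  set (rho := Rmax (q / 2) (q - d / 8)).
  assert (R1 : q / 2 <= rho) by apply Rmax_l; assert (R2 : q - d / 8 <= rho) by apply Rmax_r.
  assert (R3 : rho < q) by (apply Rmax_lub_lt; lra).
  assert (AC : forall s, 0 <= s < q -> exists M, 0 < M /\ abs_conv a s M).
  { intros s Hs; assert (Hm : Cmod (RtoC ((s + q) / 2)) < 1) by (rewrite Cmod_R, Rabs_pos_eq; lra).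
    apply (pser_abs_conv a (RtoC ((s + q) / 2)) (F (exist _ _ Hm))); [|rewrite Cmod_R, Rabs_pos_eq; lra].
    apply (HE (exist _ _ Hm)); simpl; rewrite Cmod_R, Rabs_pos_eq; lra. }
  (* The recentred series and the local expansion of [F] both represent [F] near [c], so they have
     the same coefficients. [|c| + d1] may exceed [q]; the end of the proof uses exactly this to
     reach points beyond the old radius. *)
  assert (LOC : forall c b d1 M1, Cmod c < q -> 0 < d1 -> abs_conv a (Cmod c + d1) M1 ->
    (forall z : disc, Cmod (proj1_sig z - c)%C < d -> pser b (proj1_sig z - c)%C (F z)) ->
    (forall k, vseries (fun n => vsc (shift_coef c n k) (a n)) (b k)) /\
    (forall v l, Cmod v <= d1 -> pser a (c + v)%C l -> pser b v l)).
  { intros c b d1 M1 Hc Hd1 HM Hb.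
    destruct (recenter a c d1 M1 Hd1 HM) as [b' [Hk [_ Hv]]].
    assert (Hc0 := Cmod_ge_0 c).
    assert (E : forall k, b' k = b k).
    { apply (pser_unique b' b (Rmin (Rmin d d1) (q - Cmod c))).
      - repeat apply Rmin_pos; lra.
      - intros w Hw.
        assert (W1 := Rlt_le_trans _ _ _ Hw (Rmin_l _ _)).
        assert (W2 := Rlt_le_trans _ _ _ Hw (Rmin_r _ _)).
        assert (W3 := Rlt_le_trans _ _ _ W1 (Rmin_l _ _)).
        assert (W4 := Rlt_le_trans _ _ _ W1 (Rmin_r _ _)).
        assert (T := Cmod_triangle c w).
        assert (Hz : Cmod (c + w)%C < 1) by lra.
        exists (F (exist _ _ Hz)); split.
        + apply Hv; [lra|]; apply (HE (exist _ _ Hz)); simpl; lra.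
        + specialize (Hb (exist _ _ Hz)); simpl in Hb.
          replace (c + w - c)%C with w in Hb by ring; auto. }
    split.
    - intros k; rewrite <- E; apply Hk.
    - intros v l H1 H2; eapply vseries_ext; [|exact (Hv v l H1 H2)].
      intros k; simpl; now rewrite E. }
  (* Along the circle of radius [rho], the [k]-th local coefficient times [circle t ^ k] is a
     trigonometric series in [t] with coefficients [rshift_coef rho n k] times [a n]. The bound on
     the local coefficients is uniform in [t], so it passes to each of them. *)
  assert (COEF : forall n k, vn (a n) * rshift_coef rho n k * d ^ k <= / d).
  { intros n k.
    set (d1 := (q - rho) / 2); assert (Hd1 : 0 < d1) by (unfold d1; lra).
    destruct (AC (rho + d1)) as [M1 [PM1 HM1]]; [unfold d1; lra|].
    assert (Pdk : 0 < d ^ k) by now apply pow_lt.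
    replace (vn (a n) * rshift_coef rho n k) with (vn (vsc (RtoC (rshift_coef rho n k)) (a n))).
    2:{ rewrite vn_sc, Cmod_R, Rabs_pos_eq; [ring | apply rshift_coef_ge_0; lra]. }
    apply Rmult_le_reg_r with (/ d ^ k); [now apply Rinv_0_lt_compat|].
    rewrite Rmult_assoc, Rinv_r, Rmult_1_r by lra.
    apply (coef_le_sup (fun n => vsc (RtoC (rshift_coef rho n k)) (a n)) _ (M1 * / d1 ^ k)).
    - intros N; assert (P1 : 0 < d1 ^ k) by now apply pow_lt.
      apply Rmult_le_reg_r with (d1 ^ k); [exact P1|].
      rewrite Rmult_assoc, Rinv_l, Rmult_1_r by lra.
      eapply Rle_trans; [|apply (HM1 N)].
      rewrite Rmult_comm, <- rsum_scal; apply rsum_le; intros m _.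
      rewrite vn_sc, Cmod_R, Rabs_pos_eq by (apply rshift_coef_ge_0; lra).
      assert (Q := rshift_coef_term rho d1 m k ltac:(lra) ltac:(lra)).
      assert (V := vn_ge_0 (a m)); nra.
    - intros t l Hl.
      set (c := (RtoC rho * circle t)%C).
      assert (Hc : Cmod c = rho) by (unfold c; rewrite Cmod_mult, Cmod_circle, Cmod_R, Rabs_pos_eq; lra).
      destruct (HG c ltac:(lra)) as [b [Hb1 Hb2]].
      destruct (LOC c b d1 M1 ltac:(lra) Hd1 ltac:(now rewrite Hc) Hb2) as [Hk _].
      assert (El : l = vsc (circle t ^ k)%C (b k)).
      { apply (vseries_unique _ _ _ Hl).
        eapply vseries_ext; [|exact (vseries_sc (circle t ^ k)%C _ _ (Hk k))].
        intros m; simpl; rewrite !vsc_assoc; f_equal; unfold c.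
        rewrite shift_coef_circle, shift_coef_real, circle_nat; reflexivity. }
      rewrite El, vn_sc, Cmod_circle_pow, Rmult_1_l.
      apply Rmult_le_reg_r with (d ^ k); [exact Pdk|].
      rewrite Rmult_assoc, Rinv_l, Rmult_1_r by lra.
      eapply Rle_trans; [|apply (Hb1 (S k))].
      apply (rsum_term (fun k => vn (b k) * d ^ k)); [|lia].
      intros j; apply Rmult_le_pos; [apply vn_ge_0 | apply pow_le; lra]. }
  (* Halving [d] produces the factors [(1 / 2)^k], whose sum is the [2] in the bound. *)
  assert (BD : forall n, vn (a n) * (rho + d / 2) ^ n <= / d * 2).
  { intros n; rewrite <- (rshift_coef_sum_eq rho (d / 2) n (S n)) by lia.
    rewrite <- rsum_scal.
    apply Rle_trans with (/ d * rsum (fun k => (1 / 2) ^ k) (S n)).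
    - rewrite <- rsum_scal; apply rsum_le; intros k _.
      replace (vn (a n) * (rshift_coef rho n k * (d / 2) ^ k))
        with (vn (a n) * rshift_coef rho n k * d ^ k * (1 / 2) ^ k).
      + apply Rmult_le_compat_r; [apply pow_le; lra | apply COEF].
      + replace (d / 2) with (d * (1 / 2)) by field; rewrite Rpow_mult_distr; ring.
    - apply Rmult_le_compat_l; [left; now apply Rinv_0_lt_compat|].
      eapply Rle_trans; [apply rsum_geom; lra | lra]. }
  assert (HM := abs_conv_of_terms a (rho + d / 2) (q + d / 4) _ ltac:(lra) BD).
  set (M := / d * 2 * / (1 - (q + d / 4) / (rho + d / 2))) in *; clearbody M.
  intros z Hz; destruct (Rlt_le_dec (Cmod (proj1_sig z)) q) as [Hz'|Hz']; [now apply HE|].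
  set (w := proj1_sig z) in *.
  assert (Pw : 0 < Cmod w) by lra.
  assert (Nw : RtoC (Cmod w) <> RtoC 0) by (intros E; injection E; lra).
  (* The point of the circle of radius [rho] nearest to [w]. *)
  set (c := (w * RtoC (rho / Cmod w))%C).
  assert (Hc : Cmod c = rho).
  { unfold c; rewrite Cmod_mult, Cmod_R, Rabs_pos_eq; [field; lra|].
    apply Rdiv_le_0_compat; lra. }
  assert (Hwc : Cmod (w - c)%C = Cmod w - rho).
  { replace (w - c)%C with (w * RtoC (1 - rho / Cmod w))%C
      by (unfold c; rewrite RtoC_minus; ring).
    rewrite Cmod_mult, Cmod_R, Rabs_pos_eq; [field; lra|].
    assert (rho / Cmod w < 1) by (apply div_lt_1; lra); lra. }
  destruct (HG c ltac:(lra)) as [b [_ Hb]].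
  destruct (LOC c b (Cmod w - rho) M ltac:(lra) ltac:(lra)) as [_ Hv].
  { rewrite Hc; apply (abs_conv_le a _ _ M HM); lra. }
  { exact Hb. }
  destruct (pser_ex a w _ _ HM ltac:(lra)) as [l Hl].
  assert (H1 : pser b (w - c)%C l).
  { apply Hv; [lra|]; replace (c + (w - c))%C with w by ring; exact Hl. }
  assert (H2 : pser b (w - c)%C (F z)) by (apply Hb; fold w; lra).
  rewrite <- (vseries_unique _ _ _ H1 H2); exact Hl.
Qed.

Lemma expands_le F a r s : s <= r -> expands F a r -> expands F a s.
Proof. intros H HE z Hz; apply HE; lra. Qed.

(** The expansion at [0] is continued outwards. One [d] serves the whole disc of radius [r], so each
    step gains the same length [d / 4] and finitely many reach [r]; then [r] tends to [1]. *)
Theorem analytic_expands F : analytic Y F -> exists a, expands F a 1.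
Proof.
  intros HF.
  assert (H0 : Cmod 0 < 1) by (rewrite Cmod_0; lra).
  destruct (HF (exist _ _ H0)) as [a [e Ha]]; simpl in Ha.
  assert (Pe := cond_pos e).
  exists a.
  assert (E0 : expands F a (Rmin e (1 / 2))).
  { intros z Hz; apply pser_is_pseries.
    specialize (Ha z); replace (proj1_sig z - 0)%C with (proj1_sig z) in Ha by ring.
    apply Ha; eapply Rlt_le_trans; [exact Hz | apply Rmin_l]. }
  assert (P0 : 0 < Rmin e (1 / 2)) by (apply Rmin_pos; lra).
  assert (P1 := Rmin_r e (1 / 2)).
  set (r0 := Rmin e (1 / 2)) in *; clearbody r0.
  assert (A : forall r, 1 / 2 <= r < 1 -> expands F a r).
  { intros r Hr; destruct (good_uniform F r HF (proj2 Hr)) as [d [Pd HG]].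
    assert (I : forall j, expands F a (Rmin r (r0 + INR j * (d / 4)))).
    { induction j as [|j IH].
      - simpl; rewrite Rmult_0_l, Rplus_0_r; apply expands_le with r0; [apply Rmin_r | exact E0].
      - rewrite S_INR.
        apply expands_le with (Rmin r (r0 + INR j * (d / 4)) + d / 4).
        + unfold Rmin at 2; destruct (Rle_dec _ _);
            [eapply Rle_trans; [apply Rmin_l|] | eapply Rle_trans; [apply Rmin_r|]]; lra.
        + assert (J := pos_INR j).
          assert (Rmin r (r0 + INR j * (d / 4)) <= r) by apply Rmin_l.
          apply expands_step; [|exact Pd| |exact IH].
          * split; [|lra]; apply Rmin_pos; [lra|].
            assert (0 <= INR j * (d / 4)) by (apply Rmult_le_pos; lra); lra.
          * intros c Hc; apply HG; lra. }
    destruct (archimed_cor1 (d / 4)) as [N [HN1 HN2]]; [lra|].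
    assert (PN : 0 < INR N) by (apply lt_0_INR; exact HN2).
    assert (K : 1 < INR N * (d / 4)).
    { apply (Rmult_lt_compat_l (INR N)) in HN1; [|exact PN]; rewrite Rinv_r in HN1; lra. }
    apply expands_le with (Rmin r (r0 + INR N * (d / 4))); [|apply I].
    apply Rmin_glb; lra. }
  intros z Hz; apply (A (Rmax (1 / 2) ((Cmod (proj1_sig z) + 1) / 2))).
  - split; [apply Rmax_l | apply Rmax_lub_lt; lra].
  - eapply Rlt_le_trans; [|apply Rmax_r]; lra.
Qed.

Lemma expands_analytic F a : expands F a 1 -> analytic Y F.
Proof.
  intros HE z0; set (w0 := proj1_sig z0); assert (H0 : Cmod w0 < 1) by exact (proj2_sig z0).
  assert (P0 := Cmod_ge_0 w0).
  set (d := (1 - Cmod w0) / 2); assert (Pd : 0 < d) by (unfold d; lra).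
  assert (Hm : Cmod (RtoC (Cmod w0 + 3 / 2 * d)) < 1).
  { rewrite Cmod_R, Rabs_pos_eq; unfold d; lra. }
  destruct (pser_abs_conv a _ _ (Cmod w0 + d) (HE (exist _ _ Hm) Hm)) as [M [_ HM]].
  { simpl; rewrite Cmod_R, Rabs_pos_eq; lra. }
  destruct (recenter a w0 d M Pd HM) as [b [_ [_ Hb]]].
  exists b, (mkposreal _ Pd); intros z Hz; apply pser_is_pseries, Hb.
  - left; exact Hz.
  - fold w0; replace (w0 + (proj1_sig z - w0))%C with (proj1_sig z) by ring.
    apply HE, (proj2_sig z).
Qed.

Lemma expands_unique F a b : expands F a 1 -> expands F b 1 -> a = b.
Proof.
  intros Ha Hb; apply functional_extensionality, (pser_unique a b 1 Rlt_0_1).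
  intros w Hw; exists (F (exist _ w Hw)); split;
    [apply (Ha (exist _ w Hw)) | apply (Hb (exist _ w Hw))]; exact Hw.
Qed.

Lemma expands_abs_conv F a s : expands F a 1 -> 0 <= s < 1 -> exists M, 0 < M /\ abs_conv a s M.
Proof.
  intros HE Hs; assert (Hm : Cmod (RtoC ((s + 1) / 2)) < 1) by (rewrite Cmod_R, Rabs_pos_eq; lra).
  apply (pser_abs_conv a _ _ s (HE (exist _ _ Hm) Hm)); simpl; rewrite Cmod_R, Rabs_pos_eq; lra.
Qed.

End AnalyticSeries.

(** * Means over a period *)

Definition pmean (f : R -> R) : R := RInt f (- (1 / 2)) (1 / 2).

Lemma cont_ex_RInt (f : R -> R) a b : (forall t, continuous f t) -> ex_RInt f a b.
Proof. intros H; apply (@ex_RInt_continuous R_CompleteNormedModule); auto. Qed.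

Lemma continuous_affine (f : R -> R) u v t : (forall t, continuous f t) ->
  continuous (fun s => f (u * s + v)) t.
Proof.
  intros H; apply (continuous_comp (fun s => u * s + v) f); [|apply H].
  apply (ex_derive_continuous (fun s => u * s + v)); auto_derive; trivial.
Qed.

Lemma RInt_affine (f : R -> R) u v a b : (forall t, continuous f t) ->
  u * RInt (fun t => f (u * t + v)) a b = RInt f (u * a + v) (u * b + v).
Proof.
  intros H; rewrite <- (RInt_comp_lin f u v a b) by now apply cont_ex_RInt.
  symmetry; apply (RInt_scal (fun t => f (u * t + v))).
  apply cont_ex_RInt; intros t; now apply continuous_affine.
Qed.

Section PeriodicMeans.
Context (f : R -> R) (Cf : forall t, continuous f t) (Pf : forall t, f (t + 1) = f t).

Lemma RInt_period a b : RInt f a (a + 1) = RInt f b (b + 1).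
Proof.
  assert (E := RInt_affine f 1 1 a b Cf).
  rewrite !Rmult_1_l, (RInt_ext _ f) in E by (intros; rewrite Rmult_1_l; apply Pf).
  assert (E1 := RInt_Chasles f a b (b + 1) (cont_ex_RInt _ _ _ Cf) (cont_ex_RInt _ _ _ Cf)).
  assert (E2 := RInt_Chasles f a (a + 1) (b + 1) (cont_ex_RInt _ _ _ Cf) (cont_ex_RInt _ _ _ Cf)).
  change plus with Rplus in E1, E2; simpl in *; lra.
Qed.

Lemma pmean_shift c : pmean (fun t => f (t + c)) = pmean f.
Proof.
  unfold pmean; assert (E := RInt_affine f 1 c (- (1 / 2)) (1 / 2) Cf).
  rewrite !Rmult_1_l in E.
  rewrite (RInt_ext _ (fun t => f (1 * t + c))) by (intros; now rewrite Rmult_1_l).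
  rewrite E; replace (1 / 2 + c) with (- (1 / 2) + c + 1) by field.
  rewrite (RInt_period _ (- (1 / 2))); f_equal; field.
Qed.

Lemma pmean_opp : pmean (fun t => f (- t)) = pmean f.
Proof.
  unfold pmean; assert (E := RInt_affine f (-1) 0 (- (1 / 2)) (1 / 2) Cf).
  rewrite (RInt_ext _ (fun t => f (-1 * t + 0))) by (intros; f_equal; ring).
  replace (-1 * - (1 / 2) + 0) with (1 / 2) in E by field.
  replace (-1 * (1 / 2) + 0) with (- (1 / 2)) in E by field.
  assert (S := opp_RInt_swap f (- (1 / 2)) (1 / 2) (cont_ex_RInt _ _ _ Cf)).
  change opp with Ropp in S; simpl in *; lra.
Qed.

Lemma pmean_double : pmean (fun t => f (2 * t)) = pmean f.
Proof.
  unfold pmean; assert (E := RInt_affine f 2 0 (- (1 / 2)) (1 / 2) Cf).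
  rewrite (RInt_ext _ (fun t => f (2 * t + 0))) by (intros; f_equal; ring).
  replace (2 * - (1 / 2) + 0) with (-1) in E by field.
  replace (2 * (1 / 2) + 0) with 1 in E by field.
  assert (E1 := RInt_Chasles f (-1) 0 1 (cont_ex_RInt _ _ _ Cf) (cont_ex_RInt _ _ _ Cf)).
  assert (E2 := RInt_period (-1) (- (1 / 2))); assert (E3 := RInt_period 0 (- (1 / 2))).
  replace (-1 + 1) with 0 in E2 by ring; rewrite Rplus_0_l in E3.
  replace (- (1 / 2) + 1) with (1 / 2) in E2, E3 by field.
  change plus with Rplus in E1; simpl in *; lra.
Qed.

Lemma pmean_rsum (x : nat -> R) N :
  is_RInt (fun t => rsum (fun j => f (t + x j)) N) (- (1 / 2)) (1 / 2) (INR N * pmean f).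
Proof.
  induction N as [|N IH].
  - simpl; rewrite Rmult_0_l.
    assert (K := is_RInt_const (V := R_NormedModule) (- (1 / 2)) (1 / 2) 0).
    replace (scal _ _) with 0 in K; [exact K|].
    symmetry; apply Rmult_0_r.
  - rewrite S_INR, Rmult_plus_distr_r, Rmult_1_l.
    apply (is_RInt_plus (V := R_NormedModule)); [exact IH|].
    rewrite <- (pmean_shift (x N)); apply (RInt_correct (fun t => f (t + x N))).
    apply cont_ex_RInt; intros t.
    apply continuous_ext with (fun t => f (1 * t + x N)).
    + intros s; now rewrite Rmult_1_l.
    + now apply continuous_affine.
Qed.

End PeriodicMeans.

Lemma pmean_const c : pmean (fun _ => c) = c.
Proof. unfold pmean; rewrite RInt_const; unfold scal; simpl; unfold mult; simpl; field. Qed.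

Lemma pmean_le (f g : R -> R) : (forall t, continuous f t) -> (forall t, continuous g t) ->
  (forall t, f t <= g t) -> pmean f <= pmean g.
Proof. intros Hf Hg H; apply RInt_le; try (now apply cont_ex_RInt); [lra | auto]. Qed.

Lemma pmean_scal c (f : R -> R) : (forall t, continuous f t) -> pmean (fun t => c * f t) = c * pmean f.
Proof. intros H; apply (RInt_scal f); now apply cont_ex_RInt. Qed.

Lemma pmean_plus (f g : R -> R) : (forall t, continuous f t) -> (forall t, continuous g t) ->
  pmean (fun t => f t + g t) = pmean f + pmean g.
Proof. intros Hf Hg; apply (RInt_plus f g); now apply cont_ex_RInt. Qed.

Lemma pmean_ge_0 (f : R -> R) : (forall t, continuous f t) -> (forall t, 0 <= f t) -> 0 <= pmean f.
Proof. intros Hf H; apply RInt_ge_0; [lra | now apply cont_ex_RInt | auto]. Qed.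

(** * Growth of the coefficients of functions in [H_p] *)

Lemma nnpow_pos x p : 0 < x -> nnpow x p = Rpower x p.
Proof. intros H; unfold nnpow; destruct (Rle_dec x 0); [lra | reflexivity]. Qed.

Lemma nnpow_0 p : nnpow 0 p = 0.
Proof. unfold nnpow; destruct (Rle_dec 0 0); lra. Qed.

(** From [x = x^(1-p) x^p]: all but the power [p] is spent on the upper bound. This takes the place
    of an inequality between means, which goes the wrong way for [p < 1]. *)
Lemma le_nnpow_split x y p : p <= 1 -> 0 <= x <= y -> x <= nnpow y (1 - p) * nnpow x p.
Proof.
  intros Hp [H0 H]; destruct (Rle_lt_or_eq_dec 0 x H0) as [P|<-].
  - apply Rle_trans with (nnpow x (1 - p) * nnpow x p).
    + rewrite !nnpow_pos, <- Rpower_plus by exact P.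
      replace (1 - p + p) with 1 by ring; rewrite Rpower_1; lra.
    + apply Rmult_le_compat_r; [apply nnpow_ge_0 | apply nnpow_le; lra].
  - rewrite nnpow_0; lra.
Qed.

(** Dividing by [B^(1-p)] is legitimate because [B] is a finite number; this is why the
    self-improving estimate is run on a supremum already known to exist. *)
Lemma nnpow_absorb p B K : 0 < p -> B <= K * nnpow B (1 - p) -> B <= nnpow K (/ p).
Proof.
  intros Hp H; destruct (Rle_lt_dec B 0) as [N|P].
  - assert (A := nnpow_ge_0 K (/ p)); lra.
  - assert (E : B = nnpow (Rpower B p) (/ p)).
    { rewrite nnpow_pos by apply exp_pos; rewrite Rpower_mult, Rinv_r, Rpower_1; lra. }
    rewrite E; apply nnpow_le; [left; now apply Rinv_0_lt_compat|].
    rewrite nnpow_pos in H by exact P.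
    apply Rmult_le_reg_r with (Rpower B (1 - p)); [apply exp_pos|].
    rewrite <- Rpower_plus; replace (p + (1 - p)) with 1 by ring; rewrite Rpower_1; lra.
Qed.

Lemma Rpower_1_l y : Rpower 1 y = 1.
Proof. unfold Rpower; rewrite ln_1, Rmult_0_r; apply exp_0. Qed.

Lemma Rpower_le_1 x y : 0 < x <= 1 -> 0 <= y -> Rpower x y <= 1.
Proof.
  intros Hx Hy; rewrite <- (Rpower_1_l y); apply Rle_Rpower_l; lra.
Qed.

Lemma bernoulli x n : 0 <= x <= 1 -> 1 - INR n * x <= (1 - x) ^ n.
Proof.
  intros Hx; induction n as [|n IH]; [simpl; lra|].
  rewrite S_INR; simpl.
  apply Rle_trans with ((1 - x) * (1 - INR n * x)); [assert (P := pos_INR n); nra|].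
  apply Rmult_le_compat_l; lra.
Qed.

Section Growth.
Context {Y : CompleteNormedModule C_AbsRing}.
Context (p : R) (Hp0 : 0 < p) (Hp1 : p <= 1).
Context (F : disc -> Y) (a : nat -> Y) (A : R) (HF : expands F a 1).
(** Radii below [1/4] are left out on purpose: when [F] is built from a distribution, the means near
    the centre are not yet controlled uniformly, and the growth estimate below is what controls
    them. *)
Context (HA : forall r Hr, 1 / 4 <= r -> pmean (fun t => nnpow (vn (F (disc_point r Hr t))) p) <= A).

Let S (r : R) : R := total (fun k => vn (a k) * r ^ k).

Lemma disc_cont r Hr t : continuous (fun s => F (disc_point r Hr s)) t.
Proof. apply Hp_disc_continuous, (expands_analytic F a HF). Qed.

Lemma vn_disc_cont r Hr t : continuous (fun s => vn (F (disc_point r Hr s))) t.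
Proof.
  apply (continuous_comp (fun s => F (disc_point r Hr s)) norm); [apply disc_cont|].
  refine (filterlim_norm _).
Qed.

Lemma disc_point_periodic r Hr t : disc_point r Hr (t + 1) = disc_point r Hr t.
Proof.
  unfold disc_point.
  assert (E : (r * circle (t + 1) = r * circle t)%C) by now rewrite circle_periodic.
  revert E; generalize (disc_point_proof r (t + 1) Hr) (disc_point_proof r t Hr).
  intros H1 H2 E; revert H1 H2; rewrite E; intros H1 H2; f_equal; apply proof_irrelevance.
Qed.

Lemma S_ub r N : 0 <= r < 1 -> rsum (fun k => vn (a k) * r ^ k) N <= S r.
Proof.
  intros Hr; destruct (expands_abs_conv F a r HF Hr) as [M [_ HM]].
  exact (proj1 (total_lub _ M HM) N).
Qed.

Lemma S_ge_0 r : 0 <= r < 1 -> 0 <= S r.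
Proof. intros Hr; exact (S_ub r 0 Hr). Qed.

Lemma disc_expansion (r : R) Hr t : pser a (RtoC r * circle t)%C (F (disc_point r Hr t)).
Proof. exact (HF (disc_point r Hr t) (disc_point_proof r t Hr)). Qed.

(** [coef_le_mean] holds for every offset [t]. Integrated over a period, each of the [N] samples
    contributes the same mean by translation invariance, and only the real function [|F|] is ever
    integrated. *)
Lemma coef_le_pmean r Hr n : vn (a n) * r ^ n <= pmean (fun t => vn (F (disc_point r Hr t))).
Proof.
  apply le_epsilon; intros eps He.
  set (b := fun m => vsc (RtoC (r ^ m)) (a m)).
  assert (E : forall k, vn (b k) = vn (a k) * r ^ k).
  { intros k; unfold b; rewrite vn_sc, Cmod_R, Rabs_pos_eq by (apply pow_le; lra); ring. }
  destruct (bounded_tail (fun k => vn (a k) * r ^ k) (S r)) with (eps := eps) as [N0 H0].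
  { intros k; apply Rmult_le_pos; [apply vn_ge_0 | apply pow_le; lra]. }
  { intros N; now apply S_ub. }
  { exact He. }
  set (N := Datatypes.S (Nat.max N0 n)).
  assert (HN1 : (N0 <= N)%nat) by (unfold N; lia); assert (HN2 : (n < N)%nat) by (unfold N; lia).
  clearbody N; assert (PN : 0 < INR N) by (apply lt_0_INR; lia).
  set (f := fun t => vn (F (disc_point r Hr t))).
  assert (Cf : forall t, continuous f t) by (intros t; apply vn_disc_cont).
  assert (Pf : forall t, f (t + 1) = f t) by (intros t; unfold f; now rewrite disc_point_periodic).
  assert (K := pmean_rsum f Cf Pf (fun j => INR j / INR N) N).
  apply (is_RInt_scal (V := R_NormedModule) _ _ _ (/ INR N)) in K.
  assert (K1 := is_RInt_const (V := R_NormedModule) (- (1 / 2)) (1 / 2) eps).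
  assert (K2 := is_RInt_const (V := R_NormedModule) (- (1 / 2)) (1 / 2) (vn (a n) * r ^ n)).
  assert (K3 := is_RInt_plus (V := R_NormedModule) _ _ _ _ _ _ K K1).
  assert (H12 : - (1 / 2) <= 1 / 2) by lra.
  assert (L := is_RInt_le _ _ _ _ _ _ H12 K2 K3).
  unfold plus, scal in L; simpl in L; unfold mult in L; simpl in L.
  replace (/ INR N * (INR N * pmean f)) with (pmean f) in L by (field; lra).
  replace ((1 / 2 - - (1 / 2)) * (vn (a n) * r ^ n)) with (vn (a n) * r ^ n) in L by field.
  replace ((1 / 2 - - (1 / 2)) * eps) with eps in L by field.
  apply L; intros t _; rewrite <- E.
  apply (coef_le_mean b (fun t => F (disc_point r Hr t)) N n eps t).
  - intros s; apply pser_circle, disc_expansion.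
  - intros M HM.
    rewrite (rsum_ext _ _ M (fun k _ => E k)), (rsum_ext _ _ N (fun k _ => E k)).
    apply H0; lia.
  - exact HN2.
Qed.

Lemma A_ge_0 : 0 <= A.
Proof.
  assert (Hr : 0 <= 1 / 2 < 1) by lra.
  eapply Rle_trans; [|apply (HA _ Hr); lra]; apply pmean_ge_0.
  - intros t; exact (nnpow_norm_continuous _ p t Hp0 (disc_cont _ Hr t)).
  - intros t; apply nnpow_ge_0.
Qed.

Lemma coef_le_S r n : 1 / 4 <= r < 1 -> vn (a n) * r ^ n <= nnpow (S r) (1 - p) * A.
Proof.
  intros H; assert (Hr : 0 <= r < 1) by lra.
  eapply Rle_trans; [apply (coef_le_pmean r Hr n)|].
  assert (Cn : forall t, continuous (fun t => nnpow (vn (F (disc_point r Hr t))) p) t).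
  { intros t; exact (nnpow_norm_continuous _ p t Hp0 (disc_cont _ Hr t)). }
  apply Rle_trans with (nnpow (S r) (1 - p) * pmean (fun t => nnpow (vn (F (disc_point r Hr t))) p)).
  - rewrite <- pmean_scal by exact Cn.
    apply pmean_le.
    + intros t; apply vn_disc_cont.
    + intros t; apply (continuous_scal_r (V := R_NormedModule)), Cn.
    + intros t; apply le_nnpow_split; [exact Hp1|]; split; [apply vn_ge_0|].
      apply (vseries_norm_le _ _ _ (disc_expansion r Hr t)); intros N.
      apply (pser_abs_bound a _ r); [intros k; now apply S_ub|].
      rewrite Cmod_mult, Cmod_circle, Cmod_R, Rabs_pos_eq; lra.
  - apply Rmult_le_compat_l; [apply nnpow_ge_0 | apply HA; lra].
Qed.

Lemma S_le_S r s : 0 <= r < s -> 1 / 4 <= s < 1 ->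
  S r <= nnpow (S s) (1 - p) * A * / (1 - r / s).
Proof.
  intros Hr Hs; refine (proj2 (total_lub _ _ _)); intros N.
  apply (abs_conv_of_terms a s r); [exact Hr|]; intros n; now apply coef_le_S.
Qed.

Lemma S_mono r s : 0 <= r <= s -> s < 1 -> S r <= S s.
Proof.
  intros Hr Hs; refine (proj2 (total_lub _ _ _)); intros N; eapply Rle_trans; [|apply (S_ub s N); lra].
  apply rsum_le; intros k _; apply Rmult_le_compat_l; [apply vn_ge_0 | now apply pow_incr].
Qed.

(* The weight [(s - r)^(1/p)] is the one for which the self-improving estimate
   [S_le_S], with [s] replaced by the midpoint of [r] and [s], is scale invariant. *)
Lemma S_growth r s : 0 <= r < s -> 1 / 2 <= s < 1 ->
  Rpower (s - r) (/ p) * S r <= nnpow (Rpower 2 (/ p) * A) (/ p).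
Proof.
  intros Hr Hs.
  assert (Hp' := Rinv_0_lt_compat p Hp0).
  set (w := fun r => Rpower (s - r) (/ p) * S r).
  set (E := fun v => exists r, 0 <= r < s /\ v = w r).
  destruct (completeness E) as [B [U L]].
  (* Stopping at [s < 1] makes the weighted supremum finite. The bound obtained in the end does not
     involve [S s]. *)
  - exists (S s); intros v [x [Hx ->]]; unfold w.
    rewrite <- (Rmult_1_l (S s)); apply Rmult_le_compat.
    + left; apply exp_pos.
    + apply S_ge_0; lra.
    + apply Rpower_le_1; lra.
    + apply S_mono; lra.
  - exists (w r), r; auto.
  - assert (HB : B <= Rpower 2 (/ p) * A * nnpow B (1 - p)).
    { apply L; intros v [x [Hx ->]]; unfold w.
      set (h := (s - x) / 2); assert (Ph : 0 < h) by (unfold h; lra).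
      set (y := x + h); assert (Hy : x < y < s) by (unfold y, h; lra).
      assert (U1 : w y <= B) by (apply U; exists y; split; [lra | reflexivity]).
      assert (B0 : 0 <= B).
      { eapply Rle_trans; [|exact U1]; unfold w; apply Rmult_le_pos; [left; apply exp_pos | apply S_ge_0; lra]. }
      assert (SY : S y <= B * Rpower h (- / p)).
      { unfold w in U1; replace (s - y) with h in U1 by (unfold y, h; lra).
        apply Rmult_le_reg_l with (Rpower h (/ p)); [apply exp_pos|].
        replace (Rpower h (/ p) * (B * Rpower h (- / p))) with (B * (Rpower h (/ p) * Rpower h (- / p))) by ring.
        rewrite <- Rpower_plus, Rplus_opp_r, Rpower_O, Rmult_1_r by exact Ph; exact U1. }
      assert (A0 := A_ge_0).
      assert (Q : nnpow (S y) (1 - p) <= nnpow B (1 - p) * Rpower h (- / p * (1 - p))).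
      { eapply Rle_trans; [apply nnpow_le; [lra | exact SY]|].
        rewrite nnpow_mult; [|exact B0 | left; apply exp_pos].
        rewrite (nnpow_pos (Rpower h (- / p))) by apply exp_pos; rewrite Rpower_mult; lra. }
      assert (G : / (1 - x / y) <= Rpower h (- 1)).
      { replace (- 1) with (- (1)) by ring; rewrite Rpower_Ropp, Rpower_1 by exact Ph.
        apply Rinv_le_contravar; [exact Ph|].
        apply Rmult_le_reg_r with y; [lra|].
        replace ((1 - x / y) * y) with h by (unfold y; field; unfold y in Hy; lra).
        rewrite <- (Rmult_1_r h) at 2; apply Rmult_le_compat_l; lra. }
      assert (S1 := S_le_S x y ltac:(lra) ltac:(unfold y, h in *; lra)).
      assert (I0 : 0 <= / (1 - x / y)).
      { left; apply Rinv_0_lt_compat; assert (x / y < 1) by (apply div_lt_1; lra); lra. }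
      apply Rle_trans with (Rpower (s - x) (/ p) * (nnpow B (1 - p) * Rpower h (- / p * (1 - p)) * A * Rpower h (- 1))).
      + apply Rmult_le_compat_l; [left; apply exp_pos|].
        eapply Rle_trans; [exact S1|]; apply Rmult_le_compat; [|exact I0| |exact G].
        * apply Rmult_le_pos; [apply nnpow_ge_0 | exact A0].
        * apply Rmult_le_compat_r; [exact A0 | exact Q].
      + replace (s - x) with (2 * h) by (unfold h; field).
        rewrite <- Rpower_mult_distr by lra.
        replace (Rpower 2 (/ p) * Rpower h (/ p) * (nnpow B (1 - p) * Rpower h (- / p * (1 - p)) * A * Rpower h (- 1)))
          with (Rpower 2 (/ p) * A * nnpow B (1 - p) * (Rpower h (/ p) * Rpower h (- / p * (1 - p)) * Rpower h (- 1))) by ring.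
        rewrite <- !Rpower_plus.
        replace (/ p + - / p * (1 - p) + - 1) with 0 by (field; lra).
        rewrite Rpower_O by exact Ph; lra. }
    apply Rle_trans with B; [apply U; exists r; split; [exact Hr | reflexivity]|].
    apply nnpow_absorb; assumption.
Qed.

(** Take [r = 1 - 1/m] and [s = 1 - 1/(2m)] with [m = n + 2]. The weight in [S_growth] costs
    [(2m)^(1/p) <= (2m)^k], and [r^n >= 1/m] by Bernoulli costs one more factor [m], hence the
    exponent [k + 1]. The dependence on [A] is homogeneous of degree [1/p], like the quasi-norm. *)
Lemma coef_growth n k : / p <= INR k ->
  vn (a n) <= nnpow (Rpower 2 (/ p)) (/ p) * 2 ^ k * (INR n + 2) ^ Datatypes.S k * nnpow A (/ p).
Proof.
  intros Hk; assert (Pn := pos_INR n).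
  assert (Hp' := Rinv_0_lt_compat p Hp0).
  set (m := INR n + 2); assert (Pm : 2 <= m) by (unfold m; lra).
  assert (Im : 0 < / m <= 1 / 2).
  { split; [apply Rinv_0_lt_compat; lra|].
    replace (1 / 2) with (/ 2) by field; apply Rinv_le_contravar; lra. }
  set (r := 1 - / m); set (s := 1 - / m / 2).
  assert (G := S_growth r s ltac:(unfold r, s; lra) ltac:(unfold s; lra)).
  replace (s - r) with (/ (2 * m)) in G by (unfold s, r; field; lra).
  rewrite nnpow_mult in G; [|left; apply exp_pos | apply A_ge_0].
  assert (T := rsum_term (fun k => vn (a k) * r ^ k) (Datatypes.S n) n).
  simpl in T; assert (Tn := S_ub r (Datatypes.S n) ltac:(unfold r; lra)).
  assert (T' : vn (a n) * r ^ n <= S r).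
  { eapply Rle_trans; [|exact Tn]; apply T; [|lia].
    intros j; apply Rmult_le_pos; [apply vn_ge_0 | apply pow_le; unfold r; lra]. }
  assert (Bn : / m <= r ^ n).
  { eapply Rle_trans; [|apply bernoulli; lra].
    apply Rmult_le_reg_r with m; [lra|].
    replace ((1 - INR n * / m) * m) with (m - INR n) by (field; lra).
    rewrite Rinv_l by lra; unfold m; lra. }
  set (K := nnpow (Rpower 2 (/ p)) (/ p) * nnpow A (/ p)) in *.
  assert (PR : 0 < Rpower (/ (2 * m)) (/ p)) by apply exp_pos.
  assert (ER : Rpower (/ (2 * m)) (/ p) * Rpower (2 * m) (/ p) = 1).
  { rewrite Rpower_mult_distr; [|apply Rinv_0_lt_compat; lra | lra].
    rewrite Rinv_l by lra; apply Rpower_1_l. }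
  assert (K0 : 0 <= K) by (apply Rmult_le_pos; apply nnpow_ge_0).
  assert (PK : Rpower (2 * m) (/ p) <= (2 * m) ^ k).
  { rewrite <- Rpower_pow by lra; apply Rle_Rpower; lra. }
  assert (SR : S r <= Rpower (2 * m) (/ p) * K).
  { replace (S r) with (Rpower (2 * m) (/ p) * (Rpower (/ (2 * m)) (/ p) * S r)).
    - apply Rmult_le_compat_l; [left; apply exp_pos | exact G].
    - rewrite <- Rmult_assoc, (Rmult_comm (Rpower (2 * m) _)), ER; ring. }
  assert (V : vn (a n) * / m <= (2 * m) ^ k * K).
  { eapply Rle_trans; [apply Rmult_le_compat_l; [apply vn_ge_0 | exact Bn]|].
    eapply Rle_trans; [exact T'|]; eapply Rle_trans; [exact SR|].
    apply Rmult_le_compat_r; [exact K0 | exact PK]. }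
  apply Rmult_le_reg_r with (/ m); [lra|]; eapply Rle_trans; [exact V|].
  rewrite Rpow_mult_distr; unfold K; simpl; apply Req_le; field; lra.
Qed.

End Growth.

(** * Fourier coefficients *)

(* The integers are enumerated as [0, -1, 1, -2, 2, ...], so that sequences indexed
   by [Z] and power series have the same index set. *)
Definition freq (m : nat) : Z :=
  if Nat.even m then Z.of_nat (Nat.div2 m) else (- Z.of_nat (S (Nat.div2 m)))%Z.
(** The absolute value of [freq m] as a natural number: [0, 1, 1, 2, 2, ...]. *)
Definition afreq (m : nat) : nat := Nat.div2 (S m).

Lemma freq_even k : freq (2 * k) = Z.of_nat k.
Proof. unfold freq; rewrite Nat.even_even, Nat.div2_double; reflexivity. Qed.
Lemma freq_odd k : freq (2 * k + 1) = (- Z.of_nat (S k))%Z.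
Proof.
  unfold freq; rewrite Nat.even_odd, Nat.add_1_r, Nat.div2_succ_double; reflexivity.
Qed.
Lemma afreq_even k : afreq (2 * k) = k.
Proof. unfold afreq; apply Nat.div2_succ_double. Qed.
Lemma afreq_odd k : afreq (2 * k + 1) = S k.
Proof.
  unfold afreq; replace (S (2 * k + 1)) with (2 * S k)%nat by lia; apply Nat.div2_double.
Qed.

Lemma parity_case m : exists k, m = (2 * k)%nat \/ m = (2 * k + 1)%nat.
Proof. destruct (Nat.Even_or_Odd m) as [[k E]|[k E]]; exists k; auto. Qed.

Lemma freq_inj m n : freq m = freq n -> m = n.
Proof.
  destruct (parity_case m) as [k [->| ->]], (parity_case n) as [l [->| ->]];
    rewrite ?freq_even, ?freq_odd; lia.
Qed.

Lemma freq_surj z : exists m, freq m = z.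
Proof.
  destruct (Z.le_gt_cases 0 z) as [H|H].
  - exists (2 * Z.to_nat z)%nat; rewrite freq_even; lia.
  - exists (2 * (Z.to_nat (- z) - 1) + 1)%nat; rewrite freq_odd; lia.
Qed.

(** With [freq_le], this makes powers of the index and of the frequency interchangeable in growth
    and decay estimates. Index [0] is excluded because its frequency vanishes. *)
Lemma freq_ge m : (1 <= m)%nat -> INR m + 1 <= 4 * Rabs (IZR (freq m)).
Proof.
  intros Hm; rewrite <- abs_IZR, INR_IZR_INZ, <- plus_IZR, <- (mult_IZR 4).
  apply IZR_le; destruct (parity_case m) as [k [->| ->]]; rewrite ?freq_even, ?freq_odd; lia.
Qed.

Lemma freq_le m : Rabs (IZR (freq m)) <= INR m + 1.
Proof.
  rewrite <- abs_IZR, INR_IZR_INZ, <- plus_IZR.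
  apply IZR_le; destruct (parity_case m) as [k [->| ->]]; rewrite ?freq_even, ?freq_odd; lia.
Qed.

(** * Continuous complex functions and their means over a period *)

Definition ccont (g : R -> C) : Prop :=
  (forall t, continuous (fun s => Re (g s)) t) /\ (forall t, continuous (fun s => Im (g s)) t).

Definition cmean (g : R -> C) : C := (pmean (fun s => Re (g s)), pmean (fun s => Im (g s))).

Lemma ccont_plus g h : ccont g -> ccont h -> ccont (fun s => g s + h s)%C.
Proof.
  intros [A B] [A' B']; split; intros t.
  - exact (continuous_plus (V := R_NormedModule) _ _ t (A t) (A' t)).
  - exact (continuous_plus (V := R_NormedModule) _ _ t (B t) (B' t)).
Qed.

Lemma ccont_mult g h : ccont g -> ccont h -> ccont (fun s => g s * h s)%C.
Proof.
  intros [A B] [A' B']; split; intros t; simpl.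
  - exact (continuous_minus (V := R_NormedModule) _ _ t
      (continuous_mult _ _ t (A t) (A' t)) (continuous_mult _ _ t (B t) (B' t))).
  - exact (continuous_plus (V := R_NormedModule) _ _ t
      (continuous_mult _ _ t (A t) (B' t)) (continuous_mult _ _ t (B t) (A' t))).
Qed.

Lemma ccont_const c : ccont (fun _ => c).
Proof. split; intros t; apply continuous_const. Qed.

Lemma ccont_ext g h : (forall t, g t = h t) -> ccont g -> ccont h.
Proof.
  intros E [A B]; split; intros t.
  - apply continuous_ext with (fun s => Re (g s)); [intros; now rewrite E | apply A].
  - apply continuous_ext with (fun s => Im (g s)); [intros; now rewrite E | apply B].
Qed.

Lemma ccont_circle c : ccont (fun s => circle (c * s)).
Proof.
  split; intros t; unfold circle; simpl.
  - apply (ex_derive_continuous (fun s => cos (2 * PI * (c * s)))); auto_derive; trivial.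
  - apply (ex_derive_continuous (fun s => sin (2 * PI * (c * s)))); auto_derive; trivial.
Qed.

Lemma ccont_csum (f : nat -> R -> C) N : (forall m, ccont (f m)) -> ccont (fun s => csum (fun m => f m s) N).
Proof.
  intros H; induction N as [|N IH]; simpl; [apply ccont_const | now apply ccont_plus].
Qed.

Lemma cmean_ext g h : (forall t, g t = h t) -> cmean g = cmean h.
Proof. intros E; f_equal; apply functional_extensionality; exact E. Qed.

Lemma cmean_plus g h : ccont g -> ccont h ->
  cmean (fun s => g s + h s)%C = (cmean g + cmean h)%C.
Proof.
  intros [A B] [A' B']; apply injective_projections; simpl.
  - exact (pmean_plus _ _ A A').
  - exact (pmean_plus _ _ B B').
Qed.

Lemma cmean_scal c g : ccont g -> cmean (fun s => c * g s)%C = (c * cmean g)%C.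
Proof.
  intros [A B].
  assert (Sc : forall (f : R -> R) k, (forall t, continuous f t) -> forall t, continuous (fun t => k * f t) t).
  { intros f k Cf t; exact (continuous_scal_r (V := R_NormedModule) _ _ t (Cf t)). }
  apply injective_projections.
  - transitivity (pmean (fun s => fst c * Re (g s) + - snd c * Im (g s))).
    + simpl; f_equal; funext s; unfold Re, Im; ring.
    + rewrite pmean_plus, !pmean_scal by auto; simpl; ring.
  - transitivity (pmean (fun s => fst c * Im (g s) + snd c * Re (g s))); [reflexivity|].
    rewrite pmean_plus, !pmean_scal by auto; reflexivity.
Qed.

Lemma cmean_csum (f : nat -> R -> C) N : (forall m, ccont (f m)) ->
  cmean (fun s => csum (fun m => f m s) N) = csum (fun m => cmean (f m)) N.
Proof.
  intros H; induction N as [|N IH]; simpl.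
  - unfold cmean; simpl; rewrite pmean_const; reflexivity.
  - rewrite cmean_plus, IH; auto; now apply ccont_csum.
Qed.

Lemma Cmod_le_sum (z : C) : Cmod z <= Rabs (Re z) + Rabs (Im z).
Proof.
  replace z with (RtoC (Re z) + Ci * RtoC (Im z))%C at 1
    by (destruct z; apply injective_projections; simpl; ring).
  eapply Rle_trans; [apply Cmod_triangle|].
  rewrite Cmod_mult, Cmod_Ci, !Cmod_R; lra.
Qed.

Lemma Rabs_Re_le (z : C) : Rabs (Re z) <= Cmod z.
Proof. eapply Rle_trans; [|apply Rmax_Cmod]; apply Rmax_l. Qed.
Lemma Rabs_Im_le (z : C) : Rabs (Im z) <= Cmod z.
Proof. eapply Rle_trans; [|apply Rmax_Cmod]; apply Rmax_r. Qed.

Lemma pmean_bound f B : (forall t, continuous f t) -> (forall t, Rabs (f t) <= B) -> Rabs (pmean f) <= B.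
Proof.
  intros Hf H; apply Rabs_le; rewrite <- (pmean_const B) at 2.
  rewrite <- (pmean_const (- B)) at 1; split; apply pmean_le; auto; try (intros; apply continuous_const);
    intros t; specialize (H t); apply Rabs_le_between in H; lra.
Qed.

(** The factor [2] comes from estimating real and imaginary parts separately; a sharp constant would
    only change numerical factors later. *)
Lemma cmean_bound g B : ccont g -> (forall t, Cmod (g t) <= B) -> Cmod (cmean g) <= 2 * B.
Proof.
  intros [A D] H; eapply Rle_trans; [apply Cmod_le_sum|]; simpl.
  assert (H1 : Rabs (pmean (fun s => Re (g s))) <= B).
  { apply pmean_bound; [exact A|]; intros t; eapply Rle_trans; [apply Rabs_Re_le | apply H]. }
  assert (H2 : Rabs (pmean (fun s => Im (g s))) <= B).
  { apply pmean_bound; [exact D|]; intros t; eapply Rle_trans; [apply Rabs_Im_le | apply H]. }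
  lra.
Qed.

Definition cderive (g g' : R -> C) : Prop :=
  forall t, is_derive (fun s => Re (g s)) t (Re (g' t)) /\ is_derive (fun s => Im (g s)) t (Im (g' t)).

Lemma cmean_derive g g' : cderive g g' -> ccont g' -> (forall t, g (t + 1) = g t) -> cmean g' = RtoC 0.
Proof.
  intros D [A B] P.
  assert (E : g (1 / 2) = g (- (1 / 2))) by (rewrite <- (P (- (1 / 2))); f_equal; field).
  apply injective_projections; simpl; unfold pmean.
  - apply is_RInt_unique.
    replace 0 with (minus (Re (g (1 / 2))) (Re (g (- (1 / 2))))).
    + apply (is_RInt_derive (V := R_CompleteNormedModule) (fun s => Re (g s))); intros; [apply D | apply A].
    + rewrite E; unfold minus, plus, opp; simpl; ring.
  - apply is_RInt_unique.
    replace 0 with (minus (Im (g (1 / 2))) (Im (g (- (1 / 2))))).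
    + apply (is_RInt_derive (V := R_CompleteNormedModule) (fun s => Im (g s))); intros; [apply D | apply B].
    + rewrite E; unfold minus, plus, opp; simpl; ring.
Qed.

(** The eigenvalue of differentiation on [s => circle (c * s)]. *)
Definition omega (c : R) : C := (Ci * RtoC (2 * PI * c))%C.

Lemma cderive_circle (A : C) c : cderive (fun s => A * circle (c * s))%C (fun s => A * omega c * circle (c * s))%C.
Proof.
  intros t; destruct A as [a b]; unfold circle, omega; simpl; split; auto_derive; trivial; ring.
Qed.

Lemma cderive_plus g g' h h' : cderive g g' -> cderive h h' ->
  cderive (fun s => g s + h s)%C (fun s => g' s + h' s)%C.
Proof.
  intros D D' t; split.
  - exact (is_derive_plus (V := R_NormedModule) _ _ t _ _ (proj1 (D t)) (proj1 (D' t))).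
  - exact (is_derive_plus (V := R_NormedModule) _ _ t _ _ (proj2 (D t)) (proj2 (D' t))).
Qed.

Lemma cderive_mult g g' h h' : cderive g g' -> cderive h h' ->
  cderive (fun s => g s * h s)%C (fun s => g' s * h s + g s * h' s)%C.
Proof.
  intros D D' t; destruct (D t) as [A B], (D' t) as [A' B']; split.
  - eapply (is_derive_ext (fun s => minus (mult (Re (g s)) (Re (h s))) (mult (Im (g s)) (Im (h s))))).
    { intros s; reflexivity. }
    replace (Re (g' t * h t + g t * h' t)%C) with
      (minus (plus (mult (Re (g' t)) (Re (h t))) (mult (Re (g t)) (Re (h' t))))
             (plus (mult (Im (g' t)) (Im (h t))) (mult (Im (g t)) (Im (h' t))))).
    + apply (is_derive_minus (V := R_NormedModule)); apply (is_derive_mult (K := R_AbsRing)); auto;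
        intros; apply Rmult_comm.
    + unfold minus, plus, mult, opp; simpl; unfold Re, Im; ring.
  - eapply (is_derive_ext (fun s => plus (mult (Re (g s)) (Im (h s))) (mult (Im (g s)) (Re (h s))))).
    { intros s; reflexivity. }
    replace (Im (g' t * h t + g t * h' t)%C) with
      (plus (plus (mult (Re (g' t)) (Im (h t))) (mult (Re (g t)) (Im (h' t))))
             (plus (mult (Im (g' t)) (Re (h t))) (mult (Im (g t)) (Re (h' t))))).
    + apply (is_derive_plus (V := R_NormedModule)); apply (is_derive_mult (K := R_AbsRing)); auto;
        intros; apply Rmult_comm.
    + unfold plus, mult; simpl; unfold Re, Im; ring.
Qed.

Lemma cderive_ext g g' h h' : (forall t, g t = h t) -> (forall t, g' t = h' t) ->
  cderive g g' -> cderive h h'.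
Proof.
  intros E E' D t; rewrite <- E'; destruct (D t) as [A B]; split.
  - eapply is_derive_ext; [|exact A]; intros; simpl; now rewrite E.
  - eapply is_derive_ext; [|exact B]; intros; simpl; now rewrite E.
Qed.

Lemma circle_freq_periodic z t : circle (IZR z * (t + 1)) = circle (IZR z * t).
Proof.
  rewrite Rmult_plus_distr_l, circle_add, Rmult_1_r, circle_IZR; ring.
Qed.

(** For [z <> 0] the integrand is the derivative of the periodic function
    [circle (z s) / omega z]. *)
Lemma cmean_circle z : cmean (fun s => circle (IZR z * s)) = if Z.eq_dec z 0 then RtoC 1 else RtoC 0.
Proof.
  destruct (Z.eq_dec z 0) as [->|N].
  - rewrite (cmean_ext _ (fun _ => RtoC 1)); [unfold cmean; simpl; now rewrite !pmean_const|].
    intros t; rewrite Rmult_0_l; apply circle_0.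
  - assert (Nz : omega (IZR z) <> RtoC 0).
    { unfold omega; intros E; apply (f_equal Cmod) in E.
      rewrite Cmod_mult, Cmod_Ci, Cmod_R, Cmod_0, Rmult_1_l in E.
      apply Rabs_eq_0 in E; assert (P := PI_RGT_0).
      apply Rmult_integral in E; destruct E as [E|E]; [lra|]; apply eq_IZR in E; auto. }
    assert (K := cmean_derive _ _ (cderive_circle (/ omega (IZR z))%C (IZR z))).
    rewrite (cmean_ext _ (fun s => circle (IZR z * s))) in K.
    + apply K.
      * eapply ccont_ext; [|apply (ccont_circle (IZR z))].
        intros t; simpl; field; exact Nz.
      * intros t; now rewrite circle_freq_periodic.
    + intros t; field; exact Nz.
Qed.

(** The signs follow the convention for distributions: the coefficient of [f] at frequency [n] is
    [f] applied to [exp (-2 pi i n s)]. Test functions are therefore expanded in the conjugate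
    exponentials [psi_fun m], and [fc g m] is the coefficient of [psi_fun m]. *)
Definition fc (g : R -> C) (m : nat) : C := cmean (fun s => g s * circle (IZR (freq m) * s))%C.

Definition psi_fun (m : nat) (s : R) : C := circle (- IZR (freq m) * s).

Lemma psi_fun_periodic m s : psi_fun m (s + 1) = psi_fun m s.
Proof. unfold psi_fun; rewrite <- opp_IZR; apply circle_freq_periodic. Qed.

Lemma Cmod_psi m s : Cmod (psi_fun m s) = 1.
Proof. apply Cmod_circle. Qed.

Lemma ccont_psi m : ccont (psi_fun m).
Proof. apply ccont_circle. Qed.

Lemma fc_psi m n : fc (psi_fun m) n = if Nat.eqb m n then RtoC 1 else RtoC 0.
Proof.
  unfold fc, psi_fun.
  rewrite (cmean_ext _ (fun s => circle (IZR (freq n - freq m) * s))).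
  - rewrite cmean_circle; destruct (Z.eq_dec _ _) as [E|E], (Nat.eqb_spec m n) as [E'|E']; auto.
    + exfalso; apply E', freq_inj; lia.
    + exfalso; apply E; subst; lia.
  - intros t; rewrite <- circle_add; f_equal; rewrite minus_IZR; ring.
Qed.

Lemma ccont_fc g m : ccont g -> ccont (fun s => g s * circle (IZR (freq m) * s))%C.
Proof. intros H; apply ccont_mult; [exact H | apply ccont_circle]. Qed.

Lemma fc_plus g h m : ccont g -> ccont h -> fc (fun s => g s + h s)%C m = (fc g m + fc h m)%C.
Proof.
  intros Hg Hh; unfold fc; rewrite <- cmean_plus by now apply ccont_fc.
  apply cmean_ext; intros t; ring.
Qed.

Lemma fc_scal c g m : ccont g -> fc (fun s => c * g s)%C m = (c * fc g m)%C.
Proof.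
  intros Hg; unfold fc; rewrite <- cmean_scal by now apply ccont_fc.
  apply cmean_ext; intros t; ring.
Qed.

Lemma fc_bound g B m : ccont g -> (forall t, Cmod (g t) <= B) -> Cmod (fc g m) <= 2 * B.
Proof.
  intros Hg H; apply cmean_bound; [now apply ccont_fc|].
  intros t; rewrite Cmod_mult, Cmod_circle, Rmult_1_r; apply H.
Qed.

Definition trig_poly (c : nat -> C) (N : nat) (s : R) : C := csum (fun m => c m * psi_fun m s)%C N.

Lemma ccont_trig_poly c N : ccont (trig_poly c N).
Proof.
  apply ccont_csum; intros m; apply ccont_mult; [apply ccont_const | apply ccont_psi].
Qed.

Lemma fc_trig_poly c N m : (m < N)%nat -> fc (trig_poly c N) m = c m.
Proof.
  intros Hm; unfold fc, trig_poly.
  rewrite (cmean_ext _ (fun s => csum (fun n => c n * (psi_fun n s * circle (IZR (freq m) * s))) N)%C).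
  2:{ intros t; rewrite Cmult_comm, <- csum_scal; apply csum_ext; intros n _; ring. }
  rewrite (cmean_csum (fun n s => c n * (psi_fun n s * circle (IZR (freq m) * s)))%C).
  2:{ intros n; apply ccont_mult; [apply ccont_const | apply ccont_fc, ccont_psi]. }
  rewrite (csum_ext _ (fun n => c n * if Nat.eqb n m then RtoC 1 else RtoC 0)%C).
  2:{ intros n _; transitivity (c n * fc (psi_fun n) m)%C; [|now rewrite fc_psi].
      apply (cmean_scal (c n) (fun s => psi_fun n s * circle (IZR (freq m) * s))%C).
      apply ccont_fc, ccont_psi. }
  rewrite (csum_single _ m N Hm), Nat.eqb_refl; [ring|].
  intros k Hk; apply Nat.eqb_neq in Hk; rewrite Hk; ring.
Qed.

(** Once [N > m] the polynomials have [m]-th coefficient exactly [c m], and [fc] is continuous for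
    the supremum norm. *)
Lemma fc_uniform_limit g c : ccont g ->
  (forall eps, 0 < eps -> exists N0, forall N t, (N0 <= N)%nat -> Cmod (g t - trig_poly c N t)%C <= eps) ->
  forall m, fc g m = c m.
Proof.
  intros Hg H m.
  assert (Z : Cmod (fc g m - c m)%C <= 0).
  { apply le_epsilon; intros eps He.
    destruct (H (eps / 2)) as [N0 HN]; [lra|].
    set (N := Nat.max N0 (S m)).
    replace (fc g m - c m)%C with (fc (fun s => g s + (- (1)) * trig_poly c N s)%C m).
    - replace (0 + eps) with (2 * (eps / 2)) by field; apply fc_bound.
      + apply ccont_plus; [exact Hg|]; apply ccont_mult; [apply ccont_const | apply ccont_trig_poly].
      + intros t; replace (g t + (- (1)) * trig_poly c N t)%C with (g t - trig_poly c N t)%C by ring.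
        apply HN; unfold N; lia.
    - rewrite (fc_plus g (fun s => (- (1)) * trig_poly c N s)%C);
        [|exact Hg | apply ccont_mult; [apply ccont_const | apply ccont_trig_poly]].
      rewrite fc_scal by apply ccont_trig_poly.
      rewrite fc_trig_poly by (unfold N; lia); ring. }
  assert (E : (fc g m - c m)%C = RtoC 0).
  { apply Cmod_eq_0, Rle_antisym; [exact Z | apply Cmod_ge_0]. }
  replace (fc g m) with (fc g m - c m + c m)%C by ring; rewrite E; ring.
Qed.

(** * Uniqueness of Fourier coefficients *)

(** The classical peaking argument: [h] is orthogonal to all powers of [k = (1 + cos (2 pi t)) / 2].
    If [h 0 > 0], the integral of [h k^N] gains a multiple of [g1^N] near [0] and loses at most
    [M g0^N] elsewhere, with [g0 < g1]; for large [N] it cannot vanish. *)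
Lemma uniqueness_at_0 (h : R -> R) : (forall t, continuous h t) ->
  (exists M, forall t, Rabs (h t) <= M) ->
  (forall n : nat, pmean (fun t => h t * cos (2 * PI * (INR n * t))) = 0 /\
                   pmean (fun t => h t * sin (2 * PI * (INR n * t))) = 0) -> h 0 <= 0.
Proof.
  intros Ch [M HM] H0; apply Rnot_lt_le; intros Pc.
  set (k := fun t : R => (1 + cos (2 * PI * t)) / 2).
  assert (Ck : forall t, continuous k t).
  { intros t; apply (ex_derive_continuous k); unfold k; auto_derive; trivial. }
  assert (Ckn : forall N t, continuous (fun t => k t ^ N) t).
  { intros N t; induction N as [|N IH]; simpl; [apply continuous_const|].
    exact (continuous_mult _ _ t (Ck t) IH). }
  assert (Cc : forall c t, continuous (fun t => cos (2 * PI * (c * t))) t).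
  { intros c t; apply (ex_derive_continuous (fun t => cos (2 * PI * (c * t)))); auto_derive; trivial. }
  assert (Cs : forall c t, continuous (fun t => sin (2 * PI * (c * t))) t).
  { intros c t; apply (ex_derive_continuous (fun t => sin (2 * PI * (c * t)))); auto_derive; trivial. }
  (* multiplication by [k] shifts frequencies by [1], so it preserves orthogonality *)
  assert (V : forall N, (forall n : nat, pmean (fun t => h t * k t ^ N * cos (2 * PI * (INR n * t))) = 0 /\
                   pmean (fun t => h t * k t ^ N * sin (2 * PI * (INR n * t))) = 0)).
  { induction N as [|N IH]; intros n.
    - destruct (H0 n) as [A B]; split; [etransitivity; [|exact A] | etransitivity; [|exact B]];
        f_equal; funext t; simpl; ring.
    - set (u := fun t => h t * k t ^ N) in *.
      assert (Cu : forall t, continuous u t).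
      { intros t; exact (continuous_mult _ _ t (Ch t) (Ckn N t)). }
      assert (IHc : forall z : R, (exists n, z = INR n \/ z = - INR n) ->
         pmean (fun t => u t * cos (2 * PI * (z * t))) = 0 /\
         pmean (fun t => u t * sin (2 * PI * (z * t))) = 0).
      { intros z [m [->| ->]]; [apply IH|]; destruct (IH m) as [A B]; split.
        all: change (pmean (fun t => u t * cos (2 * PI * (INR m * t))) = 0) in A.
        all: change (pmean (fun t => u t * sin (2 * PI * (INR m * t))) = 0) in B.
        - rewrite <- A; f_equal; funext t.
          replace (2 * PI * (- INR m * t)) with (- (2 * PI * (INR m * t))) by ring; now rewrite cos_neg.
        - transitivity (-1 * pmean (fun t => u t * sin (2 * PI * (INR m * t)))); [|rewrite B; ring].
          rewrite <- pmean_scal.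
          + f_equal; funext t.
            replace (2 * PI * (- INR m * t)) with (- (2 * PI * (INR m * t))) by ring; rewrite sin_neg; ring.
          + intros t; exact (continuous_mult _ _ t (Cu t) (Cs _ t)). }
      destruct (IHc (INR n)) as [A1 B1]; [exists n; now left|].
      destruct (IHc (INR n + 1)) as [A2 B2]; [exists (S n); left; now rewrite S_INR|].
      destruct (IHc (INR n - 1)) as [A3 B3].
      { destruct n as [|n]; [exists 1%nat; right; simpl; ring|].
        exists n; left; rewrite S_INR; ring. }
      assert (LC : forall f1 f2 f3 : R -> R, (forall t, continuous f1 t) -> (forall t, continuous f2 t) ->
        (forall t, continuous f3 t) -> pmean f1 = 0 -> pmean f2 = 0 -> pmean f3 = 0 ->
        pmean (fun t => / 2 * f1 t + (/ 4 * f2 t + / 4 * f3 t)) = 0).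
      { intros f1 f2 f3 C1 C2 C3 E1 E2 E3.
        assert (Sc : forall (f : R -> R) c, (forall t, continuous f t) -> forall t, continuous (fun t => c * f t) t).
        { intros f c Cf t; exact (continuous_scal_r (V := R_NormedModule) _ _ t (Cf t)). }
        rewrite pmean_plus, pmean_plus, !pmean_scal, E1, E2, E3; auto; [ring|].
        intros t; exact (continuous_plus (V := R_NormedModule) _ _ t (Sc _ _ C2 t) (Sc _ _ C3 t)). }
      assert (Cm : forall (f g : R -> R), (forall t, continuous f t) -> (forall t, continuous g t) ->
                   forall t, continuous (fun t => f t * g t) t).
      { intros f g Cf Cg t; exact (continuous_mult _ _ t (Cf t) (Cg t)). }
      split.
      + rewrite <- (LC _ _ _ (Cm _ _ Cu (Cc (INR n))) (Cm _ _ Cu (Cc (INR n + 1))) (Cm _ _ Cu (Cc (INR n - 1))) A1 A2 A3).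
        f_equal; funext t; unfold u, k; simpl.
        replace (2 * PI * ((INR n + 1) * t)) with (2 * PI * (INR n * t) + 2 * PI * t) by ring.
        replace (2 * PI * ((INR n - 1) * t)) with (2 * PI * (INR n * t) - 2 * PI * t) by ring.
        rewrite cos_plus, cos_minus; field.
      + rewrite <- (LC _ _ _ (Cm _ _ Cu (Cs (INR n))) (Cm _ _ Cu (Cs (INR n + 1))) (Cm _ _ Cu (Cs (INR n - 1))) B1 B2 B3).
        f_equal; funext t; unfold u, k; simpl.
        replace (2 * PI * ((INR n + 1) * t)) with (2 * PI * (INR n * t) + 2 * PI * t) by ring.
        replace (2 * PI * ((INR n - 1) * t)) with (2 * PI * (INR n * t) - 2 * PI * t) by ring.
        rewrite sin_plus, sin_minus; field. }
  assert (P2 : 0 < h 0 / 2) by lra.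
  destruct (proj1 (filterlim_locally _ _) (Ch 0) (mkposreal _ P2)) as [d Hd].
  set (e := Rmin (d / 2) (1 / 4)).
  assert (Pd := cond_pos d).
  assert (E1 : e <= d / 2) by apply Rmin_l; assert (E2 : e <= 1 / 4) by apply Rmin_r.
  assert (Pe : 0 < e) by (apply Rmin_pos; lra).
  assert (Hh : forall t, Rabs t <= e -> h 0 / 2 <= h t).
  { intros t Ht; specialize (Hd t).
    assert (B : ball 0 d t) by (change (Rabs (t - 0) < d); rewrite Rminus_0_r; lra).
    specialize (Hd B); change (Rabs (h t - h 0) < h 0 / 2) in Hd.
    apply Rabs_lt_between in Hd; lra. }
  assert (PPI := PI_RGT_0).
  assert (k0 : forall t, 0 <= k t <= 1).
  { intros t; unfold k; assert (B := COS_bound (2 * PI * t)); lra. }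
  assert (kabs : forall t, k t = k (Rabs t)).
  { intros t; unfold k, Rabs; destruct (Rcase_abs t); [|reflexivity].
    replace (2 * PI * - t) with (- (2 * PI * t)) by ring; now rewrite cos_neg. }
  assert (kdec : forall x y, 0 <= x <= y -> y <= 1 / 2 -> k y <= k x).
  { intros x y Hx Hy; unfold k; assert (cos (2 * PI * y) <= cos (2 * PI * x)); [|lra].
    apply cos_decr_1; nra. }
  (* [k >= g1] for [|t| <= e / 2] and [k <= g0] for [|t| >= e] within the period. The zone in
     between separates the two rates; there only the sign of [h] is used. *)
  set (g1 := k (e / 2)); set (g0 := k e).
  assert (G : 0 <= g0 < g1).
  { split; [apply k0|]; unfold g0, g1, k.
    assert (cos (2 * PI * e) < cos (2 * PI * (e / 2))); [|lra].
    apply cos_decreasing_1; nra. }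
  assert (M0 : 0 <= M) by (eapply Rle_trans; [apply Rabs_pos | apply (HM 0)]).
  assert (Low : forall N, e * (h 0 / 2) * g1 ^ N <= M * g0 ^ N).
  { intros N; set (u := fun t => h t * k t ^ N).
    assert (Cu : forall t, continuous u t).
    { intros t; exact (continuous_mult _ _ t (Ch t) (Ckn N t)). }
    assert (Z : pmean u = 0).
    { destruct (V N 0%nat) as [A _]; rewrite <- A; f_equal; funext t.
      simpl; rewrite Rmult_0_l, Rmult_0_r, cos_0; unfold u; ring. }
    assert (D1 := RInt_Chasles u (- (1 / 2)) (- (e / 2)) (1 / 2) (cont_ex_RInt _ _ _ Cu) (cont_ex_RInt _ _ _ Cu)).
    assert (D2 := RInt_Chasles u (- (e / 2)) (e / 2) (1 / 2) (cont_ex_RInt _ _ _ Cu) (cont_ex_RInt _ _ _ Cu)).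
    change plus with Rplus in D1, D2; simpl in D1, D2.
    assert (Cst : forall c a b : R, RInt (fun _ => c) a b = (b - a) * c).
    { intros c a b; rewrite RInt_const; reflexivity. }
    assert (out : forall t, e / 2 <= Rabs t <= 1 / 2 -> - (M * g0 ^ N) <= u t).
    { intros t Ht; unfold u; destruct (Rle_lt_dec (Rabs t) e) as [T|T].
      - assert (0 <= h t * k t ^ N).
        { apply Rmult_le_pos; [specialize (Hh t T); lra | apply pow_le, k0]. }
        assert (0 <= M * g0 ^ N) by (apply Rmult_le_pos; [exact M0 | apply pow_le; lra]); lra.
      - assert (k t ^ N <= g0 ^ N).
        { apply pow_incr; split; [apply k0|]; rewrite kabs; apply kdec; lra. }
        assert (0 <= k t ^ N) by (apply pow_le, k0).
        assert (B := HM t); apply Rabs_le_between in B.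
        assert (M * k t ^ N <= M * g0 ^ N) by (apply Rmult_le_compat_l; lra).
        assert (- M * k t ^ N <= h t * k t ^ N) by (apply Rmult_le_compat_r; lra); lra. }
    assert (I1 : (- (e / 2) - - (1 / 2)) * - (M * g0 ^ N) <= RInt u (- (1 / 2)) (- (e / 2))).
    { rewrite <- Cst; apply RInt_le; try (apply cont_ex_RInt; auto; intros; apply continuous_const); [lra|].
      intros t Ht; apply out; rewrite Rabs_left by lra; lra. }
    assert (I3 : (1 / 2 - e / 2) * - (M * g0 ^ N) <= RInt u (e / 2) (1 / 2)).
    { rewrite <- Cst; apply RInt_le; try (apply cont_ex_RInt; auto; intros; apply continuous_const); [lra|].
      intros t Ht; apply out; rewrite Rabs_pos_eq by lra; lra. }
    assert (I2 : (e / 2 - - (e / 2)) * (h 0 / 2 * g1 ^ N) <= RInt u (- (e / 2)) (e / 2)).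
    { rewrite <- Cst; apply RInt_le; try (apply cont_ex_RInt; auto; intros; apply continuous_const); [lra|].
      intros t Ht; assert (T : Rabs t <= e / 2) by (apply Rabs_le; lra).
      unfold u; apply Rmult_le_compat; [lra | apply pow_le; lra | apply Hh; lra|].
      apply pow_incr; split; [lra|]; rewrite kabs; apply kdec; [split; [apply Rabs_pos | exact T] | lra]. }
    unfold pmean in Z; assert (0 <= M * g0 ^ N) by (apply Rmult_le_pos; [exact M0 | apply pow_le; lra]); nra. }
  set (q := g0 / g1).
  assert (Hq : Rabs q < 1).
  { unfold q; rewrite Rabs_pos_eq by (apply Rdiv_le_0_compat; lra); apply div_lt_1; lra. }
  destruct (pow_lt_1_zero q Hq (e * (h 0 / 2) / (M + 1))) as [N HN].
  { apply Rdiv_lt_0_compat; [nra | lra]. }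
  specialize (HN N (Nat.le_refl N)); specialize (Low N).
  assert (Pg : 0 < g1 ^ N) by (apply pow_lt; lra).
  assert (Q0 : 0 <= q ^ N) by (apply pow_le, Rdiv_le_0_compat; lra).
  rewrite Rabs_pos_eq in HN by exact Q0.
  assert (Eq : g0 ^ N = q ^ N * g1 ^ N) by (unfold q; rewrite <- Rpow_mult_distr; f_equal; field; lra).
  rewrite Eq in Low.
  assert (L2 : e * (h 0 / 2) <= M * q ^ N) by (apply Rmult_le_reg_r with (g1 ^ N); [exact Pg | lra]).
  assert (L3 : (M + 1) * q ^ N < e * (h 0 / 2)).
  { apply Rmult_lt_reg_r with (/ (M + 1)); [apply Rinv_0_lt_compat; lra|].
    replace ((M + 1) * q ^ N * / (M + 1)) with (q ^ N) by (field; lra); exact HN. }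
  lra.
Qed.

(** * Fourier inversion *)

Lemma periodic_bounded (f : R -> R) : (forall t, continuous f t) -> (forall t, f (t + 1) = f t) ->
  exists M, forall t, Rabs (f t) <= M.
Proof.
  intros Cf Pf.
  destruct (continuity_ab_maj (fun s => Rabs (f s)) 0 1) as [m [Hm _]].
  { lra. }
  { intros c _; apply continuity_pt_filterlim.
    exact (continuous_comp f Rabs c (Cf c) (continuous_Rabs (f c))). }
  exists (Rabs (f m)); intros t.
  rewrite <- (periodic_Z _ Pf (- Int_part t) t), opp_IZR.
  apply Hm; destruct (base_Int_part t); lra.
Qed.

(** Translation multiplies the coefficients by unimodular constants, so [t0] can be moved to [0].
    Combining the frequencies [n] and [-n] gives the multipliers [cos] and [sin], which are real and
    so commute with [Re]. *)
Lemma uniqueness_re (h : R -> C) t0 : ccont h -> (forall t, h (t + 1) = h t) ->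
  (forall m, fc h m = RtoC 0) -> Re (h t0) <= 0.
Proof.
  intros Ch Ph Z.
  set (u := fun t => h (t + t0)).
  assert (Cu : ccont u).
  { destruct Ch as [A B]; split; intros t.
    - apply continuous_ext with (fun s => Re (h (1 * s + t0))).
      + intros s; unfold u; now rewrite Rmult_1_l.
      + exact (continuous_affine (fun s => Re (h s)) 1 t0 t A).
    - apply continuous_ext with (fun s => Im (h (1 * s + t0))).
      + intros s; unfold u; now rewrite Rmult_1_l.
      + exact (continuous_affine (fun s => Im (h s)) 1 t0 t B). }
  assert (Zu : forall z, cmean (fun s => u s * circle (IZR z * s))%C = RtoC 0).
  { intros z; destruct (freq_surj z) as [m E]; specialize (Z m); unfold fc in Z; rewrite E in Z.
    set (w := fun s => (h s * circle (IZR z * s))%C) in *.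
    assert (Cw : ccont w) by (apply ccont_mult; [exact Ch | apply ccont_circle]).
    assert (Pw : forall t, w (t + 1) = w t) by (intros t; unfold w; now rewrite Ph, circle_freq_periodic).
    assert (S : cmean (fun s => w (s + t0)) = RtoC 0).
    { rewrite <- Z; apply injective_projections; simpl.
      - apply (pmean_shift (fun s => Re (w s)) (proj1 Cw)); intros t; now rewrite Pw.
      - apply (pmean_shift (fun s => Im (w s)) (proj2 Cw)); intros t; now rewrite Pw. }
    rewrite (cmean_ext _ (fun s => circle (- (IZR z * t0)) * w (s + t0)%R)%C).
    - rewrite cmean_scal, S; [ring|].
      eapply ccont_ext; [|apply (ccont_mult _ _ Cu (ccont_mult _ _ (ccont_const (circle (IZR z * t0))) (ccont_circle (IZR z))))].
      intros t; unfold w, u; simpl; rewrite Rmult_plus_distr_l, circle_add; ring.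
    - intros t; unfold w, u; rewrite Rmult_plus_distr_l, circle_add.
      transitivity (circle (- (IZR z * t0)) * circle (IZR z * t0) * (h (t + t0)%R * circle (IZR z * t)))%C; [|ring].
      rewrite circle_opp; ring. }
  assert (K : forall n : nat,
     cmean (fun s => RtoC (cos (2 * PI * (INR n * s))) * u s)%C = RtoC 0 /\
     cmean (fun s => RtoC (sin (2 * PI * (INR n * s))) * u s)%C = RtoC 0).
  { intros n; assert (Z1 := Zu (Z.of_nat n)); assert (Z2 := Zu (- Z.of_nat n)%Z).
    rewrite opp_IZR in Z2; rewrite <- INR_IZR_INZ in Z1, Z2.
    assert (C1 := ccont_mult _ _ Cu (ccont_circle (INR n))).
    assert (C2 := ccont_mult _ _ Cu (ccont_circle (- INR n))).
    assert (Lin : forall a b : C, cmean (fun s => a * (u s * circle (INR n * s)) + b * (u s * circle (- INR n * s)))%C = RtoC 0).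
    { intros a b; rewrite cmean_plus, !cmean_scal, Z1, Z2; auto; [ring| |];
        (apply ccont_mult; [apply ccont_const | assumption]). }
    assert (E : forall s, circle (- INR n * s) = (cos (2 * PI * (INR n * s)), - sin (2 * PI * (INR n * s)))).
    { intros s; unfold circle; replace (2 * PI * (- INR n * s)) with (- (2 * PI * (INR n * s))) by ring.
      now rewrite cos_neg, sin_neg. }
    split.
    - rewrite <- (Lin (RtoC (/ 2)) (RtoC (/ 2))); apply cmean_ext; intros s; rewrite E; unfold circle.
      apply injective_projections; simpl; field.
    - rewrite <- (Lin (- Ci * RtoC (/ 2))%C (Ci * RtoC (/ 2))%C); apply cmean_ext; intros s; rewrite E; unfold circle.
      apply injective_projections; simpl; field. }
  replace (Re (h t0)) with (Re (u 0)) by (unfold u; now rewrite Rplus_0_l).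
  apply (uniqueness_at_0 (fun t => Re (u t))).
  - apply Cu.
  - apply periodic_bounded; [apply Cu|]; intros t; unfold u.
    replace (t + 1 + t0) with (t + t0 + 1) by ring; now rewrite Ph.
  - intros n; destruct (K n) as [K1 K2]; split.
    + apply (f_equal Re) in K1; simpl in K1; rewrite <- K1; f_equal.
      funext t; unfold Re; ring.
    + apply (f_equal Re) in K2; simpl in K2; rewrite <- K2; f_equal.
      funext t; unfold Re; ring.
Qed.

(** [uniqueness_re] applied to [h] multiplied by [1], [-1], [Ci] and [-Ci] bounds both parts from
    both sides. *)
Lemma uniqueness (h : R -> C) : ccont h -> (forall t, h (t + 1) = h t) ->
  (forall m, fc h m = RtoC 0) -> forall t, h t = RtoC 0.
Proof.
  intros Ch Ph Z t.
  assert (L : forall c : C, Re (c * h t)%C <= 0).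
  { intros c; apply (uniqueness_re (fun s => c * h s)%C t).
    - apply ccont_mult; [apply ccont_const | exact Ch].
    - intros s; now rewrite Ph.
    - intros m; rewrite fc_scal, Z by exact Ch; ring. }
  assert (L1 := L (RtoC 1)); assert (L2 := L (RtoC (-1))); assert (L3 := L Ci); assert (L4 := L (- Ci)%C).
  destruct (h t) as [x y]; unfold Re in *; simpl in *; apply injective_projections; simpl; lra.
Qed.

Lemma rsum_inv_sq n : rsum (fun m => / (INR m + 1) ^ 2) n <= 2.
Proof.
  assert (H : forall n, rsum (fun m => / (INR m + 1) ^ 2) (S n) <= 2 - / (INR n + 1)).
  { induction n0 as [|k IH]; [simpl; lra|].
    change (rsum (fun m => / (INR m + 1) ^ 2) (S k) + / (INR (S k) + 1) ^ 2 <= 2 - / (INR (S k) + 1)).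
    rewrite S_INR; assert (P := pos_INR k); set (x := INR k + 1) in *.
    assert (Px : 0 < x) by (unfold x; lra).
    assert (I : / (x + 1) ^ 2 <= / x - / (x + 1)); [|lra].
    replace (/ x - / (x + 1)) with (/ (x * (x + 1))) by (field; lra).
    apply Rinv_le_contravar; nra. }
  destruct n as [|n]; [simpl; lra|]; eapply Rle_trans; [apply H|].
  assert (0 < / (INR n + 1)) by (apply Rinv_0_lt_compat; assert (P := pos_INR n); lra); lra.
Qed.

Lemma vsum_csum_C (f : nat -> C) n : @vsum C_CompleteNormedModule f n = csum f n.
Proof. induction n as [|n IH]; simpl; [reflexivity | rewrite IH; reflexivity]. Qed.

Lemma vsub_C (x y : C) : @vsub C_CompleteNormedModule x y = (x - y)%C.
Proof.
  change (x + Copp (RtoC 1) * y = x - y)%C; ring.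
Qed.

Lemma csum_tail (f : nat -> C) n m : (n <= m)%nat ->
  Cmod (csum f m - csum f n)%C <= rsum (fun k => Cmod (f k)) m - rsum (fun k => Cmod (f k)) n.
Proof.
  induction 1 as [|m Hm IH].
  - unfold Cminus; rewrite Cplus_opp_r, Cmod_0; lra.
  - simpl; replace (csum f m + f m - csum f n)%C with ((csum f m - csum f n) + f m)%C by ring.
    eapply Rle_trans; [apply Cmod_triangle | lra].
Qed.

Definition clim (s : nat -> C) (l : C) : Prop :=
  forall eps, 0 < eps -> exists N, forall n, (N <= n)%nat -> Cmod (s n - l)%C <= eps.

Lemma clim_unique s l l' : clim s l -> clim s l' -> l = l'.
Proof.
  intros H H'; apply (@vlim_unique C_CompleteNormedModule s).
  - intros eps He; destruct (H eps He) as [N HN]; exists N; intros n Hn; rewrite vsub_C; now apply HN.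
  - intros eps He; destruct (H' eps He) as [N HN]; exists N; intros n Hn; rewrite vsub_C; now apply HN.
Qed.

Lemma csum_abs_cv (f : nat -> C) M : (forall n, rsum (fun k => Cmod (f k)) n <= M) ->
  exists l, clim (csum f) l.
Proof.
  intros HM; destruct (@vseries_ex C_CompleteNormedModule f M HM) as [l Hl]; exists l.
  intros eps He; destruct (Hl eps He) as [N HN]; exists N; intros n Hn.
  specialize (HN n Hn); rewrite vsub_C, vsum_csum_C in HN; exact HN.
Qed.

Lemma clim_csum_tail (f : nat -> C) l n e : clim (csum f) l ->
  (forall m, (n <= m)%nat -> rsum (fun k => Cmod (f k)) m - rsum (fun k => Cmod (f k)) n <= e) ->
  Cmod (l - csum f n)%C <= e.
Proof.
  intros H B; apply le_epsilon; intros eps He.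
  destruct (H eps He) as [N HN].
  specialize (HN (Nat.max N n) ltac:(lia)); specialize (B (Nat.max N n) ltac:(lia)).
  assert (T := csum_tail f n (Nat.max N n) ltac:(lia)).
  replace (l - csum f n)%C with (- (csum f (Nat.max N n) - l) + (csum f (Nat.max N n) - csum f n))%C by ring.
  eapply Rle_trans; [apply Cmod_triangle|]; rewrite Cmod_opp; lra.
Qed.

Definition uniform_sum (c : nat -> C) (g : R -> C) : Prop :=
  forall eps, 0 < eps -> exists N0, forall N t, (N0 <= N)%nat -> Cmod (g t - trig_poly c N t)%C <= eps.

Lemma trig_series_uniform c M g : (forall n, rsum (fun k => Cmod (c k)) n <= M) ->
  (forall t, clim (fun N => trig_poly c N t) (g t)) -> uniform_sum c g.
Proof.
  intros HM Hg eps He.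
  destruct (bounded_tail _ M (fun k => Cmod_ge_0 (c k)) HM eps He) as [N0 HN].
  exists N0; intros N t HN0; apply (clim_csum_tail (fun m => c m * psi_fun m t)%C (g t) N eps (Hg t)).
  intros m Hm.
  rewrite (rsum_ext _ (fun k => Cmod (c k)) m), (rsum_ext _ (fun k => Cmod (c k)) N).
  - now apply HN.
  - intros k _; now rewrite Cmod_mult, Cmod_psi, Rmult_1_r.
  - intros k _; now rewrite Cmod_mult, Cmod_psi, Rmult_1_r.
Qed.

Lemma uniform_limit_continuous (f : R -> R) (u : nat -> R -> R) :
  (forall n t, continuous (u n) t) ->
  (forall eps, 0 < eps -> exists n, forall t, Rabs (f t - u n t) <= eps) -> forall t, continuous f t.
Proof.
  intros Hu H t; apply filterlim_locally; intros eps.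
  assert (Pe := cond_pos eps).
  destruct (H (eps / 4)) as [n Hn]; [lra|].
  assert (P4 : 0 < eps / 4) by lra.
  generalize (proj1 (filterlim_locally _ _) (Hu n t) (mkposreal _ P4)); apply filter_imp.
  intros s Hs; change (Rabs (u n s - u n t) < eps / 4) in Hs; change (Rabs (f s - f t) < eps).
  assert (A := Hn s); assert (B := Hn t).
  apply Rabs_lt_between in Hs; apply Rabs_le_between in A; apply Rabs_le_between in B.
  apply Rabs_def1; lra.
Qed.

Lemma uniform_sum_ccont c g : uniform_sum c g -> ccont g.
Proof.
  intros H; split;
    [apply (uniform_limit_continuous _ (fun N t => Re (trig_poly c N t)))
    |apply (uniform_limit_continuous _ (fun N t => Im (trig_poly c N t)))];
    try (intros n; apply (ccont_trig_poly c n));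
    intros eps He; destruct (H eps He) as [N HN]; exists N; intros t;
    (eapply Rle_trans; [|apply (HN N t), Nat.le_refl]).
  - exact (Rabs_Re_le (g t - trig_poly c N t)%C).
  - exact (Rabs_Im_le (g t - trig_poly c N t)%C).
Qed.

Lemma trig_poly_periodic c N t : trig_poly c N (t + 1) = trig_poly c N t.
Proof. unfold trig_poly; apply csum_ext; intros m _; now rewrite psi_fun_periodic. Qed.

(** The decay makes the Fourier series converge uniformly to some continuous [G]. Its coefficients
    are those of [g], so [uniqueness] applies to [g - G]. *)
Lemma fourier_inversion g B : ccont g -> (forall t, g (t + 1) = g t) ->
  (forall m, Cmod (fc g m) * (INR m + 1) ^ 2 <= B) -> uniform_sum (fc g) g.
Proof.
  intros Cg Pg HB.
  assert (HM : forall n, rsum (fun k => Cmod (fc g k)) n <= B * 2).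
  { intros n; assert (B0 : 0 <= B).
    { eapply Rle_trans; [|apply (HB 0%nat)]; apply Rmult_le_pos; [apply Cmod_ge_0 | apply pow_le; simpl; lra]. }
    apply Rle_trans with (B * rsum (fun m => / (INR m + 1) ^ 2) n).
    - rewrite <- rsum_scal; apply rsum_le; intros k _.
      assert (P : 0 < (INR k + 1) ^ 2) by (apply pow_lt; assert (Q := pos_INR k); lra).
      apply Rmult_le_reg_r with ((INR k + 1) ^ 2); [exact P|].
      rewrite Rmult_assoc, Rinv_l, Rmult_1_r by lra; apply HB.
    - apply Rmult_le_compat_l; [exact B0 | apply rsum_inv_sq]. }
  assert (L : forall t, exists l, clim (fun N => trig_poly (fc g) N t) l).
  { intros t; apply (csum_abs_cv _ (B * 2)); intros n.
    rewrite (rsum_ext _ (fun k => Cmod (fc g k))); [apply HM|].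
    intros k _; now rewrite Cmod_mult, Cmod_psi, Rmult_1_r. }
  destruct (choice _ L) as [G HG].
  assert (UG := trig_series_uniform _ _ _ HM HG).
  assert (CG := uniform_sum_ccont _ _ UG).
  assert (E : forall t, (g t + (- (1)) * G t)%C = RtoC 0).
  { apply (uniqueness (fun t => g t + (- (1)) * G t)%C).
    - apply ccont_plus; [exact Cg|]; apply ccont_mult; [apply ccont_const | exact CG].
    - intros t; rewrite Pg; do 2 f_equal; apply (clim_unique (fun N => trig_poly (fc g) N t)); [|apply HG].
      intros eps He; destruct (HG (t + 1) eps He) as [N HN]; exists N; intros n Hn.
      rewrite <- trig_poly_periodic; now apply HN.
    - intros m; rewrite (fc_plus g (fun t => (- (1)) * G t)%C), fc_scal, (fc_uniform_limit G (fc g)); auto.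
      + ring.
      + apply ccont_mult; [apply ccont_const | exact CG]. }
  intros eps He; destruct (UG eps He) as [N0 HN]; exists N0; intros N t HN0.
  replace (g t) with (g t + (- (1)) * G t + G t)%C by ring; rewrite E, Cplus_0_l; now apply HN.
Qed.

(** * Smooth functions and their derivatives *)

(** A smooth periodic function together with all its derivatives. Smoothness of a new function is
    proved by exhibiting its tower, which avoids computing with iterated derivatives. *)
Definition ctower (G : nat -> R -> C) : Prop :=
  (forall j, cderive (G j) (G (S j))) /\ (forall j t, G j (t + 1) = G j t).

Lemma cderive_ccont g g' : cderive g g' -> ccont g.
Proof.
  intros D; split; intros t; [apply (ex_derive_continuous (fun s => Re (g s))); exists (Re (g' t))
                             | apply (ex_derive_continuous (fun s => Im (g s))); exists (Im (g' t))]; apply D.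
Qed.

Lemma ctower_ccont G j : ctower G -> ccont (G j).
Proof. intros [D _]; exact (cderive_ccont _ _ (D j)). Qed.

Lemma smooth_ctower (g : smooth_torus) : ctower (torus_deriv (proj1_sig g)).
Proof.
  destruct g as [g [Pg Sg]]; simpl; split.
  - intros j t; split; simpl; apply Derive_correct.
    + exact (proj1 (Sg (S j) t)).
    + exact (proj2 (Sg (S j) t)).
  - intros j t; unfold torus_deriv; apply injective_projections; simpl.
    + rewrite <- Derive_n_comp_trans; apply Derive_n_ext; intros s; now rewrite Pg.
    + rewrite <- Derive_n_comp_trans; apply Derive_n_ext; intros s; now rewrite Pg.
Qed.

Lemma torus_deriv_0 (g : R -> C) : torus_deriv g 0 = g.
Proof. funext t; unfold torus_deriv; simpl; symmetry; apply surjective_pairing. Qed.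

Lemma ctower_Derive_n G : ctower G -> forall j,
  (fun t => Derive_n (fun s => Re (G 0%nat s)) j t) = (fun t => Re (G j t)) /\
  (fun t => Derive_n (fun s => Im (G 0%nat s)) j t) = (fun t => Im (G j t)).
Proof.
  intros [D _]; induction j as [|j [E1 E2]]; [split; reflexivity|]; split;
    funext t; simpl.
  - rewrite (Derive_ext _ (fun s => Re (G j s))) by (intros s; exact (f_equal (fun f => f s) E1)).
    apply is_derive_unique, D.
  - rewrite (Derive_ext _ (fun s => Im (G j s))) by (intros s; exact (f_equal (fun f => f s) E2)).
    apply is_derive_unique, D.
Qed.

Lemma ctower_deriv G j t : ctower G -> torus_deriv (G 0%nat) j t = G j t.
Proof.
  intros H; destruct (ctower_Derive_n G H j) as [E1 E2]; unfold torus_deriv.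
  apply injective_projections; simpl; [exact (f_equal (fun f => f t) E1) | exact (f_equal (fun f => f t) E2)].
Qed.

Lemma ctower_smooth G : ctower G -> smooth_periodic (G 0%nat).
Proof.
  intros H; split; [intros t; apply H|].
  intros [|j] t; [split; exact I|]; destruct (ctower_Derive_n G H j) as [E1 E2]; split; simpl.
  - apply ex_derive_ext with (fun s => Re (G j s)); [intros s; symmetry; exact (f_equal (fun f => f s) E1)|].
    exists (Re (G (S j) t)); apply H.
  - apply ex_derive_ext with (fun s => Im (G j s)); [intros s; symmetry; exact (f_equal (fun f => f s) E2)|].
    exists (Im (G (S j) t)); apply H.
Qed.

Lemma trig_poly_ctower c N :
  ctower (fun j => trig_poly (fun m => c m * omega (- IZR (freq m)) ^ j)%C N).
Proof.
  split.
  - intros j; unfold trig_poly; induction N as [|N IH].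
    + intros t; simpl; split; apply (is_derive_const (V := R_NormedModule)).
    + simpl; apply cderive_plus; [exact IH|].
      eapply cderive_ext; [| |apply (cderive_circle (c N * omega (- IZR (freq N)) ^ j)%C (- IZR (freq N)))];
        intros t; simpl; unfold psi_fun; ring.
  - intros j t; apply trig_poly_periodic.
Qed.

Lemma ctower_lin G H c : ctower G -> ctower H -> ctower (fun j t => G j t + c * H j t)%C.
Proof.
  intros [D P] [D' P']; split.
  - intros j; apply cderive_plus; [apply D|]; intros t; destruct (D' j t) as [A B]; destruct c as [a b]; split.
    + eapply (is_derive_ext (fun s => minus (scal a (Re (H j s))) (scal b (Im (H j s))))); [intros; reflexivity|].
      apply (is_derive_minus (V := R_NormedModule));
        apply (is_derive_scal (fun s => _)); assumption.
    + eapply (is_derive_ext (fun s => plus (scal a (Im (H j s))) (scal b (Re (H j s))))); [intros; reflexivity|].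
      apply (is_derive_plus (V := R_NormedModule));
        apply (is_derive_scal (fun s => _)); assumption.
  - intros j t; now rewrite P, P'.
Qed.

(** Integration by parts, in the form that the derivative of the periodic product of [G j] and the
    exponential has mean [0]. *)
Lemma fc_derivative G j m : ctower G ->
  fc (G (S j)) m = (omega (- IZR (freq m)) * fc (G j) m)%C.
Proof.
  intros H.
  assert (Dc := cderive_circle (RtoC 1) (IZR (freq m))).
  assert (D := cderive_mult _ _ _ _ (proj1 H j) Dc).
  assert (Cj := ctower_ccont G j H); assert (CSj := ctower_ccont G (S j) H).
  assert (C1 := ccont_fc _ m CSj); assert (C2 := ccont_fc _ m Cj).
  apply cmean_derive in D.
  - rewrite (cmean_ext _ (fun s => G (S j) s * circle (IZR (freq m) * s) +
       omega (IZR (freq m)) * (G j s * circle (IZR (freq m) * s)))%C) in D by (intros; ring).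
    rewrite cmean_plus, cmean_scal in D; auto.
    + unfold fc; replace (cmean (fun s => G (S j) s * circle (IZR (freq m) * s))%C)
        with (cmean (fun s => G (S j) s * circle (IZR (freq m) * s))%C
              + omega (IZR (freq m)) * cmean (fun s => G j s * circle (IZR (freq m) * s))%C
              - omega (IZR (freq m)) * cmean (fun s => G j s * circle (IZR (freq m) * s))%C)%C by ring.
      rewrite D; replace (omega (- IZR (freq m))) with (- omega (IZR (freq m)))%C; [ring|].
      unfold omega; rewrite <- Ropp_mult_distr_r, RtoC_opp; ring.
    + apply ccont_mult; [apply ccont_const | exact C2].
  - eapply ccont_ext; [|apply (ccont_plus _ _ C1 (ccont_mult _ _ (ccont_const (omega (IZR (freq m)))) C2))].
    intros t; simpl; ring.
  - intros t; now rewrite (proj2 H j), circle_freq_periodic.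
Qed.

Lemma fc_derivative_n G j m : ctower G ->
  fc (G j) m = (fc (G 0%nat) m * omega (- IZR (freq m)) ^ j)%C.
Proof.
  intros H; induction j as [|j IH]; [simpl; ring|].
  rewrite fc_derivative, IH by exact H; simpl; ring.
Qed.

Lemma Cmod_omega c : Cmod (omega c) = 2 * PI * Rabs c.
Proof.
  unfold omega; rewrite Cmod_mult, Cmod_Ci, Cmod_R, Rmult_1_l, Rabs_mult, Rabs_pos_eq; [reflexivity|].
  assert (P := PI_RGT_0); lra.
Qed.

(** [K] derivatives multiply the coefficient by [(2 pi |freq m|)^K] in modulus, at least [(m + 1)^K]
    for [m >= 1] since [2 pi > 4]. At [m = 0] this factor vanishes for [K > 0], and the bound on the
    function itself is used. *)
Lemma fc_decay G K B m : ctower G -> (forall t, Cmod (G 0%nat t) <= B) -> (forall t, Cmod (G K t) <= B) ->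
  Cmod (fc (G 0%nat) m) * (INR m + 1) ^ K <= 2 * B.
Proof.
  intros H H0 HK; destruct m as [|m].
  - simpl INR; rewrite Rplus_0_l, pow1, Rmult_1_r; apply fc_bound; [now apply ctower_ccont | exact H0].
  - apply Rle_trans with (Cmod (fc (G K) (S m))); [|apply fc_bound; [now apply ctower_ccont | exact HK]].
    rewrite (fc_derivative_n G K), Cmod_mult, Cmod_pow by exact H.
    apply Rmult_le_compat_l; [apply Cmod_ge_0|]; apply pow_incr; split.
    + assert (P := pos_INR (S m)); lra.
    + rewrite Cmod_omega, Rabs_Ropp; assert (Q := freq_ge (S m) ltac:(lia)).
      assert (P := PI2_1); assert (A := Rabs_pos (IZR (freq (S m)))); nra.
Qed.

Lemma ctower_bounded G j : ctower G -> exists B, forall t, Cmod (G j t) <= B.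
Proof.
  intros H; assert (Cj := ctower_ccont G j H).
  destruct (periodic_bounded (fun t => Re (G j t)) (proj1 Cj)) as [B1 H1].
  { intros t; now rewrite (proj2 H). }
  destruct (periodic_bounded (fun t => Im (G j t)) (proj2 Cj)) as [B2 H2].
  { intros t; now rewrite (proj2 H). }
  exists (B1 + B2); intros t; eapply Rle_trans; [apply Cmod_le_sum|].
  apply Rplus_le_compat; auto.
Qed.

Lemma fc_decay_ex G K : ctower G -> exists B, 0 <= B /\ forall m, Cmod (fc (G 0%nat) m) * (INR m + 1) ^ K <= B.
Proof.
  intros H; destruct (ctower_bounded G 0 H) as [B0 H0], (ctower_bounded G K H) as [B1 H1].
  assert (P0 := Rle_trans _ _ _ (Cmod_ge_0 _) (H0 0)); assert (P1 := Rle_trans _ _ _ (Cmod_ge_0 _) (H1 0)).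
  exists (2 * (B0 + B1)); split; [lra|]; intros m; apply fc_decay; auto; intros t.
  - specialize (H0 t); lra.
  - specialize (H1 t); lra.
Qed.

Lemma ctower_shift G j : ctower G -> ctower (fun i => G (i + j)%nat).
Proof. intros [D P]; split; [intros i; exact (D (i + j)%nat) | intros i; apply P]. Qed.

Lemma ctower_inversion G j : ctower G ->
  uniform_sum (fun m => fc (G 0%nat) m * omega (- IZR (freq m)) ^ j)%C (G j).
Proof.
  intros H; destruct (fc_decay_ex (fun i => G (i + j)%nat) 2 (ctower_shift G j H)) as [B [_ HB]].
  assert (U := fourier_inversion (G j) B (ctower_ccont G j H) (proj2 H j) HB).
  intros eps He; destruct (U eps He) as [N0 HN]; exists N0; intros N t HN0.
  specialize (HN N t HN0); unfold trig_poly in *.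
  erewrite csum_ext; [exact HN|]; intros m _; simpl; now rewrite (fc_derivative_n G j).
Qed.

(** * Distributions and their Fourier coefficients *)

Lemma psi_ctower m : ctower (fun j s => omega (- IZR (freq m)) ^ j * psi_fun m s)%C.
Proof.
  split.
  - intros j; eapply cderive_ext; [| |apply (cderive_circle (omega (- IZR (freq m)) ^ j)%C (- IZR (freq m)))];
      intros t; simpl; unfold psi_fun; ring.
  - intros j t; now rewrite psi_fun_periodic.
Qed.

Lemma psi_smooth m : smooth_periodic (psi_fun m).
Proof.
  replace (psi_fun m) with (fun s => omega (- IZR (freq m)) ^ 0 * psi_fun m s)%C.
  - exact (ctower_smooth _ (psi_ctower m)).
  - funext s; simpl; ring.
Qed.

Definition psi (m : nat) : smooth_torus := exist _ (psi_fun m) (psi_smooth m).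

Fixpoint smooth_sum (c : nat -> C) (N : nat) : smooth_torus :=
  match N with
  | O => zero
  | S N => plus (smooth_sum c N) (scal (c N : C_Ring) (psi N))
  end.

Lemma smooth_sum_eq c N t : proj1_sig (smooth_sum c N) t = trig_poly c N t.
Proof.
  induction N as [|N IH]; [reflexivity|].
  change (proj1_sig (smooth_sum c N) t + c N * psi_fun N t = trig_poly c N t + c N * psi_fun N t)%C.
  now rewrite IH.
Qed.

Lemma smooth_sum_deriv c N j t :
  torus_deriv (proj1_sig (smooth_sum c N)) j t =
  trig_poly (fun m => c m * omega (- IZR (freq m)) ^ j)%C N t.
Proof.
  assert (E : proj1_sig (smooth_sum c N) = trig_poly (fun m => c m * omega (- IZR (freq m)) ^ 0)%C N).
  { funext s; rewrite smooth_sum_eq.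
    apply csum_ext; intros m _; simpl; ring. }
  rewrite E; exact (ctower_deriv _ j t (trig_poly_ctower c N)).
Qed.

Lemma smooth_torus_eq (g h : smooth_torus) : (forall t, proj1_sig g t = proj1_sig h t) -> g = h.
Proof. intros E; apply sub_eq, functional_extensionality, E. Qed.

Definition sfc (g : smooth_torus) (m : nat) : C := fc (proj1_sig g) m.

Lemma smooth_ccont (g : smooth_torus) : ccont (proj1_sig g).
Proof.
  assert (H := ctower_ccont _ 0 (smooth_ctower g)); now rewrite torus_deriv_0 in H.
Qed.

(** The Fourier series converges in the Frechet topology: by [ctower_inversion] every derivative of
    the partial sums converges uniformly, and a neighbourhood tests only finitely many of them. *)
Lemma smooth_sum_converges (g : smooth_torus) (P : smooth_torus -> Prop) :
  smooth_nbhs g P -> exists N0, forall N, (N0 <= N)%nat -> P (smooth_sum (sfc g) N).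
Proof.
  intros [K [d HP]].
  assert (Pd := cond_pos d).
  assert (L : forall K, exists N0, forall N k t, (N0 <= N)%nat -> (k <= K)%nat ->
    Cmod (torus_deriv (proj1_sig (smooth_sum (sfc g) N)) k t - torus_deriv (proj1_sig g) k t)%C < d).
  { assert (L1 : forall k, exists N0, forall N t, (N0 <= N)%nat ->
      Cmod (torus_deriv (proj1_sig (smooth_sum (sfc g) N)) k t - torus_deriv (proj1_sig g) k t)%C < d).
    { intros k; destruct (ctower_inversion _ k (smooth_ctower g) (d / 2)) as [N0 HN]; [lra|].
      exists N0; intros N t HN0; specialize (HN N t HN0).
      rewrite torus_deriv_0 in HN.
      rewrite smooth_sum_deriv; unfold sfc.
      rewrite <- Cmod_opp; apply Rle_lt_trans with (d / 2); [|lra].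
      eapply Rle_trans; [|exact HN]; apply Req_le; f_equal; ring. }
    induction K0 as [|K0 [N1 H1]].
    - destruct (L1 0%nat) as [N0 H0]; exists N0; intros N k t HN Hk.
      replace k with 0%nat by lia; now apply H0.
    - destruct (L1 (S K0)) as [N2 H2]; exists (Nat.max N1 N2); intros N k t HN Hk.
      destruct (Nat.eq_dec k (S K0)) as [->|D]; [apply H2; lia | apply H1; lia]. }
  destruct (L K) as [N0 H0]; exists N0; intros N HN; apply HP; intros k t Hk; now apply H0.
Qed.

Section Dist.
Context {Y : CompleteNormedModule C_AbsRing}.
Implicit Types (f : smooth_torus -> Y) (h : nat -> Y).

Lemma dist_plus f g g' : distribution Y f -> f (plus g g') = vadd (f g) (f g').
Proof. intros [H _]; apply H. Qed.

Lemma dist_scal f c (g : smooth_torus) : distribution Y f -> f (scal (c : C_Ring) g) = vsc c (f g).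
Proof. intros [_ [H _]]; apply H. Qed.

Lemma dist_zero f : distribution Y f -> f zero = v0.
Proof.
  intros H; replace (zero : smooth_torus) with (scal (RtoC 0 : C_Ring) (zero : smooth_torus)).
  - rewrite (dist_scal f (RtoC 0) zero H); apply vsc_0.
  - apply smooth_torus_eq; intros t; change (RtoC 0 * RtoC 0 = RtoC 0)%C; ring.
Qed.

Lemma dist_smooth_sum f c N : distribution Y f ->
  f (smooth_sum c N) = vsum (fun m => vsc (c m) (f (psi m))) N.
Proof.
  intros H; induction N as [|N IH]; simpl; [now apply dist_zero|].
  rewrite (dist_plus f _ _ H), IH, (dist_scal f _ _ H); reflexivity.
Qed.

(** Continuity carries [f] through the Fourier series of [g]; hence a distribution is determined by
    its values on the [psi m]. *)
Lemma dist_fourier f g : distribution Y f ->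
  vseries (fun m => vsc (sfc g m) (f (psi m))) (f g).
Proof.
  intros H eps He; assert (H3 := proj2 (proj2 H)).
  assert (P : 0 < eps / @norm_factor _ Y)
    by (apply Rdiv_lt_0_compat; [exact He | apply norm_factor_gt_0]).
  destruct (smooth_sum_converges g _ (proj1 (filterlim_locally _ _) (H3 g) (mkposreal _ P))) as [N0 HN].
  exists N0; intros N HN0; specialize (HN N HN0).
  rewrite dist_smooth_sum in HN by exact H.
  left; exact (vn_of_ball _ _ eps P HN).
Qed.

Definition poly_growth h : Prop :=
  exists C k, 0 <= C /\ forall m, vn (h m) <= C * (INR m + 1) ^ k.

(** Continuity at [0] yields a neighbourhood, defined by [K] derivatives, on which [f] is smaller
    than [1]. A multiple of [psi m] by a factor of order [(m + 1)^(-K)] lies in it, and homogeneity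
    does the rest. *)
Lemma dist_growth f : distribution Y f -> poly_growth (fun m => f (psi m)).
Proof.
  intros H; assert (H3 := proj2 (proj2 H)).
  assert (P : 0 < 1 / @norm_factor _ Y)
    by (apply Rdiv_lt_0_compat; [lra | apply norm_factor_gt_0]).
  destruct (proj1 (filterlim_locally _ _) (H3 zero) (mkposreal _ P)) as [K [d HK]].
  assert (Pd := cond_pos d); assert (PP := PI_RGT_0); assert (P2 := PI2_1).
  exists (2 / d * (2 * PI) ^ K), K; split.
  { apply Rmult_le_pos; [apply Rdiv_le_0_compat; lra | apply pow_le; lra]. }
  intros m.
  set (w := 2 * PI * (INR m + 1)).
  assert (Pm := pos_INR m).
  assert (W : 1 <= w) by (unfold w; nra).
  assert (Wk : 0 < w ^ K) by (apply pow_lt; lra).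
  (* [w >= 1] bounds [2 pi |freq m|], so all derivatives of [l psi m] up to order [K] are at most
     [l w^K = d / 2]. *)
  set (l := d / (2 * w ^ K)).
  assert (Pl : 0 < l) by (apply Rdiv_lt_0_compat; lra).
  assert (Z : torus_deriv (proj1_sig (zero : smooth_torus)) = fun _ _ => RtoC 0).
  { funext k; funext t.
    unfold torus_deriv; simpl; apply injective_projections; simpl.
    - destruct k; [reflexivity | exact (Derive_n_const k 0 t)].
    - destruct k; [reflexivity | exact (Derive_n_const k 0 t)]. }
  assert (T : forall k t, torus_deriv (proj1_sig (scal (RtoC l : C_Ring) (psi m))) k t
     = (RtoC 0 + RtoC l * (omega (- IZR (freq m)) ^ k * psi_fun m t))%C).
  { intros k t.
    assert (T0 : ctower (fun _ _ => RtoC 0)).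
    { split; [|reflexivity]; intros j s; split; apply (is_derive_const (V := R_NormedModule)). }
    rewrite <- (ctower_deriv _ k t (ctower_lin _ _ (RtoC l) T0 (psi_ctower m))); f_equal.
    funext s.
    change (RtoC l * psi_fun m s = RtoC 0 + RtoC l * (RtoC 1 * psi_fun m s))%C; ring. }
  specialize (HK (scal (RtoC l : C_Ring) (psi m))).
  assert (Q : ball (f zero) (1 / @norm_factor _ Y) (f (scal (RtoC l : C_Ring) (psi m)))).
  { apply HK; intros k t Hk; rewrite T, Z.
    replace (RtoC 0 + RtoC l * (omega (- IZR (freq m)) ^ k * psi_fun m t) - RtoC 0)%C
      with (RtoC l * (omega (- IZR (freq m)) ^ k * psi_fun m t))%C by ring.
    rewrite !Cmod_mult, Cmod_R, Cmod_psi, Rmult_1_r, Cmod_pow, Cmod_omega, Rabs_Ropp, Rabs_pos_eq by lra.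
    apply Rle_lt_trans with (l * w ^ K).
    - apply Rmult_le_compat_l; [lra|].
      apply Rle_trans with (w ^ k); [|now apply Rle_pow].
      apply pow_incr; split; [apply Rmult_le_pos; [lra | apply Rabs_pos]|].
      unfold w; apply Rmult_le_compat_l; [lra | apply freq_le].
    - unfold l; replace (d / (2 * w ^ K) * w ^ K) with (d / 2) by (field; lra); lra. }
  assert (B := vn_of_ball _ _ 1 P Q).
  rewrite (dist_zero f H), (dist_scal f _ _ H), vsub_0_r, vn_sc, Cmod_R, Rabs_pos_eq in B by lra.
  apply Rmult_le_reg_l with l; [exact Pl|].
  replace (l * (2 / d * (2 * PI) ^ K * (INR m + 1) ^ K)) with 1.
  - left; exact B.
  - unfold l, w; rewrite Rpow_mult_distr; field.
    repeat split; try (apply pow_nonzero; lra); lra.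
Qed.

(** The coefficients must decay two powers faster than [h] grows: the surplus [1 / (m + 1)^2] is
    what is summed. *)
Lemma pairing_abs h C k (c : nat -> Complex.C) B : 0 <= C -> 0 <= B ->
  (forall m, vn (h m) <= C * (INR m + 1) ^ k) ->
  (forall m, Cmod (c m) * (INR m + 1) ^ (k + 2) <= B) ->
  forall n, rsum (fun m => vn (vsc (c m) (h m))) n <= 2 * B * C.
Proof.
  intros HC HB Hh Hc n.
  apply Rle_trans with (B * C * rsum (fun m => / (INR m + 1) ^ 2) n).
  - rewrite <- rsum_scal; apply rsum_le; intros m _; rewrite vn_sc.
    assert (P : 0 < INR m + 1) by (assert (Q := pos_INR m); lra).
    assert (P2 : 0 < (INR m + 1) ^ 2) by now apply pow_lt.
    assert (Pk : 0 < (INR m + 1) ^ k) by now apply pow_lt.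
    apply Rmult_le_reg_r with ((INR m + 1) ^ 2); [exact P2|].
    rewrite Rmult_assoc, (Rmult_assoc (B * C)), Rinv_l, Rmult_1_r by lra.
    apply Rle_trans with (C * (Cmod (c m) * (INR m + 1) ^ (k + 2))).
    + rewrite pow_add.
      replace (Cmod (c m) * (vn (h m) * (INR m + 1) ^ 2)) with (vn (h m) * (Cmod (c m) * (INR m + 1) ^ 2)) by ring.
      replace (C * (Cmod (c m) * ((INR m + 1) ^ k * (INR m + 1) ^ 2)))
        with (C * (INR m + 1) ^ k * (Cmod (c m) * (INR m + 1) ^ 2)) by ring.
      apply Rmult_le_compat_r; [|apply Hh].
      apply Rmult_le_pos; [apply Cmod_ge_0 | lra].
    + rewrite (Rmult_comm B); apply Rmult_le_compat_l; [exact HC | apply Hc].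
  - replace (2 * B * C) with (B * C * 2) by ring.
    apply Rmult_le_compat_l; [now apply Rmult_le_pos | apply rsum_inv_sq].
Qed.

Definition dist_of h (g : smooth_torus) : Y := vtotal (fun m => vsc (sfc g m) (h m)).

Lemma dist_of_series h g : poly_growth h -> vseries (fun m => vsc (sfc g m) (h m)) (dist_of h g).
Proof.
  intros [C [k [HC Hh]]]; apply vtotal_correct.
  destruct (fc_decay_ex _ (k + 2) (smooth_ctower g)) as [B [HB Hc]].
  rewrite torus_deriv_0 in Hc.
  apply (vseries_ex _ (2 * B * C)); now apply (pairing_abs h C k).
Qed.

(** Linearity passes through the series. For continuity, smallness of the derivatives of [g' - g] up
    to order [k + 2] makes its coefficients small with enough decay to be paired with [h], by
    [fc_decay] and [pairing_abs]. *)
Lemma dist_of_distribution h : poly_growth h -> distribution Y (dist_of h).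
Proof.
  intros Hh; split; [|split].
  - intros g g'; apply (vseries_unique _ _ _ (dist_of_series h (plus g g') Hh)).
    refine (vseries_ext _ _ _ _ (vseries_add _ _ _ _ (dist_of_series h g Hh) (dist_of_series h g' Hh))).
    intros m; rewrite <- vsc_plus_l; f_equal; unfold sfc.
    symmetry; apply (fc_plus (proj1_sig g) (proj1_sig g')); apply smooth_ccont.
  - intros c g; apply (vseries_unique _ _ _ (dist_of_series h (scal (c : C_Ring) g) Hh)).
    refine (vseries_ext _ _ _ _ (vseries_sc c _ _ (dist_of_series h g Hh))).
    intros m; rewrite vsc_assoc; f_equal; unfold sfc.
    symmetry; apply (fc_scal c (proj1_sig g)), smooth_ccont.
  - intros g; apply filterlim_locally; intros eps.
    destruct Hh as [C [k [HC Hh]]].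
    assert (Pe := cond_pos eps).
    assert (Pd : 0 < eps / (8 * (C + 1))) by (apply Rdiv_lt_0_compat; lra).
    exists (k + 2)%nat, (mkposreal _ Pd); intros g' Hg'; simpl in Hg'.
    apply ball_of_vn.
    set (G := fun j t => (torus_deriv (proj1_sig g') j t + (- (1)) * torus_deriv (proj1_sig g) j t)%C).
    assert (TG : ctower G) by (apply ctower_lin; apply smooth_ctower).
    assert (BG : forall j t, (j <= k + 2)%nat -> Cmod (G j t) <= eps / (8 * (C + 1))).
    { intros j t Hj; left; unfold G.
      replace (torus_deriv (proj1_sig g') j t + (- (1)) * torus_deriv (proj1_sig g) j t)%C
        with (torus_deriv (proj1_sig g') j t - torus_deriv (proj1_sig g) j t)%C by ring.
      now apply Hg'. }
    assert (DG : forall m, Cmod (fc (G 0%nat) m) * (INR m + 1) ^ (k + 2) <= 2 * (eps / (8 * (C + 1)))).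
    { intros m; apply fc_decay; [exact TG | |]; intros t; apply BG; lia. }
    assert (EG : forall m, fc (G 0%nat) m = (sfc g' m + (- (1)) * sfc g m)%C).
    { intros m; unfold G; rewrite !torus_deriv_0.
      assert (Cg := smooth_ccont g); assert (Cg' := smooth_ccont g').
      rewrite (fc_plus (proj1_sig g') (fun t => (- (1)) * proj1_sig g t)%C), fc_scal; auto.
      apply ccont_mult; [apply ccont_const | exact Cg]. }
    assert (Hh' : poly_growth h) by (exists C, k; auto).
    assert (S1 : vseries (fun m => vsc (fc (G 0%nat) m) (h m)) (vsub (dist_of h g') (dist_of h g))).
    { refine (vseries_ext _ _ _ _ (vseries_add _ _ _ _ (dist_of_series h g' Hh')
                (vseries_sc (Copp (RtoC 1)) _ _ (dist_of_series h g Hh')))).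
      intros m; rewrite EG; vring. }
    apply Rle_lt_trans with (2 * (2 * (eps / (8 * (C + 1)))) * C).
    + apply (vseries_norm_le _ _ _ S1); intros n.
      apply (pairing_abs h C k); auto; lra.
    + apply Rmult_lt_reg_r with (8 * (C + 1)); [lra|].
      replace (2 * (2 * (eps / (8 * (C + 1)))) * C * (8 * (C + 1))) with (4 * C * eps) by (field; lra).
      nra.
Qed.

Lemma dist_of_psi h m : poly_growth h -> dist_of h (psi m) = h m.
Proof.
  intros Hh; apply (vseries_unique _ _ _ (dist_of_series h (psi m) Hh)).
  assert (E : forall k, sfc (psi m) k = if Nat.eqb m k then RtoC 1 else RtoC 0) by exact (fc_psi m).
  replace (h m) with (vsc (sfc (psi m) m) (h m)) by (rewrite E, Nat.eqb_refl; apply vsc_1).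
  apply (vseries_single (fun k => vsc (sfc (psi m) k) (h k))); intros k Hk.
  rewrite E; replace (Nat.eqb m k) with false by (symmetry; apply Nat.eqb_neq; lia); apply vsc_0.
Qed.

Lemma dist_of_coefs f : distribution Y f -> dist_of (fun m => f (psi m)) = f.
Proof.
  intros H; funext g.
  apply (vseries_unique _ _ _ (dist_of_series _ g (dist_growth f H))).
  now apply dist_fourier.
Qed.

(** * Fourier coefficients of the Poisson kernels *)

(* [a], [b] and [c] are the weights of the zero, positive and negative frequencies. *)
Definition kernel_weight (a b c : C) (m : nat) : C :=
  if Nat.even m then (if Nat.eqb m 0 then a else b) else c.

Lemma kernel_weight_even a b c k : kernel_weight a b c (2 * k) = if Nat.eqb k 0 then a else b.
Proof. unfold kernel_weight; rewrite Nat.even_even; destruct k; reflexivity. Qed.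
Lemma kernel_weight_odd a b c k : kernel_weight a b c (2 * k + 1) = c.
Proof. unfold kernel_weight; now rewrite Nat.even_odd. Qed.

(** The coefficient at [psi m] of the test function [s => k (t - s)], when [k] is the kernel of
    radius [r] with these weights; see [kernel_coef_conv]. *)
Definition kernel_coef (a b c : C) (r t : R) (m : nat) : C :=
  (kernel_weight a b c m * RtoC (r ^ afreq m) * circle (IZR (freq m) * t))%C.

Lemma kernel_coef_even a b c r t k :
  kernel_coef a b c r t (2 * k) = ((if Nat.eqb k 0 then a else b) * (RtoC r * circle t) ^ k)%C.
Proof.
  unfold kernel_coef; rewrite kernel_weight_even, afreq_even, freq_even, <- INR_IZR_INZ, circle_nat.
  rewrite RtoC_pow, Cpow_mult_l; ring.
Qed.

Lemma kernel_coef_odd a b c r t k :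
  kernel_coef a b c r t (2 * k + 1) = (c * (RtoC r * circle (- t)) ^ S k)%C.
Proof.
  unfold kernel_coef; rewrite kernel_weight_odd, afreq_odd, freq_odd, opp_IZR, <- INR_IZR_INZ.
  replace (- INR (S k) * t) with (INR (S k) * - t) by ring.
  rewrite circle_nat, RtoC_pow, Cpow_mult_l; ring.
Qed.

Lemma one_minus_nz (w : C) : Cmod w < 1 -> (1 - w)%C <> RtoC 0.
Proof.
  intros H E; assert (w = RtoC 1) as -> by (replace w with (1 - (1 - w))%C by ring; rewrite E; ring).
  rewrite Cmod_1 in H; lra.
Qed.

(** Nonnegative and negative frequencies alternate, so a partial sum of even length is a pair of
    truncated geometric series with a closed form. The limit along this subsequence suffices. *)
Lemma kernel_series a b c r t l : 0 <= r < 1 ->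
  clim (csum (kernel_coef a b c r t)) l ->
  l = (a + b * (RtoC r * circle t) / (1 - RtoC r * circle t)
         + c * (RtoC r * circle (- t)) / (1 - RtoC r * circle (- t)))%C.
Proof.
  intros Hr Hl.
  set (w := (RtoC r * circle t)%C); set (v := (RtoC r * circle (- t))%C).
  assert (Hw : Cmod w = r) by (unfold w; rewrite Cmod_mult, Cmod_circle, Cmod_R, Rabs_pos_eq; lra).
  assert (Hv : Cmod v = r) by (unfold v; rewrite Cmod_mult, Cmod_circle, Cmod_R, Rabs_pos_eq; lra).
  assert (Nw := one_minus_nz w ltac:(lra)); assert (Nv := one_minus_nz v ltac:(lra)).
  assert (E : forall N, csum (kernel_coef a b c r t) (2 * S N) =
    (a + b * w / (1 - w) + c * v / (1 - v) - (w ^ S N * (b / (1 - w)) + v ^ S N * (c * v / (1 - v))))%C).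
  { induction N as [|N IH].
    - assert (E0 := kernel_coef_even a b c r t 0); assert (E1 := kernel_coef_odd a b c r t 0).
      change (2 * 0)%nat with 0%nat in E0; change (2 * 0 + 1)%nat with 1%nat in E1.
      change (2 * 1)%nat with 2%nat; cbn [csum]; rewrite E0, E1.
      fold w v; simpl; field; auto.
    - replace (2 * S (S N))%nat with (S (S (2 * S N))) by lia; cbn [csum]; rewrite IH.
      replace (S (2 * S N)) with (2 * S N + 1)%nat by lia.
      rewrite kernel_coef_even, kernel_coef_odd; fold w v; simpl Nat.eqb; cbn iota.
      simpl; field; auto. }
  apply (clim_unique (fun N => csum (kernel_coef a b c r t) (2 * S N))).
  - intros eps He; destruct (Hl eps He) as [N HN]; exists N; intros n Hn; apply HN; lia.
  - intros eps He.
    set (A := Cmod (b / (1 - w))%C + Cmod (c * v / (1 - v))%C + 1).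
    assert (PA : 0 < A).
    { unfold A; assert (Q := Cmod_ge_0 (b / (1 - w))%C); assert (Q' := Cmod_ge_0 (c * v / (1 - v))%C); lra. }
    destruct (pow_lt_1_zero r ltac:(rewrite Rabs_pos_eq; lra) (eps / A)) as [N HN].
    { now apply Rdiv_lt_0_compat. }
    exists N; intros n Hn; rewrite E.
    match goal with |- Cmod (?x - ?y - ?x)%C <= _ => replace (x - y - x)%C with (- y)%C by ring end.
    rewrite Cmod_opp; eapply Rle_trans; [apply Cmod_triangle|].
    rewrite (Cmod_mult (w ^ S n)), (Cmod_mult (v ^ S n)), !Cmod_pow, Hw, Hv.
    specialize (HN (S n) ltac:(lia)); rewrite Rabs_pos_eq in HN by (apply pow_le; lra).
    assert (P0 : 0 <= r ^ S n) by (apply pow_le; lra).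
    apply Rle_trans with (r ^ S n * A).
    + unfold A; nra.
    + apply Rle_trans with (eps / A * A); [apply Rmult_le_compat_r; lra|].
      apply Req_le; field; lra.
Qed.

Lemma kernel_coef_summable a b c r t : 0 <= r < 1 ->
  exists M, forall n, rsum (fun m => Cmod (kernel_coef a b c r t m)) n <= M.
Proof.
  intros Hr.
  set (A := Cmod a + Cmod b + Cmod c).
  assert (Qa := Cmod_ge_0 a); assert (Qb := Cmod_ge_0 b); assert (Qc := Cmod_ge_0 c).
  assert (Pos : forall m, 0 <= Cmod (kernel_coef a b c r t m)) by (intros; apply Cmod_ge_0).
  assert (H : forall N, rsum (fun m => Cmod (kernel_coef a b c r t m)) (2 * N) <= 2 * A * rsum (fun k => r ^ k) N).
  { induction N as [|N IH]; [simpl; lra|].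
    replace (2 * S N)%nat with (S (S (2 * N))) by lia; cbn [rsum].
    replace (S (2 * N)) with (2 * N + 1)%nat by lia.
    rewrite kernel_coef_even, kernel_coef_odd, !Cmod_mult, !Cmod_pow, !Cmod_mult, !Cmod_circle, Cmod_R, Rabs_pos_eq by lra.
    rewrite !Rmult_1_r; assert (P : 0 <= r ^ N) by (apply pow_le; lra).
    assert (I : Cmod (if Nat.eqb N 0 then a else b) <= A) by (unfold A; destruct (Nat.eqb N 0); lra).
    assert (I2 : Cmod c <= A) by (unfold A; lra).
    assert (I3 : Cmod c * r ^ S N <= A * r ^ N).
    { simpl; rewrite <- Rmult_assoc; apply Rmult_le_compat_r; [exact P|]; nra. }
    assert (I4 : Cmod (if Nat.eqb N 0 then a else b) * r ^ N <= A * r ^ N) by (apply Rmult_le_compat_r; lra).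
    lra. }
  exists (2 * A * / (1 - r)); intros n.
  apply Rle_trans with (rsum (fun m => Cmod (kernel_coef a b c r t m)) (2 * n)).
  - apply rsum_mono; [exact Pos | lia].
  - eapply Rle_trans; [apply H|]; apply Rmult_le_compat_l; [unfold A; lra | now apply rsum_geom].
Qed.

Lemma kernel_coef_conv a b c r t s m :
  (kernel_coef a b c r t m * psi_fun m s = kernel_coef a b c r (t - s) m)%C.
Proof.
  unfold kernel_coef, psi_fun; rewrite <- Cmult_assoc, <- circle_add; do 2 f_equal; ring.
Qed.

(** The reflected kernel is the uniform sum of the trigonometric series with coefficients
    [kernel_coef], which are therefore its Fourier coefficients, and [dist_fourier] applies. *)
Lemma convolution_series (k : R -> R) (Hk : kernel k) a b c r f t : 0 <= r < 1 ->
  (forall s, RtoC (k s) = (a + b * (RtoC r * circle s) / (1 - RtoC r * circle s)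
         + c * (RtoC r * circle (- s)) / (1 - RtoC r * circle (- s)))%C) ->
  distribution Y f ->
  vseries (fun m => vsc (kernel_coef a b c r t m) (f (psi m))) (convolution Y k Hk f t).
Proof.
  intros Hr E Hf; unfold convolution.
  refine (vseries_ext _ _ _ _ (dist_fourier f (kernel_test k Hk t) Hf)).
  intros m; f_equal; unfold sfc; apply fc_uniform_limit; [apply smooth_ccont|].
  destruct (kernel_coef_summable a b c r t Hr) as [M HM].
  apply (trig_series_uniform _ M); [exact HM|]; intros s; simpl; rewrite E.
  assert (Ex : exists l, clim (csum (kernel_coef a b c r (t - s))) l).
  { destruct (kernel_coef_summable a b c r (t - s) Hr) as [M' HM']; now apply (csum_abs_cv _ M'). }
  destruct Ex as [l Hl]; rewrite <- (kernel_series _ _ _ _ _ _ Hr Hl).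
  intros eps He; destruct (Hl eps He) as [N HN]; exists N; intros n Hn; specialize (HN n Hn).
  unfold trig_poly; rewrite (csum_ext _ (kernel_coef a b c r (t - s))); [exact HN|].
  intros j _; apply kernel_coef_conv.
Qed.

(** The Herglotz function is [1 + 2 q] with [q = w / (1 - w)], and [v] is the conjugate of [w]. Its
    real and imaginary parts are [1 + q + Cconj q] and [- Ci (q - Cconj q)]. *)
Lemma herglotz_split r s : 0 <= r < 1 ->
  let w := (RtoC r * circle s)%C in let v := (RtoC r * circle (- s))%C in
  RtoC (poisson r s) = (1 + 1 * w / (1 - w) + 1 * v / (1 - v))%C /\
  RtoC (conj_poisson r s) = (0 + (- Ci) * w / (1 - w) + Ci * v / (1 - v))%C.
Proof.
  intros Hr w v.
  assert (Hw : Cmod w < 1) by (unfold w; rewrite Cmod_mult, Cmod_circle, Cmod_R, Rabs_pos_eq; lra).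
  assert (Nw := one_minus_nz w Hw).
  set (H := herglotz r s).
  assert (EH : H = (1 + 2 * (w / (1 - w)))%C) by (unfold H, herglotz; fold w; field; exact Nw).
  assert (Ev : v = Cconj w).
  { unfold v, w, circle; replace (2 * PI * - s) with (- (2 * PI * s)) by ring.
    rewrite cos_neg, sin_neg; apply injective_projections; simpl; ring. }
  assert (Nv : (1 - v)%C <> RtoC 0).
  { apply one_minus_nz; rewrite Ev, Cmod_conj; exact Hw. }
  assert (Ec : Cconj (w / (1 - w))%C = (v / (1 - v))%C).
  { unfold Cdiv; rewrite Cmult_conj, Cinv_conj by exact Nw; rewrite <- Ev; do 2 f_equal.
    unfold Cminus; rewrite Cplus_conj, Copp_conj, <- Ev; f_equal; apply injective_projections; simpl; ring. }
  set (q := (w / (1 - w))%C) in *.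
  replace (1 * w / (1 - w))%C with q by (unfold q; field; exact Nw).
  replace (- Ci * w / (1 - w))%C with (- Ci * q)%C by (unfold q; field; exact Nw).
  replace (1 * v / (1 - v))%C with (Cconj q) by (rewrite Ec; field; exact Nv).
  replace (Ci * v / (1 - v))%C with (Ci * Cconj q)%C by (rewrite Ec; field; exact Nv).
  unfold poisson, conj_poisson; fold H; rewrite EH; destruct q as [x y]; split;
    apply injective_projections; simpl; ring.
Qed.

Lemma poisson_series r Hr f t : distribution Y f ->
  vseries (fun m => vsc (kernel_coef 1 1 1 r t m) (f (psi m)))
    (convolution Y (poisson r) (poisson_kernel r Hr) f t).
Proof. intros Hf; apply convolution_series; [exact Hr | intros s; apply (herglotz_split r s Hr) | exact Hf]. Qed.

Lemma conj_poisson_series r Hr f t : distribution Y f ->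
  vseries (fun m => vsc (kernel_coef 0 (- Ci) Ci r t m) (f (psi m)))
    (convolution Y (conj_poisson r) (conj_poisson_kernel r Hr) f t).
Proof. intros Hf; apply convolution_series; [exact Hr | intros s; apply (herglotz_split r s Hr) | exact Hf]. Qed.

End Dist.

(** * Comparison of the two spaces *)

Lemma linear_geom_bounded r : 0 <= r < 1 -> exists M, 0 <= M /\ forall m, (INR m + 1) * r ^ m <= M.
Proof.
  intros Hr; destruct (Rle_lt_or_eq_dec 0 r (proj1 Hr)) as [Pr|<-].
  - set (x := / r - 1).
    assert (Px : 0 < x).
    { unfold x; assert (1 < / r); [|lra]; rewrite <- Rinv_1; apply Rinv_lt_contravar; lra. }
    assert (Ix := Rinv_0_lt_compat x Px).
    exists (1 + / x); split; [lra|]; intros m.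
    assert (B := poly m x Px); replace (1 + x) with (/ r) in B by (unfold x; ring).
    assert (Pm : 0 < r ^ m) by now apply pow_lt.
    rewrite pow_inv in B; assert (Q := pos_INR m).
    assert (E : r ^ m * (1 + INR m * x) <= 1).
    { apply (Rmult_le_compat_l (r ^ m)) in B; [|lra]; rewrite Rinv_r in B; lra. }
    assert (L : INR m + 1 <= (1 + / x) * (1 + INR m * x)).
    { replace ((1 + / x) * (1 + INR m * x)) with (1 + INR m * x + / x + INR m) by (field; lra).
      assert (0 <= INR m * x) by (apply Rmult_le_pos; lra); lra. }
    apply Rle_trans with ((1 + / x) * (1 + INR m * x) * r ^ m); [apply Rmult_le_compat_r; lra|].
    replace ((1 + / x) * (1 + INR m * x) * r ^ m) with ((1 + / x) * (r ^ m * (1 + INR m * x))) by ring.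
    rewrite <- (Rmult_1_r (1 + / x)) at 2; apply Rmult_le_compat_l; lra.
  - exists 1; split; [lra|]; intros [|m]; simpl; lra.
Qed.

Lemma sqrt_unit r : 0 <= r < 1 -> 0 <= sqrt r < 1 /\ r = sqrt r * sqrt r.
Proof.
  intros Hr; split; [split; [apply sqrt_pos|]; rewrite <- sqrt_1; apply sqrt_lt_1; lra|].
  rewrite sqrt_sqrt; lra.
Qed.

Lemma Rinv_le_INR p : 0 < p -> exists k, / p <= INR k.
Proof.
  intros Hp; destruct (archimed_cor1 p Hp) as [k [Hk1 Hk2]]; exists k.
  assert (Pk : 0 < / INR k) by (apply Rinv_0_lt_compat, lt_0_INR; exact Hk2).
  rewrite <- (Rinv_inv (INR k)); apply Rinv_le_contravar; lra.
Qed.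

(** Write [r = q^2]: one factor [q^m] absorbs a linear factor and the other is left to the induction
    hypothesis, which is why it is stated for all [r]. *)
Lemma poly_geom_bounded k r : 0 <= r < 1 -> exists M, 0 <= M /\ forall m, (INR m + 1) ^ k * r ^ m <= M.
Proof.
  revert r; induction k as [|k IH]; intros r Hr.
  - exists 1; split; [lra|]; intros m; simpl; rewrite Rmult_1_l.
    rewrite <- (pow1 m); apply pow_incr; lra.
  - destruct (sqrt_unit r Hr) as [Hq Eq]; set (q := sqrt r) in *.
    destruct (IH q Hq) as [M [HM BM]], (linear_geom_bounded q Hq) as [N [HN BN]].
    exists (N * M); split; [now apply Rmult_le_pos|]; intros m.
    rewrite Eq, Rpow_mult_distr; simpl.
    replace ((INR m + 1) * (INR m + 1) ^ k * (q ^ m * q ^ m))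
      with (((INR m + 1) * q ^ m) * ((INR m + 1) ^ k * q ^ m)) by ring.
    assert (Q := pos_INR m); assert (Q2 : 0 <= q ^ m) by (apply pow_le; lra).
    apply Rmult_le_compat; auto; apply Rmult_le_pos; auto; [lra | apply pow_le; lra].
Qed.

Lemma poly_geom_summable k r : 0 <= r < 1 ->
  exists M, 0 <= M /\ forall n, rsum (fun m => (INR m + 1) ^ k * r ^ m) n <= M.
Proof.
  intros Hr; destruct (sqrt_unit r Hr) as [Hq Eq]; set (q := sqrt r) in *.
  destruct (poly_geom_bounded k q Hq) as [M [HM BM]].
  exists (M * / (1 - q)); split.
  { apply Rmult_le_pos; [exact HM | left; apply Rinv_0_lt_compat; lra]. }
  intros n; apply Rle_trans with (M * rsum (fun m => q ^ m) n).
  - rewrite <- rsum_scal; apply rsum_le; intros m _; rewrite Eq, Rpow_mult_distr, <- Rmult_assoc.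
    apply Rmult_le_compat_r; [apply pow_le; lra | apply BM].
  - apply Rmult_le_compat_l; [exact HM | now apply rsum_geom].
Qed.

Lemma nnpow_sum5 p x1 x2 x3 x4 x5 : 0 < p -> 0 <= x1 -> 0 <= x2 -> 0 <= x3 -> 0 <= x4 -> 0 <= x5 ->
  nnpow (x1 + x2 + x3 + x4 + x5) p <=
  nnpow 2 p ^ 4 * (nnpow x1 p + nnpow x2 p + nnpow x3 p + nnpow x4 p + nnpow x5 p).
Proof.
  intros Hp H1 H2 H3 H4 H5.
  assert (D : 1 <= nnpow 2 p).
  { replace 1 with (nnpow 1 p); [apply nnpow_le; lra|].
    rewrite nnpow_pos by lra; apply Rpower_1_l. }
  set (d := nnpow 2 p) in *.
  assert (A1 := nnpow_ge_0 x1 p); assert (A2 := nnpow_ge_0 x2 p); assert (A3 := nnpow_ge_0 x3 p).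
  assert (A4 := nnpow_ge_0 x4 p); assert (A5 := nnpow_ge_0 x5 p).
  assert (P0 : 0 <= p) by lra.
  assert (H12 : 0 <= x1 + x2) by lra; assert (H123 : 0 <= x1 + x2 + x3) by lra.
  assert (H1234 : 0 <= x1 + x2 + x3 + x4) by lra.
  assert (I1 := nnpow_plus (x1 + x2 + x3 + x4) x5 p P0 H1234 H5).
  assert (I2 := nnpow_plus (x1 + x2 + x3) x4 p P0 H123 H4).
  assert (I3 := nnpow_plus (x1 + x2) x3 p P0 H12 H3).
  assert (I4 := nnpow_plus x1 x2 p P0 H1 H2).
  fold d in I1, I2, I3, I4.
  assert (G1 : forall x, 0 <= x -> x <= d * x) by (intros; nra).
  assert (G2 : forall x y, x <= y -> d * x <= d * y) by (intros; apply Rmult_le_compat_l; lra).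
  assert (K2 : nnpow (x1 + x2) p + nnpow x3 p <= d * (nnpow x1 p + nnpow x2 p + nnpow x3 p))
    by (specialize (G1 _ A3); lra).
  assert (K3 : nnpow (x1 + x2 + x3) p + nnpow x4 p
               <= d * (d * (nnpow x1 p + nnpow x2 p + nnpow x3 p + nnpow x4 p))).
  { assert (Q := G2 _ _ K2); assert (Q1 := G1 _ A4); assert (Q2 := G2 _ _ Q1); lra. }
  assert (K4 : nnpow (x1 + x2 + x3 + x4) p + nnpow x5 p
               <= d * (d * (d * (nnpow x1 p + nnpow x2 p + nnpow x3 p + nnpow x4 p + nnpow x5 p)))).
  { assert (Q := G2 _ _ K3); assert (Q1 := G1 _ A5); assert (Q2 := G2 _ _ Q1).
    assert (Q3 := G2 _ _ Q2); lra. }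
  eapply Rle_trans; [exact I1|]; eapply Rle_trans; [exact (G2 _ _ K4)|]; apply Req_le; ring.
Qed.

(** The comparison is linear between the means before taking roots, so the constant for the
    quasi-norms is [K^(1/p)]. Finiteness on the right is required because [real] would turn an
    infinite supremum into [0]. *)
Lemma gauge_bound p K (JU JV : forall r, 0 <= r < 1 -> R) : 0 < p -> 0 <= K ->
  (forall r Hr, 0 <= JV r Hr) -> (exists M, forall r Hr, JV r Hr <= M) ->
  (forall A, (forall r Hr, JV r Hr <= A) -> forall r Hr, JU r Hr <= K * A) ->
  real (Lub_Rbar (fun v => exists r Hr, v = nnpow (JU r Hr) (/ p))) <=
  nnpow K (/ p) * real (Lub_Rbar (fun v => exists r Hr, v = nnpow (JV r Hr) (/ p))).
Proof.
  intros Hp HK PV FV H; assert (Hp' := Rinv_0_lt_compat p Hp).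
  assert (Fin := proj2 (Hp_finite p JV Hp PV) FV).
  set (EV := fun v => exists r Hr, v = nnpow (JV r Hr) (/ p)) in *.
  set (EU := fun v => exists r Hr, v = nnpow (JU r Hr) (/ p)).
  assert (H0 : 0 <= 0 < 1) by lra.
  destruct (Lub_Rbar_correct EV) as [U _].
  assert (UV : forall r Hr, nnpow (JV r Hr) (/ p) <= real (Lub_Rbar EV)).
  { intros r Hr; assert (A := U (nnpow (JV r Hr) (/ p)) (ex_intro _ r (ex_intro _ Hr eq_refl))).
    destruct (Lub_Rbar EV); simpl in *; tauto. }
  set (l := real (Lub_Rbar EV)) in *; clearbody l.
  assert (Pl : 0 <= l) by (eapply Rle_trans; [|apply (UV 0 H0)]; apply nnpow_ge_0).
  (* The quantified bound [A] is instantiated with the [p]-th power of the quasi-norm on the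
     right. *)
  assert (BU : forall r Hr, JU r Hr <= K * nnpow l p).
  { apply H; intros r Hr; rewrite <- (nnpow_inv (JV r Hr) p Hp (PV r Hr)).
    apply nnpow_le; [lra | apply UV]. }
  assert (BU' : is_ub_Rbar EU (nnpow K (/ p) * l)).
  { intros v [r [Hr ->]]; simpl; apply Rle_trans with (nnpow (K * nnpow l p) (/ p)).
    - apply nnpow_le; [lra | apply BU].
    - rewrite nnpow_mult; [|exact HK | apply nnpow_ge_0].
      apply Rmult_le_compat_l; [apply nnpow_ge_0|].
      assert (E := nnpow_inv l (/ p) Hp' Pl); rewrite Rinv_inv in E; lra. }
  destruct (Lub_Rbar_correct EU) as [U' L']; specialize (L' _ BU').
  assert (A := U' (nnpow (JU 0 H0) (/ p)) (ex_intro _ 0 (ex_intro _ H0 eq_refl))).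
  destruct (Lub_Rbar EU); simpl in *; tauto.
Qed.

Section Comparison.
Context {Y : CompleteNormedModule C_AbsRing}.

(** A choice only in appearance: by [expands_unique] the sequence is determined whenever [F] is
    analytic. *)
Definition coef (F : disc -> Y) : nat -> Y :=
  epsilon (inhabits (fun _ => v0)) (fun a => expands F a 1).

Lemma coef_expands F : analytic Y F -> expands F (coef F) 1.
Proof. intros HF; exact (epsilon_spec (inhabits (fun _ => v0)) (fun a => expands F a 1) (analytic_expands F HF)). Qed.

Definition power_sum (h : nat -> Y) (z : disc) : Y := vtotal (fun n => vsc (proj1_sig z ^ n)%C (h n)).

Lemma power_sum_expands h : poly_growth h -> expands (power_sum h) h 1.
Proof.
  intros [C [k [HC Hh]]] z Hz; apply vtotal_correct.
  destruct (poly_geom_summable k (Cmod (proj1_sig z))) as [M [_ HM]]; [split; [apply Cmod_ge_0 | exact Hz]|].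
  apply (pser_ex h _ (Cmod (proj1_sig z)) (C * M)); [|lra].
  intros n; eapply Rle_trans; [|apply Rmult_le_compat_l; [exact HC | apply (HM n)]].
  rewrite <- rsum_scal; apply rsum_le; intros m _; rewrite <- Rmult_assoc.
  apply Rmult_le_compat_r; [apply pow_le, Cmod_ge_0 | apply Hh].
Qed.

Lemma power_sum_eq (F : disc -> Y) a : expands F a 1 -> power_sum a = F.
Proof.
  intros H; funext z; apply vtotal_eq.
  exact (H z (proj2_sig z)).
Qed.

Section Pair.
Context (F : disc -> Y) (f : smooth_torus -> Y).
Context (HF : expands F (fun m => f (psi m)) 1) (Hf : distribution Y f).

Let h (m : nat) : Y := f (psi m).
Let Pois r Hr t := convolution Y (poisson r) (poisson_kernel r Hr) f t.
Let Conj r Hr t := convolution Y (conj_poisson r) (conj_poisson_kernel r Hr) f t.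

Lemma vseries_0 : vseries (fun m => vsc (if Nat.eqb m 0 then RtoC 1 else RtoC 0) (h m)) (h 0).
Proof.
  rewrite <- (vsc_1 (h 0)).
  apply (vseries_single (fun m => vsc (if Nat.eqb m 0 then RtoC 1 else RtoC 0) (h m)) 0).
  intros [|k] Hk; [lia | apply vsc_0].
Qed.

Lemma circle_half t : circle (t + 1 / 2) = (- circle t)%C.
Proof.
  unfold circle; replace (2 * PI * (t + 1 / 2)) with (2 * PI * t + PI) by field.
  rewrite neg_cos, neg_sin; reflexivity.
Qed.

(* Even powers carry the nonnegative frequencies and odd powers the negative ones, up to
   one extra factor [conj z]. *)
Lemma kernel_coef_square a b c (q t : R) m :
  let z := (RtoC q * circle t)%C in let w := (RtoC q * circle (- t))%C in
  kernel_coef a b c (q * q) (2 * t) m =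
  (b / 2 * (z ^ m + (- z) ^ m) + c / 2 * w * (w ^ m - (- w) ^ m)
    + (a - b) * (if Nat.eqb m 0 then RtoC 1 else RtoC 0))%C.
Proof.
  intros z w.
  assert (Ez : (RtoC (q * q) * circle (2 * t) = z * z)%C).
  { unfold z; replace (2 * t) with (t + t) by ring; rewrite circle_add, RtoC_mult; ring. }
  assert (Ew : (RtoC (q * q) * circle (- (2 * t)) = w * w)%C).
  { unfold w; replace (- (2 * t)) with (- t + - t) by ring; rewrite circle_add, RtoC_mult; ring. }
  assert (Neg : forall (u : C) k, ((- u) ^ (2 * k) = u ^ (2 * k))%C).
  { intros u k; rewrite !Cpow_mult_r; f_equal; simpl; ring. }
  destruct (parity_case m) as [k [->| ->]].
  - rewrite kernel_coef_even, Ez, !Neg.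
    replace (Nat.eqb (2 * k) 0) with (Nat.eqb k 0) by (destruct k; reflexivity).
    replace ((z * z) ^ k)%C with (z ^ (2 * k))%C
      by (rewrite Cpow_mult_r; f_equal; simpl; ring).
    destruct k as [|k]; [simpl; field|].
    replace (Nat.eqb (S k) 0) with false by reflexivity.
    generalize (z ^ (2 * S k))%C (w ^ (2 * S k))%C; intros u v; field.
  - rewrite kernel_coef_odd, Ew.
    replace (Nat.eqb (2 * k + 1) 0) with false by (symmetry; apply Nat.eqb_neq; lia).
    rewrite !Cpow_add_r, !Neg.
    replace ((w * w) ^ S k)%C with (w ^ (2 * k) * (w * w))%C
      by (rewrite Cpow_mult_r; simpl; rewrite Cmult_1_r; ring).
    rewrite !Cpow_1_r; generalize (z ^ (2 * k))%C (w ^ (2 * k))%C; intros u v; field.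
Qed.

Lemma kernel_square_series a b c q Hq t l :
  vseries (fun m => vsc (kernel_coef a b c (q * q) (2 * t) m) (h m)) l ->
  l = vadd (vadd (vsc (b / 2)%C (vadd (F (disc_point q Hq t)) (F (disc_point q Hq (t + 1 / 2)))))
             (vsc (c / 2 * (RtoC q * circle (- t)))%C
                (vsub (F (disc_point q Hq (- t))) (F (disc_point q Hq (- t + 1 / 2))))))
           (vsc (a - b)%C (h 0)).
Proof.
  intros Hl; apply (vseries_unique _ _ _ Hl).
  assert (D := disc_expansion F _ HF q Hq).
  refine (vseries_ext _ _ _ _ (vseries_add _ _ _ _ (vseries_add _ _ _ _
    (vseries_sc (b / 2)%C _ _ (vseries_add _ _ _ _ (D t) (D (t + 1 / 2))))
    (vseries_sc (c / 2 * (RtoC q * circle (- t)))%C _ _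
       (vseries_add _ _ _ _ (D (- t)) (vseries_sc (Copp (RtoC 1)) _ _ (D (- t + 1 / 2))))))
    (vseries_sc (a - b)%C _ _ vseries_0))).
  intros m; cbv beta; rewrite kernel_coef_square, !circle_half.
  replace (RtoC q * - circle t)%C with (- (RtoC q * circle t))%C by ring.
  replace (RtoC q * - circle (- t))%C with (- (RtoC q * circle (- t)))%C by ring.
  fold (h m); vring.
Qed.

Lemma sq_lt q : 0 <= q < 1 -> 0 <= q * q < 1.
Proof. intros H; nra. Qed.

Lemma Pois_square q Hq Hr t : Pois (q * q) Hr (2 * t) =
  vadd (vsc (1 / 2)%C (vadd (F (disc_point q Hq t)) (F (disc_point q Hq (t + 1 / 2)))))
       (vsc (1 / 2 * (RtoC q * circle (- t)))%C
          (vsub (F (disc_point q Hq (- t))) (F (disc_point q Hq (- t + 1 / 2))))).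
Proof.
  etransitivity; [exact (kernel_square_series _ _ _ q Hq t _ (poisson_series (q * q) Hr f (2 * t) Hf)) | vring].
Qed.

(** The conjugate kernel annihilates frequency [0], which the even part of [F] contains; hence the
    subtracted [h 0]. *)
Lemma Conj_square q Hq Hr t : Conj (q * q) Hr (2 * t) =
  vsc (- Ci)%C (vsub (vsub (vsc (1 / 2)%C (vadd (F (disc_point q Hq t)) (F (disc_point q Hq (t + 1 / 2))))) (h 0))
       (vsc (1 / 2 * (RtoC q * circle (- t)))%C
          (vsub (F (disc_point q Hq (- t))) (F (disc_point q Hq (- t + 1 / 2)))))).
Proof.
  etransitivity; [exact (kernel_square_series _ _ _ q Hq t _ (conj_poisson_series (q * q) Hr f (2 * t) Hf))|].
  vlin; field.
Qed.

(** On the zero, positive and negative frequencies [P + i Q] has weights [1, 2, 0] and [P - i Q] has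
    [1, 0, 2]. Adding, respectively subtracting, [h 0] and halving leaves the two halves of [f]. The
    first is the even part of [F] at [z]; the second, read at [-t], is [z] times the odd part,
    whence the division by [z]. *)
Lemma disc_from_torus q Hq Hr t : 0 < q ->
  F (disc_point q Hq t) =
  vadd (vsc (1 / 2)%C (vadd (vadd (Pois (q * q) Hr (2 * t)) (vsc Ci (Conj (q * q) Hr (2 * t)))) (h 0)))
       (vsc (/ (2 * (RtoC q * circle t)))%C
          (vsub (vsub (Pois (q * q) Hr (2 * - t)) (vsc Ci (Conj (q * q) Hr (2 * - t)))) (h 0))).
Proof.
  intros Pq; rewrite !(Pois_square q Hq), !(Conj_square q Hq), Ropp_involutive.
  assert (I2 : (Ci * Ci = - (1))%C) by (apply injective_projections; simpl; ring).
  assert (Nz : (RtoC q * circle t)%C <> RtoC 0).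
  { intros E; apply (f_equal Cmod) in E; rewrite Cmod_mult, Cmod_circle, Cmod_R, Cmod_0, Rabs_pos_eq in E; lra. }
  set (z := (RtoC q * circle t)%C) in *; set (w := (RtoC q * circle (- t))%C).
  set (A := F (disc_point q Hq t)); set (B := F (disc_point q Hq (t + 1 / 2))).
  set (A' := F (disc_point q Hq (- t))); set (B' := F (disc_point q Hq (- t + 1 / 2))).
  set (X := vsub A' B').
  assert (E : forall y : Y, vsc Ci (vsc (- Ci)%C y) = y).
  { intros y; rewrite vsc_assoc; replace (Ci * - Ci)%C with (- (Ci * Ci))%C by ring; rewrite I2; vring. }
  rewrite !E; clear E I2.
  vlin; field; exact Nz.
Qed.

Lemma disc_at_0 Hr t : F (disc_point 0 Hr t) = h 0.
Proof.
  apply (vseries_unique _ _ _ (disc_expansion F _ HF 0 Hr t)).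
  refine (vseries_ext _ _ _ _ vseries_0); intros m; fold (h m).
  replace (RtoC 0 * circle t)%C with (RtoC 0) by ring; destruct m as [|m]; simpl; f_equal; ring.
Qed.

Lemma torus_at_0 Hr t : Pois 0 Hr t = h 0.
Proof.
  assert (H0 : 0 <= 0 < 1) by lra.
  assert (E := Pois_square 0 H0 (sq_lt 0 H0) (t / 2)).
  rewrite !disc_at_0 in E; replace (2 * (t / 2)) with t in E by field.
  transitivity (Pois (0 * 0) (sq_lt 0 H0) t).
  - unfold Pois, convolution; f_equal; apply smooth_torus_eq; intros s; simpl; now rewrite Rmult_0_l.
  - rewrite E; vlin; field.
Qed.

Lemma convolution_periodic k Hk t : convolution Y k Hk f (t + 1) = convolution Y k Hk f t.
Proof.
  unfold convolution; f_equal; apply smooth_torus_eq; intros s; simpl; f_equal.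
  replace (t + 1 - s) with (t - s + 1) by ring; apply Hk.
Qed.

(** * Means of order p on circles, and their comparison *)

Context (p : R) (Hp0 : 0 < p).

Let mu (u : R -> Y) : R := pmean (fun t => nnpow (vn (u t)) p).

Let cont (u : R -> Y) : Prop := forall t, continuous u t.
Let per (u : R -> Y) : Prop := forall t, u (t + 1) = u t.

Lemma nnpow_vn_cont u : cont u -> forall t, continuous (fun t => nnpow (vn (u t)) p) t.
Proof. intros H t; exact (nnpow_norm_continuous u p t Hp0 (H t)). Qed.

Lemma mu_shift u c : cont u -> per u -> mu (fun t => u (t + c)) = mu u.
Proof.
  intros Cu Pu; apply (pmean_shift (fun t => nnpow (vn (u t)) p) (nnpow_vn_cont u Cu)).
  intros t; now rewrite Pu.
Qed.

Lemma mu_opp u : cont u -> per u -> mu (fun t => u (- t)) = mu u.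
Proof.
  intros Cu Pu; apply (pmean_opp (fun t => nnpow (vn (u t)) p) (nnpow_vn_cont u Cu)).
Qed.

Lemma mu_double u : cont u -> per u -> mu (fun t => u (2 * t)) = mu u.
Proof.
  intros Cu Pu; apply (pmean_double (fun t => nnpow (vn (u t)) p) (nnpow_vn_cont u Cu)).
  intros t; now rewrite Pu.
Qed.

Lemma cont_arg u (v : R -> R) : (forall t, ex_derive v t) -> cont u -> cont (fun t => u (v t)).
Proof.
  intros Hv Cu t; apply (continuous_comp v u); [apply (ex_derive_continuous v), Hv | apply Cu].
Qed.
Lemma cont_plus_arg u b : cont u -> cont (fun t => u (t + b)).
Proof. apply (cont_arg u (fun t => t + b)); intros t; auto_derive; trivial. Qed.
Lemma cont_scal_arg u a : cont u -> cont (fun t => u (a * t)).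
Proof. apply (cont_arg u (fun t => a * t)); intros t; auto_derive; trivial. Qed.
Lemma cont_opp_arg u : cont u -> cont (fun t => u (- t)).
Proof. apply (cont_arg u Ropp); intros t; auto_derive; trivial. Qed.

Lemma mu_sum5 (K : R) (u u1 u2 u3 u4 : R -> Y) (x : Y) : 0 <= K ->
  cont u -> cont u1 -> cont u2 -> cont u3 -> cont u4 ->
  (forall t, vn (u t) <= K * (vn (u1 t) + vn (u2 t) + vn (u3 t) + vn (u4 t) + vn x)) ->
  mu u <= nnpow K p * nnpow 2 p ^ 4 * (mu u1 + mu u2 + mu u3 + mu u4 + nnpow (vn x) p).
Proof.
  intros HK Cu C1 C2 C3 C4 H.
  assert (N1 := nnpow_vn_cont _ C1); assert (N2 := nnpow_vn_cont _ C2).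
  assert (N3 := nnpow_vn_cont _ C3); assert (N4 := nnpow_vn_cont _ C4).
  assert (N5 : forall t : R, continuous (fun _ : R => nnpow (vn x) p) t) by (intros; apply continuous_const).
  assert (Pl : forall a b : R -> R, (forall t, continuous a t) -> (forall t, continuous b t) ->
                 forall t, continuous (fun t => a t + b t) t).
  { intros a b Ha Hb t; exact (continuous_plus (V := R_NormedModule) _ _ t (Ha t) (Hb t)). }
  assert (N12 := Pl _ _ N1 N2); assert (N123 := Pl _ _ N12 N3).
  assert (N1234 := Pl _ _ N123 N4); assert (N12345 := Pl _ _ N1234 N5).
  set (e := fun (v : R -> Y) (t : R) => nnpow (vn (v t)) p).
  assert (E : mu u1 + mu u2 + mu u3 + mu u4 + nnpow (vn x) p =
     pmean (fun t => e u1 t + e u2 t + e u3 t + e u4 t + nnpow (vn x) p)).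
  { assert (Q1 := pmean_plus (fun t => e u1 t + e u2 t + e u3 t + e u4 t) (fun _ => nnpow (vn x) p) N1234 N5).
    assert (Q2 := pmean_plus (fun t => e u1 t + e u2 t + e u3 t) (e u4) N123 N4).
    assert (Q3 := pmean_plus (fun t => e u1 t + e u2 t) (e u3) N12 N3).
    assert (Q4 := pmean_plus (e u1) (e u2) N1 N2).
    assert (Q5 := pmean_const (nnpow (vn x) p)).
    change (mu u1) with (pmean (e u1)); change (mu u2) with (pmean (e u2)).
    change (mu u3) with (pmean (e u3)); change (mu u4) with (pmean (e u4)).
    cbv beta in Q1, Q2, Q3, Q5; lra. }
  rewrite E, <- (pmean_scal _ (fun t => e u1 t + e u2 t + e u3 t + e u4 t + nnpow (vn x) p) N12345).
  apply pmean_le.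
  - now apply nnpow_vn_cont.
  - intros t; exact (continuous_scal_r (V := R_NormedModule) _ _ t (N12345 t)).
  - intros t; eapply Rle_trans; [apply nnpow_le; [lra | apply H]|].
    assert (V1 := vn_ge_0 (u1 t)); assert (V2 := vn_ge_0 (u2 t)); assert (V3 := vn_ge_0 (u3 t)).
    assert (V4 := vn_ge_0 (u4 t)); assert (V5 := vn_ge_0 x).
    rewrite nnpow_mult by lra; rewrite Rmult_assoc; apply Rmult_le_compat_l; [apply nnpow_ge_0|].
    now apply nnpow_sum5.
Qed.

Lemma mu_ge_0 u : cont u -> 0 <= mu u.
Proof. intros Cu; apply pmean_ge_0; [now apply nnpow_vn_cont | intros; apply nnpow_ge_0]. Qed.

Lemma disc_circle_cont q Hq : cont (fun t => F (disc_point q Hq t)).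
Proof. intros t; exact (disc_cont F _ HF q Hq t). Qed.
Lemma disc_circle_per q Hq : per (fun t => F (disc_point q Hq t)).
Proof. intros t; now rewrite disc_point_periodic. Qed.
Lemma conv_cont k Hk : cont (convolution Y k Hk f).
Proof. intros t; now apply convolution_continuous. Qed.

Lemma mu_const x : mu (fun _ => x) = nnpow (vn x) p.
Proof. exact (pmean_const (nnpow (vn x) p)). Qed.

Lemma vn_scal_le (c : C) (x : Y) : Cmod c <= 1 -> vn (vsc c x) <= vn x.
Proof.
  intros H; rewrite vn_sc; rewrite <- (Rmult_1_l (vn x)) at 2.
  apply Rmult_le_compat_r; [apply vn_ge_0 | exact H].
Qed.

Lemma vn_sub_le (x y : Y) : vn (vsub x y) <= vn x + vn y.
Proof.
  unfold vsub; eapply Rle_trans; [apply vn_triangle|]; apply Rplus_le_compat_l.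
  rewrite vn_sc, Cmod_opp, Cmod_1; lra.
Qed.

Lemma Cmod_half : Cmod (1 / 2)%C = 1 / 2.
Proof. replace (1 / 2)%C with (RtoC (1 / 2)) by (rewrite RtoC_div; reflexivity || lra); rewrite Cmod_R, Rabs_pos_eq; lra. Qed.

Definition torus_mean r Hr : R :=
  pmean (fun t => nnpow (vn (Pois r Hr t)) p + nnpow (vn (Conj r Hr t)) p).

Lemma torus_mean_split r Hr : torus_mean r Hr = mu (Pois r Hr) + mu (Conj r Hr).
Proof.
  apply pmean_plus; apply nnpow_vn_cont; apply conv_cont.
Qed.

(** Two kernels with five terms each, every term having mean at most [A]; [nnpow 2 p ^ 4] is the
    cost of splitting a sum of five terms. *)
Definition upper_const : R := 10 * nnpow 2 p ^ 4.

Lemma torus_le_disc A : (forall r Hr, mu (fun t => F (disc_point r Hr t)) <= A) ->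
  forall r Hr, torus_mean r Hr <= upper_const * A.
Proof.
  intros HA r Hr; rewrite torus_mean_split.
  assert (H0 : 0 <= 0 < 1) by lra.
  (* At radius [0] the function is constant, so its mean is exactly this power. *)
  assert (N0 : nnpow (vn (h 0)) p <= A).
  { rewrite <- mu_const; eapply Rle_trans; [|apply (HA 0 H0)]; apply Req_le.
    unfold mu; f_equal; funext t; now rewrite disc_at_0. }
  destruct (sqrt_unit r Hr) as [Hq Eq]; set (q := sqrt r) in *; clearbody q; subst r.
  set (u := fun t => F (disc_point q Hq t)).
  assert (Cu : cont u) by apply disc_circle_cont; assert (Pu : per u) by apply disc_circle_per.
  set (u2 := fun t => u (t + 1 / 2)).
  assert (C2 : cont u2) by now apply cont_plus_arg.
  assert (P2 : per u2) by (intros t; unfold u2; replace (t + 1 + 1 / 2) with (t + 1 / 2 + 1) by ring; apply Pu).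
  set (u3 := fun t => u (- t)); set (u4 := fun t => u2 (- t)).
  assert (C3 : cont u3) by now apply cont_opp_arg.
  assert (C4 : cont u4) by now apply cont_opp_arg.
  assert (M2 : mu u2 = mu u) by now apply mu_shift.
  assert (M3 : mu u3 = mu u) by now apply mu_opp.
  assert (M4 : mu u4 = mu u) by (rewrite <- M2; now apply mu_opp).
  assert (MA : mu u <= A) by apply HA.
  assert (One : nnpow 1 p = 1).
  { rewrite nnpow_pos by lra; apply Rpower_1_l. }
  assert (Hc : forall t, Cmod (1 / 2 * (RtoC q * circle (- t)))%C <= 1 / 2).
  { intros t; rewrite !Cmod_mult, Cmod_half, Cmod_circle, Cmod_R, Rabs_pos_eq; lra. }
  assert (D : 0 <= nnpow 2 p ^ 4) by (apply pow_le, nnpow_ge_0).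
  assert (Base : forall t, vn (vsc (1 / 2)%C (vadd (u t) (u2 t))) <= vn (u t) + vn (u2 t)).
  { intros t; rewrite vn_sc, Cmod_half; assert (T := vn_triangle (u t) (u2 t)).
    assert (V := vn_ge_0 (vadd (u t) (u2 t))); lra. }
  assert (Base2 : forall t, vn (vsc (1 / 2 * (RtoC q * circle (- t)))%C (vsub (u3 t) (u4 t))) <= vn (u3 t) + vn (u4 t)).
  { intros t; eapply Rle_trans; [apply vn_scal_le; specialize (Hc t); lra | apply vn_sub_le]. }
  assert (B : forall k Hk, (forall t, vn (convolution Y k Hk f (2 * t)) <=
      vn (u t) + vn (u2 t) + vn (u3 t) + vn (u4 t) + vn (h 0)) ->
    mu (convolution Y k Hk f) <= nnpow 1 p * nnpow 2 p ^ 4 * (mu u + mu u2 + mu u3 + mu u4 + nnpow (vn (h 0)) p)).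
  { intros k Hk Hb; rewrite <- mu_double by (apply conv_cont || (intros t; apply convolution_periodic)).
    apply mu_sum5; auto; [lra | apply cont_scal_arg, conv_cont|].
    intros t; rewrite Rmult_1_l; apply Hb. }
  assert (BP : mu (Pois (q * q) Hr) <= nnpow 1 p * nnpow 2 p ^ 4 * (mu u + mu u2 + mu u3 + mu u4 + nnpow (vn (h 0)) p)).
  { apply B; intros t; eapply Rle_trans; [apply Req_le, f_equal, (Pois_square q Hq)|].
    eapply Rle_trans; [apply vn_triangle|].
    eapply Rle_trans; [exact (Rplus_le_compat _ _ _ _ (Base t) (Base2 t))|].
    assert (V := vn_ge_0 (h 0)); lra. }
  assert (BQ : mu (Conj (q * q) Hr) <= nnpow 1 p * nnpow 2 p ^ 4 * (mu u + mu u2 + mu u3 + mu u4 + nnpow (vn (h 0)) p)).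
  { apply B; intros t; eapply Rle_trans; [apply Req_le, f_equal, (Conj_square q Hq)|].
    rewrite vn_sc, Cmod_opp, Cmod_Ci, Rmult_1_l.
    eapply Rle_trans; [apply vn_sub_le|].
    eapply Rle_trans; [apply Rplus_le_compat_r, vn_sub_le|].
    eapply Rle_trans; [exact (Rplus_le_compat _ _ _ _ (Rplus_le_compat_r (vn (h 0)) _ _ (Base t)) (Base2 t))|]; lra. }
  rewrite One, Rmult_1_l, M2, M3, M4 in BP, BQ.
  assert (L : nnpow 2 p ^ 4 * (mu u + mu u + mu u + mu u + nnpow (vn (h 0)) p) <= nnpow 2 p ^ 4 * (5 * A)).
  { apply Rmult_le_compat_l; lra. }
  unfold upper_const; lra.
Qed.

(** For radii at least [1/4] the weights in [disc_from_torus] are [1/2] and at most [2], so [h 0]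
    receives at most [5/2]; [3] exceeds them all. The last [3] counts the total mean twice, at [t]
    and at [-t], and [h 0] once. *)
Definition outer_const : R := nnpow 3 p * nnpow 2 p ^ 4 * 3.

Lemma disc_le_torus_outer A : (forall r Hr, torus_mean r Hr <= A) ->
  forall q Hq, 1 / 4 <= q -> mu (fun t => F (disc_point q Hq t)) <= outer_const * A.
Proof.
  intros HA q Hq Q.
  assert (H0 : 0 <= 0 < 1) by lra.
  assert (N0 : nnpow (vn (h 0)) p <= A).
  { assert (B := HA 0 H0); rewrite torus_mean_split in B.
    assert (B2 := mu_ge_0 _ (conv_cont _ (conj_poisson_kernel 0 H0))); fold (Conj 0 H0) in B2.
    replace (mu (Pois 0 H0)) with (mu (fun _ => h 0)) in B.
    - rewrite mu_const in B; unfold mu in *; change (fun t : R => Conj 0 H0 t) with (Conj 0 H0) in *.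
      assert (E : 0 <= pmean (fun t => nnpow (vn (Conj 0 H0 t)) p)) by exact B2; lra.
    - unfold mu; f_equal; funext t; now rewrite torus_at_0. }
  set (Hr := sq_lt q Hq).
  set (P := Pois (q * q) Hr); set (K := Conj (q * q) Hr).
  assert (CP : cont P) by apply conv_cont; assert (CK : cont K) by apply conv_cont.
  assert (PP : per P) by (intros t; apply convolution_periodic).
  assert (PK : per K) by (intros t; apply convolution_periodic).
  set (P2 := fun t => P (2 * t)); set (K2 := fun t => K (2 * t)).
  assert (CP2 : cont P2) by now apply cont_scal_arg.
  assert (CK2 : cont K2) by now apply cont_scal_arg.
  assert (PP2 : per P2).
  { intros t; unfold P2; replace (2 * (t + 1)) with (2 * t + 1 + 1) by ring; now rewrite !PP. }
  assert (PK2 : per K2).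
  { intros t; unfold K2; replace (2 * (t + 1)) with (2 * t + 1 + 1) by ring; now rewrite !PK. }
  assert (M1 : mu P2 = mu P) by now apply mu_double.
  assert (M2 : mu K2 = mu K) by now apply mu_double.
  assert (M3 : mu (fun t => P2 (- t)) = mu P) by (rewrite <- M1; now apply mu_opp).
  assert (M4 : mu (fun t => K2 (- t)) = mu K) by (rewrite <- M2; now apply mu_opp).
  assert (MA : mu P + mu K <= A).
  { assert (B := HA (q * q) Hr); rewrite torus_mean_split in B; exact B. }
  assert (B : mu (fun t => F (disc_point q Hq t)) <= nnpow 3 p * nnpow 2 p ^ 4 *
     (mu P2 + mu K2 + mu (fun t => P2 (- t)) + mu (fun t => K2 (- t)) + nnpow (vn (h 0)) p)).
  { apply mu_sum5; auto; [lra | apply disc_circle_cont | now apply cont_opp_arg | now apply cont_opp_arg|].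
    intros t; rewrite (disc_from_torus q Hq Hr t) by lra.
    eapply Rle_trans; [apply vn_triangle|].
    rewrite !vn_sc, Cmod_half.
    assert (X1 := vn_triangle (vadd (Pois (q * q) Hr (2 * t)) (vsc Ci (Conj (q * q) Hr (2 * t)))) (h 0)).
    assert (X2 := vn_triangle (Pois (q * q) Hr (2 * t)) (vsc Ci (Conj (q * q) Hr (2 * t)))).
    assert (X3 := vn_sub_le (vsub (Pois (q * q) Hr (2 * - t)) (vsc Ci (Conj (q * q) Hr (2 * - t)))) (h 0)).
    assert (X4 := vn_sub_le (Pois (q * q) Hr (2 * - t)) (vsc Ci (Conj (q * q) Hr (2 * - t)))).
    rewrite vn_sc, Cmod_Ci, Rmult_1_l in X2, X4.
    fold P K in X1, X2, X3, X4 |- *; unfold P2, K2.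
    assert (V1 := vn_ge_0 (P (2 * t))); assert (V2 := vn_ge_0 (K (2 * t))).
    assert (V3 := vn_ge_0 (P (2 * - t))); assert (V4 := vn_ge_0 (K (2 * - t))); assert (V5 := vn_ge_0 (h 0)).
    assert (Nz : (2 * (RtoC q * circle t))%C <> RtoC 0).
    { intros E; apply (f_equal Cmod) in E; rewrite Cmod_0, !Cmod_mult, Cmod_circle, !Cmod_R, !Rabs_pos_eq in E; lra. }
    assert (Hi : Cmod (/ (2 * (RtoC q * circle t)))%C <= 2).
    { rewrite Cmod_inv, !Cmod_mult, Cmod_circle, !Cmod_R, !Rabs_pos_eq by (lra || exact Nz).
      replace 2 with (/ (1 / 2)) at 2 by field; apply Rinv_le_contravar; lra. }
    set (Z := vn (vsub (vsub (P (2 * - t)) (vsc Ci (K (2 * - t)))) (h 0))) in *.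
    assert (Z0 : 0 <= Z) by apply vn_ge_0.
    assert (Hz : Cmod (/ (2 * (RtoC q * circle t)))%C * Z <= 2 * Z) by (apply Rmult_le_compat_r; lra).
    lra. }
  rewrite M1, M2, M3, M4 in B; eapply Rle_trans; [exact B|]; unfold outer_const.
  replace (nnpow 3 p * nnpow 2 p ^ 4 * 3 * A) with (nnpow 3 p * nnpow 2 p ^ 4 * (3 * A)) by ring.
  apply Rmult_le_compat_l; [apply Rmult_le_pos; [apply nnpow_ge_0 | apply pow_le, nnpow_ge_0] | lra].
Qed.

End Pair.

(** From radius [1/4] on, [outer_const] does it. Inside, those outer means already bound the
    coefficients by a polynomial times the power [1/p] of the bound; summing against [(1/4)^m] gives
    a pointwise estimate whose [p]-th power is linear in [A] again. *)
Lemma disc_le_torus (p : R) (Hp0 : 0 < p) (Hp1 : p <= 1) : exists K, 0 <= K /\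
  forall (F : disc -> Y) f, expands F (fun m => f (psi m)) 1 -> distribution Y f ->
  forall A, (forall r Hr, torus_mean f p r Hr <= A) ->
  forall r Hr, pmean (fun t => nnpow (vn (F (disc_point r Hr t))) p) <= K * A.
Proof.
  destruct (Rinv_le_INR p Hp0) as [k Hk].
  destruct (poly_geom_summable (S k) (1 / 4)) as [M [HM BM]]; [lra|].
  (* The first two factors are those of [coef_growth], [2 ^ S k] replaces [m + 2] by [m + 1] up to a
     factor [2], and [M] sums the polynomial against [(1/4)^m]. *)
  set (D := nnpow (Rpower 2 (/ p)) (/ p) * 2 ^ k * 2 ^ S k * M).
  assert (D0 : 0 <= D).
  { unfold D; repeat apply Rmult_le_pos; try apply nnpow_ge_0; try (apply pow_le; lra); lra. }
  set (B := outer_const p).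
  assert (B0 : 0 <= B).
  { unfold B, outer_const; repeat apply Rmult_le_pos; try apply nnpow_ge_0; try (apply pow_le, nnpow_ge_0); lra. }
  exists (B + nnpow D p * B); split.
  { apply Rplus_le_le_0_compat; [exact B0|]; apply Rmult_le_pos; [apply nnpow_ge_0 | exact B0]. }
  intros F f HF Hf A HA r Hr.
  assert (Out := disc_le_torus_outer F f HF Hf p Hp0 A HA); fold B in Out.
  assert (BA : 0 <= B * A).
  { eapply Rle_trans; [|apply (Out (1 / 2) ltac:(lra)); lra].
    apply pmean_ge_0; [|intros; apply nnpow_ge_0].
    intros t; exact (nnpow_norm_continuous _ p t Hp0 (disc_cont F _ HF _ _ t)). }
  assert (BA2 : 0 <= nnpow D p * (B * A)) by (apply Rmult_le_pos; [apply nnpow_ge_0 | exact BA]).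
  replace ((B + nnpow D p * B) * A) with (B * A + nnpow D p * (B * A)) by ring.
  destruct (Rle_lt_dec (1 / 4) r) as [Hr4|Hr4].
  - specialize (Out r Hr Hr4); lra.
  - assert (Pt : forall t, vn (F (disc_point r Hr t)) <= D * nnpow (B * A) (/ p)).
    { intros t; apply (vseries_norm_le _ _ _ (disc_expansion F _ HF r Hr t)).
      apply (pser_abs_bound _ _ (1 / 4)).
      2:{ rewrite Cmod_mult, Cmod_circle, Cmod_R, Rabs_pos_eq; lra. }
      intros n.
      set (E := nnpow (Rpower 2 (/ p)) (/ p) * 2 ^ k * 2 ^ S k * nnpow (B * A) (/ p)).
      apply Rle_trans with (E * rsum (fun m => (INR m + 1) ^ S k * (1 / 4) ^ m) n).
      + rewrite <- rsum_scal; apply rsum_le; intros m _.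
        rewrite <- Rmult_assoc; apply Rmult_le_compat_r; [apply pow_le; lra|].
        eapply Rle_trans; [apply (coef_growth p Hp0 Hp1 F _ (B * A) HF Out m k Hk)|].
        unfold E.
        replace (nnpow (Rpower 2 (/ p)) (/ p) * 2 ^ k * 2 ^ S k * nnpow (B * A) (/ p) * (INR m + 1) ^ S k)
          with (nnpow (Rpower 2 (/ p)) (/ p) * 2 ^ k * (2 ^ S k * (INR m + 1) ^ S k) * nnpow (B * A) (/ p)) by ring.
        rewrite <- Rpow_mult_distr.
        assert (Pm := pos_INR m).
        apply Rmult_le_compat_r; [apply nnpow_ge_0|]; apply Rmult_le_compat_l.
        * apply Rmult_le_pos; [apply nnpow_ge_0 | apply pow_le; lra].
        * apply pow_incr; lra.
      + replace (D * nnpow (B * A) (/ p)) with (E * M) by (unfold D, E; ring).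
        apply Rmult_le_compat_l; [|apply BM].
        unfold E; repeat apply Rmult_le_pos; try apply nnpow_ge_0; try (apply pow_le; lra); lra. }
    apply Rle_trans with (nnpow D p * (B * A)); [|lra].
    rewrite <- (nnpow_inv (B * A) p Hp0 BA) at 1.
    rewrite <- nnpow_mult by (exact D0 || apply nnpow_ge_0).
    rewrite <- (pmean_const (nnpow (D * nnpow (B * A) (/ p)) p)).
    apply pmean_le.
    + intros t; exact (nnpow_norm_continuous _ p t Hp0 (disc_cont F _ HF _ _ t)).
    + intros t; apply continuous_const.
    + intros t; apply nnpow_le; [lra | apply Pt].
Qed.

Lemma coef_poly_growth (p : R) (Hp0 : 0 < p) (Hp1 : p <= 1) (F : disc -> Y) a A :
  expands F a 1 -> (forall r Hr, pmean (fun t => nnpow (vn (F (disc_point r Hr t))) p) <= A) ->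
  poly_growth a.
Proof.
  intros HF HA.
  destruct (Rinv_le_INR p Hp0) as [k Hk].
  set (E := nnpow (Rpower 2 (/ p)) (/ p) * 2 ^ k).
  assert (E0 : 0 <= E) by (apply Rmult_le_pos; [apply nnpow_ge_0 | apply pow_le; lra]).
  exists (E * 2 ^ S k * nnpow A (/ p)), (S k); split.
  - repeat apply Rmult_le_pos; try apply nnpow_ge_0; try (apply pow_le; lra); lra.
  - intros m; eapply Rle_trans; [apply (coef_growth p Hp0 Hp1 F a A HF (fun r Hr _ => HA r Hr) m k Hk)|].
    fold E; assert (Pm := pos_INR m).
    replace (E * 2 ^ S k * nnpow A (/ p) * (INR m + 1) ^ S k)
      with (E * (2 ^ S k * (INR m + 1) ^ S k) * nnpow A (/ p)) by ring.
    rewrite <- Rpow_mult_distr.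
    apply Rmult_le_compat_r; [apply nnpow_ge_0|]; apply Rmult_le_compat_l; [exact E0|].
    apply pow_incr; lra.
Qed.

End Comparison.

(** * The two mutually inverse bounded maps *)

Section Isomorphism.
Context (Y : CompleteNormedModule C_AbsRing) (p : R) (Hp0 : 0 < p) (Hp1 : p <= 1).

Definition disc_mean (F : disc -> Y) r (Hr : 0 <= r < 1) : R :=
  pmean (fun t => nnpow (vn (F (disc_point r Hr t))) p).

Lemma disc_mean_ge_0 F r Hr : analytic Y F -> 0 <= disc_mean F r Hr.
Proof.
  intros HF; apply pmean_ge_0; [|intros; apply nnpow_ge_0].
  intros t; exact (nnpow_norm_continuous _ p t Hp0 (Hp_disc_continuous Y F r Hr t HF)).
Qed.

Lemma torus_mean_ge_0 f r Hr : distribution Y f -> 0 <= torus_mean f p r Hr.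
Proof.
  intros Hf; rewrite (torus_mean_split f Hf p Hp0).
  apply Rplus_le_le_0_compat; apply pmean_ge_0; try (intros; apply nnpow_ge_0);
    intros t; refine (nnpow_norm_continuous _ p t Hp0 _); now apply convolution_continuous.
Qed.

Lemma disc_norm_finite (F : analytic_functions Y) :
  Rbar_lt (Hp_disc_norm Y p F) p_infty <-> exists M, forall r Hr, disc_mean (proj1_sig F) r Hr <= M.
Proof. exact (Hp_disc_finite Y p Hp0 F). Qed.

Lemma torus_norm_finite (f : distributions Y) :
  Rbar_lt (Hp_torus_norm Y p f) p_infty <-> exists M, forall r Hr, torus_mean (proj1_sig f) p r Hr <= M.
Proof.
  apply (Hp_finite p (torus_mean (proj1_sig f) p) Hp0).
  intros r Hr; apply torus_mean_ge_0, (proj2_sig f).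
Qed.

Lemma coef_growth_Hp (x : Hp_disc Y p Hp0) : poly_growth (coef (proj1_sig (proj1_sig x))).
Proof.
  destruct (proj1 (disc_norm_finite (proj1_sig x)) (proj2_sig x)) as [A HA].
  exact (coef_poly_growth p Hp0 Hp1 _ _ A (coef_expands _ (proj2_sig (proj1_sig x))) HA).
Qed.

Lemma dist_of_coef_expands (F : disc -> Y) : analytic Y F -> poly_growth (coef F) ->
  expands F (fun m => dist_of (coef F) (psi m)) 1.
Proof.
  intros HF Hg; replace (fun m => dist_of (coef F) (psi m)) with (coef F).
  - now apply coef_expands.
  - funext m; symmetry; now apply dist_of_psi.
Qed.

Definition to_dist (x : Hp_disc Y p Hp0) : distributions Y :=
  exist _ (dist_of (coef (proj1_sig (proj1_sig x)))) (dist_of_distribution _ (coef_growth_Hp x)).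

Lemma to_dist_le (x : Hp_disc Y p Hp0) A :
  (forall r Hr, disc_mean (proj1_sig (proj1_sig x)) r Hr <= A) ->
  forall r Hr, torus_mean (proj1_sig (to_dist x)) p r Hr <= upper_const p * A.
Proof.
  apply (torus_le_disc (proj1_sig (proj1_sig x))); [|apply (proj2_sig (to_dist x)) | exact Hp0].
  apply dist_of_coef_expands; [apply (proj2_sig (proj1_sig x)) | apply coef_growth_Hp].
Qed.

Lemma to_dist_finite (x : Hp_disc Y p Hp0) : Rbar_lt (Hp_torus_norm Y p (to_dist x)) p_infty.
Proof.
  apply torus_norm_finite.
  destruct (proj1 (disc_norm_finite (proj1_sig x)) (proj2_sig x)) as [A HA].
  exists (upper_const p * A); now apply to_dist_le.
Qed.

Definition to_torus (x : Hp_disc Y p Hp0) : Hp_torus Y p Hp0 := exist _ (to_dist x) (to_dist_finite x).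

Definition boundary_coef (y : Hp_torus Y p Hp0) (m : nat) : Y := proj1_sig (proj1_sig y) (psi m).

Lemma boundary_coef_growth y : poly_growth (boundary_coef y).
Proof. exact (dist_growth _ (proj2_sig (proj1_sig y))). Qed.

Definition to_analytic (y : Hp_torus Y p Hp0) : analytic_functions Y :=
  exist _ (power_sum (boundary_coef y))
    (expands_analytic _ _ (power_sum_expands _ (boundary_coef_growth y))).

Lemma to_analytic_finite (y : Hp_torus Y p Hp0) : Rbar_lt (Hp_disc_norm Y p (to_analytic y)) p_infty.
Proof.
  apply disc_norm_finite.
  destruct (proj1 (torus_norm_finite (proj1_sig y)) (proj2_sig y)) as [A HA].
  destruct (disc_le_torus (Y := Y) p Hp0 Hp1) as [K [_ HK]].
  exists (K * A); exact (HK _ _ (power_sum_expands _ (boundary_coef_growth y)) (proj2_sig (proj1_sig y)) A HA).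
Qed.

Definition to_disc (y : Hp_torus Y p Hp0) : Hp_disc Y p Hp0 := exist _ (to_analytic y) (to_analytic_finite y).

Lemma to_disc_to_torus x : to_disc (to_torus x) = x.
Proof.
  apply sub_eq, sub_eq.
  apply power_sum_eq; refine (dist_of_coef_expands _ _ (coef_growth_Hp x)).
  apply (proj2_sig (proj1_sig x)).
Qed.

Lemma to_torus_to_disc y : to_torus (to_disc y) = y.
Proof.
  apply sub_eq, sub_eq.
  change (dist_of (coef (power_sum (boundary_coef y))) = proj1_sig (proj1_sig y)).
  assert (E := power_sum_expands _ (boundary_coef_growth y)).
  rewrite (expands_unique _ _ _ (coef_expands _ (expands_analytic _ _ E)) E).
  apply dist_of_coefs, (proj2_sig (proj1_sig y)).
Qed.

Lemma to_disc_plus y z : to_disc (plus y z) = plus (to_disc y) (to_disc z).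
Proof.
  apply sub_eq, sub_eq; apply power_sum_eq; intros w Hw.
  assert (E1 := power_sum_expands _ (boundary_coef_growth y) w Hw).
  assert (E2 := power_sum_expands _ (boundary_coef_growth z) w Hw).
  refine (vseries_ext _ _ _ _ (vseries_add _ _ _ _ E1 E2)).
  intros n; rewrite <- vsc_plus_r; reflexivity.
Qed.

Lemma to_disc_scal (c : C_Ring) y : to_disc (scal c y) = scal c (to_disc y).
Proof.
  apply sub_eq, sub_eq; apply power_sum_eq; intros w Hw.
  assert (E1 := power_sum_expands _ (boundary_coef_growth y) w Hw).
  refine (vseries_ext _ _ _ _ (vseries_sc c _ _ E1)).
  intros n; rewrite vsc_assoc.
  transitivity (vsc (proj1_sig w ^ n)%C (vsc c (boundary_coef y n))); [|reflexivity].
  rewrite vsc_assoc; f_equal; apply Cmult_comm.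
Qed.

(** The inverse of a linear bijection is linear, so additivity is verified by series only for
    [to_disc], whose coefficients are values of the distribution and not chosen by [epsilon]. *)
Lemma to_torus_plus x x' : to_torus (plus x x') = plus (to_torus x) (to_torus x').
Proof.
  rewrite <- (to_torus_to_disc (plus (to_torus x) (to_torus x'))); f_equal.
  now rewrite to_disc_plus, !to_disc_to_torus.
Qed.

Lemma to_torus_scal (c : C_Ring) x : to_torus (scal c x) = scal c (to_torus x).
Proof.
  rewrite <- (to_torus_to_disc (scal c (to_torus x))); f_equal.
  now rewrite to_disc_scal, to_disc_to_torus.
Qed.

Lemma to_torus_bounded : exists M, forall x, gauge (Hp_torus Y p Hp0) (to_torus x) <= M * gauge (Hp_disc Y p Hp0) x.
Proof.
  exists (nnpow (upper_const p) (/ p)); intros x.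
  apply (gauge_bound p (upper_const p) (torus_mean (proj1_sig (to_dist x)) p)
          (disc_mean (proj1_sig (proj1_sig x))) Hp0).
  - unfold upper_const; apply Rmult_le_pos; [lra | apply pow_le, nnpow_ge_0].
  - intros r Hr; apply disc_mean_ge_0, (proj2_sig (proj1_sig x)).
  - apply disc_norm_finite, (proj2_sig x).
  - intros A HA; now apply to_dist_le.
Qed.

Lemma to_disc_bounded : exists M, forall y, gauge (Hp_disc Y p Hp0) (to_disc y) <= M * gauge (Hp_torus Y p Hp0) y.
Proof.
  destruct (disc_le_torus (Y := Y) p Hp0 Hp1) as [K [HK HB]].
  exists (nnpow K (/ p)); intros y.
  apply (gauge_bound p K (disc_mean (power_sum (boundary_coef y)))
          (torus_mean (proj1_sig (proj1_sig y)) p) Hp0 HK).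
  - intros r Hr; apply torus_mean_ge_0, (proj2_sig (proj1_sig y)).
  - apply torus_norm_finite, (proj2_sig y).
  - apply HB; [exact (power_sum_expands _ (boundary_coef_growth y)) | apply (proj2_sig (proj1_sig y))].
Qed.

End Isomorphism.

Theorem corollary3p11
  (Y : CompleteNormedModule C_AbsRing) (HY : regular Y)
  (p : R) (Hp0 : 0 < p) (Hp1 : p <= 1) :
  isomorphic (Hp_disc Y p Hp0) (Hp_torus Y p Hp0).
Proof.
  exists (to_torus Y p Hp0 Hp1), (to_disc Y p Hp0 Hp1); repeat split.
  - apply to_torus_plus.
  - apply to_torus_scal.
  - apply to_torus_bounded.
  - apply to_disc_plus.
  - apply to_disc_scal.
  - apply to_disc_bounded.
  - apply to_disc_to_torus.
  - apply to_torus_to_disc.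
Qed.
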